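(* For all $n\geq 1$, the $n$-th eigenvalue $\zeta_n(\tau)$ of the operator $\mathfrak{g}(\tau)=-\partial_r^2-\frac1r\partial_r+(r-\tau)^2$ on $L^2_r(\mathbb{R}_+)$ satisfies, as $\tau\to+\infty$, $$\zeta_n(\tau)=2n-1-\frac{1}{4\tau^2}+O\left(\frac{1}{\tau^3}\right).$$
   Context: $L^2_r(\mathbb{R}_+)$ is the space of functions on the half-line $\mathbb{R}_+$ that are square integrable for the weight $r\,\mathrm{d}r$, and $B^1_r(\mathbb{R}_+):=\{u\in L^2_r(\mathbb{R}_+):\ u'\in L^2_r(\mathbb{R}_+),\ ru\in L^2_r(\mathbb{R}_+)\}$. For $\tau\in\mathbb{R}$, $\mathfrak{g}(\tau):=-\partial_r^2-\frac1r\partial_r+(r-\tau)^2$ is the self-adjoint operator on $L^2_r(\mathbb{R}_+)$ associated with the quadratic form $\mathfrak{q}_\tau(u):=\int_{\mathbb{R}_+}\left(|u'(r)|^2+(r-\tau)^2|u(r)|^2\right)r\,\mathrm{d}r$ with form domain $B^1_r(\mathbb{R}_+)$; its domain is $\{u\in B^1_r(\mathbb{R}_+):\ u''\in L^2_r(\mathbb{R}_+),\ \frac1r u'\in L^2_r(\mathbb{R}_+),\ r^2u\in L^2_r(\mathbb{R}_+),\ (ru'(r))_{|r=0}=0\}$. It has compact resolvent, and $\zeta_n(\tau)$, $n\ge1$, denotes its $n$-th eigenvalue (in increasing order; the eigenvalues are simple). *)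

(* Defs.v *)
From HB Require Import structures.
From mathcomp Require Import all_boot all_order all_algebra.
From mathcomp Require Import all_classical all_reals all_analysis.
From mathcomp Require Import complex.

Set Implicit Arguments.
Unset Strict Implicit.
Unset Printing Implicit Defensive.

Import Order.TTheory GRing.Theory Num.Theory.
Import numFieldNormedType.Exports.
Import ComplexField.Normc.

Local Open Scope classical_set_scope.
Local Open Scope ring_scope.
Local Open Scope complex_scope.

Section RadialOperator.
Variable R : realType.
Implicit Types (u v w f : R -> R[i]) (tau l : R) (n : nat).

Local Notation mu := (@lebesgue_measure R).
Local Notation half_line := (`]0, +oo[%classic : set R).

(* L^2((0, +oo), r dr). Functions are not quotiented by a.e. equality: each
   element is given by a representative, whose values off (0, +oo) are
   irrelevant. *)
Definition L2r u : Prop :=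
  [/\ measurable_fun half_line (fun r => complex.Re (u r)),
      measurable_fun half_line (fun r => complex.Im (u r)) &
      mu.-integrable half_line (fun r => (normc (u r) ^+ 2 * r)%:E)].

(* v is the distributional derivative of u on (0, +oo), in the usual
   one-dimensional form: u is locally absolutely continuous on (0, +oo) and v
   (determined up to a null set) is locally integrable with
   u b - u a = \int_a^b v.  In particular u is the continuous representative
   of its class. *)
Definition real_derivative (f g : R -> R) : Prop :=
  forall a b : R, 0 < a -> a <= b ->
    mu.-integrable `[a, b]%classic (EFin \o g) /\
    f b - f a = \int[mu]_(r in `[a, b]%classic) g r.

Definition derivative u v : Prop :=
  real_derivative (fun r => complex.Re (u r)) (fun r => complex.Re (v r)) /\
  real_derivative (fun r => complex.Im (u r)) (fun r => complex.Im (v r)).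

Definition B1r u : Prop :=
  [/\ L2r u, (exists2 u1, derivative u u1 & L2r u1) &
      L2r (fun r => r%:C * u r)].

(* u belongs to the operator domain, with u' = u1 and u'' = u2.  Since
   [derivative u1 u2] makes u1 continuous on (0, +oo), the trace of r u'(r) at
   r = 0 is its limit as r -> 0+. *)
Definition g_domain u u1 u2 : Prop :=
  [/\ B1r u, derivative u u1 & derivative u1 u2] /\
  [/\ L2r u2, L2r (fun r => r^-1%:C * u1 r), L2r (fun r => (r ^+ 2)%:C * u r) &
      (fun r => r * normc (u1 r)) @ 0^'+ --> (0 : R)].

(* The graph of the operator: u is in the domain of g(tau) and g(tau) u = f
   in L^2. *)
Definition g_op tau u f : Prop :=
  exists u1 u2, g_domain u u1 u2 /\
    {ae mu, forall r, 0 < r ->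
      - u2 r - r^-1%:C * u1 r + ((r - tau) ^+ 2)%:C * u r = f r}.

(* Real l is no restriction, g(tau) being self-adjoint. *)
Definition g_eigenvalue tau l : Prop :=
  exists u, ~ {ae mu, forall r, 0 < r -> u r = 0} /\
    g_op tau u (fun r => l%:C * u r).

(* The eigenvalues of g(tau) are simple, so those below l are counted without
   multiplicity. *)
Definition nth_g_eigenvalue n tau l : Prop :=
  g_eigenvalue tau l /\
  ([set m | g_eigenvalue tau m /\ m < l] #= `I_n.-1)%card.

(* The n-th eigenvalue for n >= 1, with the conventional value 0 if there were
   none. *)
Definition zeta n tau : R := xget 0 [set l | nth_g_eigenvalue n tau l].

End RadialOperator.

(* Main.v *)
Require Import Defs.
From mathcomp Require Import finmap all_boot all_order all_algebra.
From mathcomp Require Import all_classical all_reals all_analysis.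
From mathcomp Require Import complex measurable_realfun.
From mathcomp Require Import ring lra.
Import Order.TTheory GRing.Theory Num.Theory.
Import numFieldNormedType.Exports.
Local Open Scope classical_set_scope.
Local Open Scope ring_scope.

(** Let [phi tau lam] be the solution of [(r u')' = r ((r - tau)^2 - lam) u] that
is regular at [0], normalised by [phi 0 = 1].  A real [lam] is an eigenvalue
of [g(tau)] if and only if [phi tau lam] decays at infinity
([decays_eigenvalue], [eigenvalue_decays]): an eigenfunction solves the
equation, and the trace condition [r u' --> 0] at the origin makes its
Wronskian with [phi] vanish, so it is a multiple of [phi].

The eigenvalues are located by oscillation.  Let N(lam) be the number of sign
changes of [phi tau lam] on [[0, +oo)].  By Sturm comparison, N increases by
at least one when [lam] increases past an eigenvalue
([eigenvalue_oscillates]).  Conversely, between two energies without an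
eigenvalue in between, the sign of [phi] near infinity, that is the parity of
N, does not change ([grows_constant]).  It is therefore enough to find
explicit numbers
  [p_d, q_d = 2d + 1 - 1/(4 tau^2) -/+ C / tau^3],  [d = 0, 1, ...],
such that N <= d for [lam <= p_d] and N >= d + 1 for [lam >= q_d]: then
[[p_d, q_d]] contains exactly one eigenvalue for each [d], and there are none
in the gaps, so the n-th eigenvalue lies in [[p_(n-1), q_(n-1)]]
([zeta_enclosed]).

The two bounds on N ([oscillates_le], [oscillates_ge]) are again Sturm
comparisons.  The function [sqrt r * phi] solves
[w'' = ((r - tau)^2 - lam - 1/(4 r^2)) w], which for [t = r - tau] bounded is
the equation of the harmonic oscillator at the energy [lam + 1/(4 tau^2)], up
to a term of order [tau^-3].  Its comparison functions are therefore the
Hermite functions [h_d = H_d exp(-t^2/2)], corrected where [|t|] is large,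
because there the error in [1/(4 r^2)] is no longer of order [tau^-3]:
 - for the bound from above, [h_d] is multiplied on [t < -M] by
   [exp(A (-M - t)^5 / 5)], which keeps the [d] zeros of [h_d], makes it a
   strict supersolution on [r >= tau/2], and gives it on [r = tau/2] a
   logarithmic derivative that is compatible with [phi], which is positive
   and increasing before this point;
 - for the bound from below, [h_d] is multiplied by the cutoff
   [1 - (|t| - M)_+^3 / S^3], which makes it vanish at [|t| = M + S].  Since
   [h_d] decays like a Gaussian, the cutoff costs nothing: it even adds to the
   strictness, up to a bounded error near [|t| = M].  The zeros of the result
   delimit [d + 1] intervals, in each of which [phi] has to change sign.
Throughout, [M] exceeds all zeros of [h_d] and [C] is a large constant. *)

Set Implicit Arguments.
Unset Strict Implicit.
Unset Printing Implicit Defensive.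

(** * Calculus on the real line *)

Section Calculus.
Variable R : realType.
Implicit Types (f g df dg : R -> R) (a b c x y : R).

Lemma isdD f g x a b : is_derive x 1 f a -> is_derive x 1 g b ->
  is_derive x 1 (fun y => f y + g y) (a + b).
Proof. by move=> fa gb; exact: is_deriveD. Qed.

Lemma isdB f g x a b : is_derive x 1 f a -> is_derive x 1 g b ->
  is_derive x 1 (fun y => f y - g y) (a - b).
Proof. by move=> fa gb; exact: is_deriveB. Qed.

Lemma isdN f x a : is_derive x 1 f a -> is_derive x 1 (fun y => - f y) (- a).
Proof. by move=> fa; exact: is_deriveN. Qed.

Lemma isdM f g x a b : is_derive x 1 f a -> is_derive x 1 g b ->
  is_derive x 1 (fun y => f y * g y) (a * g x + f x * b).
Proof.
move=> fa gb; apply: (@is_derive_eq _ _ _ _ _ _ _ _ (is_deriveM fa gb)).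
by rewrite /GRing.scale /= addrC mulrC.
Qed.

Lemma isd_cst x a : is_derive x 1 (fun=> a : R) 0.
Proof. exact: is_derive_cst. Qed.

Lemma isd_id x : is_derive x 1 (fun y : R => y) (1 : R).
Proof. exact: is_derive_id. Qed.

Lemma isdZ c f x a : is_derive x 1 f a ->
  is_derive x 1 (fun y => c * f y) (c * a).
Proof.
by move=> fa; apply: is_derive_eq (isdM (isd_cst x c) fa) _; rewrite mul0r add0r.
Qed.

Lemma isd_comp f g x a b : is_derive (g x) 1 f a -> is_derive x 1 g b ->
  is_derive x 1 (fun y => f (g y)) (a * b).
Proof. by move=> fa gb; exact: is_derive1_comp. Qed.

Lemma isd_exp g x b : is_derive x 1 g b ->
  is_derive x 1 (fun y => expR (g y)) (expR (g x) * b).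
Proof. by move=> gb; exact: (isd_comp (f := expR) (g := g)). Qed.

Lemma isd_expR_lin c x : is_derive x 1 (fun y => expR (c * y)) (expR (c * x) * c).
Proof.
apply: (isd_comp (f := expR) (g := fun y => c * y)).
by rewrite -[X in is_derive _ _ _ X]mulr1; apply: isdZ; exact: isd_id.
Qed.

Lemma isd_cts f x a : is_derive x 1 f a -> {for x, continuous f}.
Proof. by case=> fa _; exact/differentiable_continuous/derivable1_diffP. Qed.

Lemma isd_ext f g x a : f =1 g -> is_derive x 1 f a -> is_derive x 1 g a.
Proof. by move=> /funext ->. Qed.

Lemma cts_within f a b : (forall x, a <= x <= b -> {for x, continuous f}) ->
  {within `[a, b], continuous f}.
Proof.
move=> cf; apply: continuous_in_subspaceT => x.
by rewrite inE /= in_itv /=; exact: cf.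
Qed.

Lemma ivt0 f a b : a <= b -> (forall x, a <= x <= b -> {for x, continuous f}) ->
  f a * f b <= 0 -> exists2 c, a <= c <= b & f c = 0.
Proof.
move=> ab cf fab.
have [|c] := @IVT _ f a b 0 ab (cts_within cf).
  by case: (leP (f a) (f b)) => h; apply/andP; split => //=; nra.
by rewrite in_itv /=; exists c.
Qed.

Lemma mvt f df a b : a < b -> (forall x, a <= x <= b -> is_derive x 1 f (df x)) ->
  exists2 c, a < c < b & f b - f a = df c * (b - a).
Proof.
move=> ab fdf; have [|x xab|c] := @MVT _ f df a b ab.
- by move=> x; rewrite in_itv /= => /andP[ax xb]; apply: fdf; rewrite !ltW.
- by apply: cts_within => // y yab; exact/isd_cts/fdf.
- by rewrite in_itv /=; exists c.
Qed.

Lemma mono_le f df a b : a <= b -> (forall x, a <= x <= b -> is_derive x 1 f (df x)) ->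
  (forall x, a < x < b -> 0 <= df x) -> f a <= f b.
Proof.
rewrite le_eqVlt => /predU1P[-> //|ab] fdf df0.
have [c cab e] := mvt ab fdf; rewrite -subr_ge0 e mulr_ge0 ?df0// subr_ge0.
exact: ltW.
Qed.

Lemma mono_le_oo f df a b : a <= b -> (forall x, a <= x <= b -> {for x, continuous f}) ->
  (forall x, a < x < b -> is_derive x 1 f (df x)) ->
  (forall x, a < x < b -> 0 <= df x) -> f a <= f b.
Proof.
rewrite le_eqVlt => /predU1P[-> //|ab] fc fdf df0.
have h x : x \in `]a, b[%R -> is_derive x 1 f (df x) by rewrite in_itv /=; exact: fdf.
have [c] := MVT ab h (cts_within fc).
rewrite in_itv /= => cab e; rewrite -subr_ge0 e mulr_ge0 ?df0// subr_ge0.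
exact: ltW.
Qed.

Lemma cts_pos f x : {for x, continuous f} -> 0 < f x ->
  exists2 d, 0 < d & forall y, `|x - y| < d -> 0 < f y.
Proof.
move=> cf fx0; have : \forall y \near x, 0 < f y.
  by apply: (cf (fun y => 0 < y)); exact: lt_nbhsr.
by move=> /nbhs_ballP[d /= d0 dP]; exists d => // y xy; apply: dP.
Qed.

Lemma cts_ge0 f x a : {for x, continuous f} -> a < x ->
  (forall y, a < y < x -> 0 <= f y) -> 0 <= f x.
Proof.
move=> cf ax fy; rewrite leNgt; apply/negP => fx.
have [||d d0 dP] := @cts_pos (fun y => - f y) x.
- by apply: continuousN.
- by rewrite oppr_gt0.
(* strictly between [a] and [x], and within [d] of [x] *)
pose y := Num.max ((a + x) / 2) (x - d / 2).
have y1 : (a + x) / 2 <= y by rewrite le_max lexx.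
have y2 : x - d / 2 <= y by rewrite le_max lexx orbT.
have y3 : y < x by rewrite gt_max; apply/andP; split; lra.
have := dP y; rewrite ger0_norm ?subr_ge0 ?ltW// => /(_ _).
have := fy y; rewrite y3 andbT => /(_ _); lra.
Qed.

Lemma cts_ge0r f x b : {for x, continuous f} -> x < b ->
  (forall y, x < y < b -> 0 <= f y) -> 0 <= f x.
Proof.
move=> cf ax fy; rewrite leNgt; apply/negP => fx.
have [||d d0 dP] := @cts_pos (fun y => - f y) x.
- by apply: continuousN.
- by rewrite oppr_gt0.
pose y := Num.min ((b + x) / 2) (x + d / 2).
have y1 : y <= (b + x) / 2 by rewrite ge_min lexx.
have y2 : y <= x + d / 2 by rewrite ge_min lexx orbT.
have y3 : x < y by rewrite lt_min; apply/andP; split; lra.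
have := dP y; rewrite distrC ger0_norm ?subr_ge0 ?ltW// => /(_ _).
have := fy y; rewrite y3 /= => /(_ _); lra.
Qed.

(** The zero is the supremum of the points where [f <= 0]. *)
Lemma last_zero f a x : a < x -> (forall y, a <= y <= x -> {for y, continuous f}) ->
  f a <= 0 -> 0 < f x ->
  exists c, [/\ a <= c < x, f c = 0 & forall y, c < y <= x -> 0 < f y].
Proof.
move=> ax cf fa fx.
pose S := [set y | a <= y <= x /\ f y <= 0].
have Sa : S a by split=> //; rewrite lexx ltW.
have hS : has_sup S by split; [exists a | exists x => y [/andP[]]].
pose c := sup S.
have cub y : S y -> y <= c by move=> Sy; exact: ub_le_sup hS.2 _ Sy.
have ac : a <= c by exact: cub.
have cx : c <= x by apply: ge_sup; [exists a | move=> y [/andP[]]].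
have pos y : c < y <= x -> 0 < f y.
  move=> /andP[cy yx]; rewrite ltNge; apply/negP => fy.
  by have := cub y (conj _ fy); rewrite yx (ltW (le_lt_trans ac cy)) leNgt cy => /(_ isT).
have fc : f c <= 0.
  rewrite leNgt; apply/negP => fc.
  have [|d d0 dP] := @cts_pos f c _ fc; first by apply: cf; rewrite ac.
  have [y Sy] := sup_adherent d0 hS; rewrite -/c => cdy.
  have yc := cub y Sy.
  have := dP y; rewrite ger0_norm ?subr_ge0//; move: Sy.2; lra.
have cx' : c < x.
  by rewrite lt_neqAle cx andbT; apply/eqP => e; move: fc; rewrite e leNgt fx.
exists c; split => //; first by rewrite ac.
apply/eqP; rewrite eq_le fc /=.
by apply: (cts_ge0r _ cx') => [|y /andP[cy yx]];
  [apply: cf; rewrite ac | rewrite ltW// pos// cy ltW].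
Qed.

Lemma first_zero f x b : x < b -> (forall y, x <= y <= b -> {for y, continuous f}) ->
  0 < f x -> f b <= 0 ->
  exists c, [/\ x < c <= b, f c = 0 & forall y, x <= y < c -> 0 < f y].
Proof.
move=> xb cf fx fb.
have [||||c [c1 c2 c3]] := @last_zero (fun y => f (- y)) (- b) (- x).
- by rewrite ltrN2.
- move=> y yab; apply: (@continuous_comp _ _ _ (fun y => - y) f).
    exact: opp_continuous.
  by case/andP: yab => ? ?; apply: cf; apply/andP; split; lra.
- by rewrite opprK.
- by rewrite opprK.
case/andP: c1 => bc cx; exists (- c); split => //.
  by apply/andP; split; lra.
move=> y /andP[xy yc]; have := c3 (- y); rewrite opprK; apply.
by apply/andP; split; lra.
Qed.

(** The Caratheodory slope of [f] at [x] is continuous and nonnegative to the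
right of [x]. *)
Lemma derive_ge0r f x d b : is_derive x 1 f d -> x < b -> f x = 0 ->
  (forall y, x < y < b -> 0 <= f y) -> 0 <= d.
Proof.
move=> fd xb fx fy; have /is_derive1_caratheodory [h [fE hC hxE]] := fd.
rewrite -hxE; apply: (cts_ge0r (b := b)) => // y /andP[xy yb].
have := fE y; rewrite fx subr0 => fyE; have := fy y; rewrite xy yb => /(_ isT).
by rewrite fyE pmulr_lge0 // subr_gt0.
Qed.

Lemma derive_le0l f x d a : is_derive x 1 f d -> a < x -> f x = 0 ->
  (forall y, a < y < x -> 0 <= f y) -> d <= 0.
Proof.
move=> fd ax fx fy; have /is_derive1_caratheodory [h [fE hC hxE]] := fd.
rewrite -hxE -oppr_ge0; apply: (cts_ge0 (f := fun y => - h y) (a := a)) => //.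
  exact: continuousN.
move=> y /andP[ay yx].
have := fE y; rewrite fx subr0 => fyE; have := fy y; rewrite ay yx => /(_ isT).
by rewrite fyE -mulrNN opprB pmulr_lge0 // subr_gt0.
Qed.

End Calculus.

(** * Sturm comparison and alternating signs *)

Section Sturm.
Variable R : realType.
Implicit Types (f g df w k W : R -> R) (a b c x y lo hi s t : R).

Definition is_sign s := s = 1 \/ s = -1.

Lemma is_sign_unit s : is_sign s -> s \is a GRing.unit.
Proof. by rewrite unitfE; case=> ->; rewrite ?oppr_eq0 oner_eq0. Qed.

Lemma sign_cases m : is_sign ((-1) ^+ m).
Proof. by rewrite -signr_odd; case: (odd _); [right|left]. Qed.

(** [W] is a Wronskian of [f] and [g] whose derivative is [k f g] with [k > 0]:
[g] satisfies an equation that oscillates strictly faster than that of [f].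
The weight [w] (here [r] or [sqrt r]) comes from the form of the equations.
Positivity of [k] is asked inside the interval only, so that the comparison
functions may vanish at its ends. *)
Definition sturm_pair lo hi f df g w k W :=
  [/\ forall x, lo <= x <= hi -> is_derive x 1 f (df x),
      forall x, lo <= x <= hi -> {for x, continuous g},
      forall a b, lo <= a -> a < b -> b <= hi -> exists2 y, a < y < b & g y != 0 &
   [/\ forall x, lo < x < hi -> is_derive x 1 W (k x * f x * g x),
      forall x, lo <= x <= hi -> {for x, continuous W},
      forall x, lo < x < hi -> 0 < k x,
      forall x, lo <= x <= hi -> 0 <= w x &
      forall x, lo <= x <= hi -> f x = 0 -> W x = w x * (df x * g x)]].

(** Signs are normalised by multiplying [f] and [g] by constants, so that
below both can be taken positive. *)
Lemma sturm_pair_scale s t lo hi f df g w k W : s \is a GRing.unit -> t \is a GRing.unit ->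
  sturm_pair lo hi f df g w k W ->
  sturm_pair lo hi (fun x => s * f x) (fun x => s * df x) (fun x => t * g x) w k
    (fun x => s * t * W x).
Proof.
rewrite !unitfE => s0 t0 [fd gc gnt [Wd Wc k0 w0 W0]]; split.
- by move=> x lx; apply: isdZ; exact: fd.
- move=> x lx; apply: (@continuousM _ _ (fun=> t) g); first exact: cst_continuous.
  exact: gc.
- move=> a b la ab bh; have [y yab gy] := gnt _ _ la ab bh.
  by exists y => //; rewrite mulf_neq0.
split => //.
- move=> x lx; apply: is_derive_eq (isdZ (s * t) (Wd x lx)) _; ring.
- move=> x lx; apply: (@continuousM _ _ (fun=> s * t) W); first exact: cst_continuous.
  exact: Wc.
- move=> x lx /eqP; rewrite mulf_eq0 (negPf s0) /= => /eqP fx.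
  rewrite W0//; ring.
Qed.

Section pair.
Variables (lo hi : R) (f df g w k W : R -> R).
Hypothesis fgW : sturm_pair lo hi f df g w k W.

(** [W] is nondecreasing, and cannot be constant because [g] does not vanish
identically. *)
Lemma sturm_pos a b : lo <= a -> a < b -> b <= hi -> 0 <= W a ->
  (forall y, a < y < b -> 0 < f y) -> (forall y, a < y < b -> 0 <= g y) -> 0 < W b.
Proof.
case: fgW => fd gc gnt [Wd Wc k0 w0 W0] la ab bh Wa f0 g0.
have Wmono x y : a <= x -> x <= y -> y <= b -> W x <= W y.
  move=> ax xy yb.
  apply: (mono_le_oo xy (df := fun z => k z * f z * g z)) => z /andP[xz zy].
  - by apply: Wc; apply/andP; split; lra.
  - by apply: Wd; apply/andP; split; lra.
  have zab : a < z < b by apply/andP; split; lra.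
  have zlh : lo < z < hi by apply/andP; split; lra.
  apply: mulr_ge0; last exact: g0.
  by apply: mulr_ge0; apply: ltW; [exact: k0|exact: f0].
rewrite ltNge; apply/negP => Wb.
have Wz x : a <= x <= b -> W x = 0.
  move=> /andP[ax xb]; have := Wmono a x (lexx _) ax xb.
  by have := Wmono x b ax xb (lexx _); lra.
have [y yab gy] := gnt _ _ la ab bh; have /andP[ay yb] := yab.
have lyh : lo < y < hi by apply/andP; split; lra.
have : 0 <= - (k y * f y * g y).
  have Wdy := isdN (Wd y lyh).
  apply: (derive_ge0r Wdy yb) => /=.
    by rewrite Wz ?oppr0// !ltW.
  by move=> z /andP[yz zb]; rewrite Wz ?oppr0//; apply/andP; split; lra.
have : 0 < k y * f y * g y.
  apply: mulr_gt0; last by rewrite lt_def gy g0.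
  by apply: mulr_gt0; [apply: k0; apply/andP; split; lra|exact: f0].
lra.
Qed.

(** Moving left from [x] to the first point where [f] is not positive (or to [a])
gives a starting point at which [W] has the right sign: at a zero of [f] where
[f] becomes positive, [W = w f' g] is nonnegative. *)
Lemma sturm_left a x : lo <= a -> a < x -> x <= hi -> (0 < f a -> 0 <= W a) -> 0 < f x ->
  (forall y, a < y < x -> 0 <= g y) ->
  exists al, [/\ a <= al < x, 0 <= W al & forall y, al < y <= x -> 0 < f y].
Proof.
case: fgW => fd gc gnt [Wd Wc k0 w0 W0] la ax xh fWa fx g0.
have key b : a <= b -> b < x -> f b <= 0 ->
  exists al, [/\ a <= al < x, 0 <= W al & forall y, al < y <= x -> 0 < f y].
  move=> ab bx fb.
  have [y /andP[yb yx]|al [/andP[ba alx] fal pos]] := last_zero bx _ fb fx.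
    by apply: isd_cts (fd y _); apply/andP; split; lra.
  exists al; split=> //; first by apply/andP; split=> //; lra.
  have lal : lo <= al <= hi by apply/andP; split; lra.
  rewrite W0// mulr_ge0 ?w0// mulr_ge0//.
    apply: (derive_ge0r (fd al lal) alx fal) => y /andP[? ?].
    by rewrite ltW// pos//; apply/andP; split=> //; exact: ltW.
  apply: (cts_ge0r (gc al lal) alx) => y /andP[? ?].
  by apply: g0; apply/andP; split=> //; lra.
have [fa|fa] := leP (f a) 0; first by apply: (key a).
have [[b [ab bx fb]]|H] := pselect (exists b, [/\ a < b, b < x & f b <= 0]).
  by apply: (key b) => //; exact: ltW.
exists a; split => //; [by rewrite lexx | exact: fWa |].
move=> y /andP[ay]; rewrite le_eqVlt => /predU1P[-> //|yx].
by rewrite ltNge; apply/negP => fy; apply: H; exists y.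
Qed.

(** Sturm's theorem in the form used for both solutions and comparison functions:
on the component of [f > 0] around [x], the Wronskian starts nonnegative and
increases, but at the right end, where [f] vanishes with [f' <= 0], it equals
[w f' g <= 0]. *)
Lemma sturm_one a x c : lo <= a -> a < x -> x < c -> c <= hi -> (0 < f a -> 0 <= W a) ->
  0 < f x -> f c = 0 -> (forall y, a < y < c -> 0 <= g y) -> False.
Proof.
move=> la ax xc ch fWa fx fc g0.
have xh : x <= hi by lra.
have [|al [/andP[aal alx] Wal pos]] := sturm_left la ax xh fWa fx.
  by move=> y /andP[ay yx]; apply: g0; apply/andP; split=> //; lra.
case: fgW => fd gc gnt [Wd Wc k0 w0 W0].
have [y /andP[yb yc]||be [/andP[xbe bec] fbe posr]] := first_zero xc _ fx.
- by apply: isd_cts (fd y _); apply/andP; split; lra.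
- by rewrite fc.
have albe : al < be by lra.
have lbe : lo <= be <= hi by apply/andP; split; lra.
have beh : be <= hi by lra.
have pos2 y : al < y < be -> 0 < f y.
  move=> /andP[aly ybe]; have [yx|xy] := leP y x; first by rewrite pos// aly.
  by rewrite posr// ybe ltW.
have g1 y : al < y < be -> 0 <= g y.
  by move=> /andP[aly ybe]; apply: g0; apply/andP; split; lra.
have := sturm_pos (le_trans la aal) albe beh Wal pos2 g1.
have df0 : df be <= 0.
  by apply: (derive_le0l (fd be lbe) albe fbe) => y yab; rewrite ltW// pos2.
have gbe : 0 <= g be by apply: (cts_ge0 (gc be lbe) albe).
by rewrite W0// ltNge mulr_ge0_le0 ?w0// mulr_le0_ge0.
Qed.

End pair.

Lemma sturm_signs lo hi f df g w k W a c x s : sturm_pair lo hi f df g w k W ->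
  is_sign s -> lo <= a -> a < x -> x < c -> c <= hi -> f a = 0 -> f c = 0 -> f x != 0 ->
  exists2 y, a < y < c & 0 < s * g y.
Proof.
move=> fgW hs la ax xc ch fa fc fx; apply: contrapT => H.
pose u : R := if 0 < f x then 1 else -1.
have uu : u \is a GRing.unit by rewrite unitfE /u; case: ifP; rewrite ?oppr_eq0 oner_eq0.
have su : - s \is a GRing.unit.
  by rewrite unitfE oppr_eq0; case: hs => ->; rewrite ?oppr_eq0 oner_eq0.
apply: (sturm_one (sturm_pair_scale uu su fgW) la ax xc ch) => /=.
- by rewrite fa mulr0 ltxx.
- rewrite /u; case: ifP => [|/negbT]; first by rewrite mul1r.
  by rewrite -leNgt le_eqVlt (negPf fx) /= mulN1r oppr_gt0.
- by rewrite fc mulr0.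
- move=> y yac; rewrite mulNr oppr_ge0 leNgt; apply/negP => gy.
  by apply: H; exists y.
Qed.

(** The first nodal interval has no zero of [f] at its left end; the boundary
condition there is expressed by the sign of [W]. *)
Lemma sturm_signs_left lo hi f df g w k W a c x s : sturm_pair lo hi f df g w k W ->
  is_sign s -> lo <= a -> a < x -> x < c -> c <= hi -> 0 <= - s * W a ->
  0 < f x -> f c = 0 -> exists2 y, a < y < c & 0 < s * g y.
Proof.
move=> fgW hs la ax xc ch Wa fx fc; apply: contrapT => H.
have uu : (1 : R) \is a GRing.unit by rewrite unitr1.
have su : - s \is a GRing.unit.
  by rewrite unitfE oppr_eq0; case: hs => ->; rewrite ?oppr_eq0 oner_eq0.
apply: (sturm_one (sturm_pair_scale uu su fgW) la ax xc ch) => /=.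
- by rewrite !mul1r.
- by rewrite mul1r.
- by rewrite mul1r.
- move=> y yac; rewrite mulNr oppr_ge0 leNgt; apply/negP => gy.
  by apply: H; exists y.
Qed.

(** There are points [x_0 < ... < x_m = x] in [[lo, x]] at which [f] has the signs
[+, -, +, ...]: at least [m] sign changes, the first sign being [+].  Sign
changes are used instead of zeros because no question of multiplicity arises
and because they can be transferred from one function to another one interval
at a time. *)
Fixpoint chain lo f m x : Prop :=
  if m is m'.+1 then 0 < (-1) ^+ m * f x /\ (exists2 y, y < x & chain lo f m' y)
  else lo <= x /\ 0 < f x.

Lemma chain_lo lo f m x : chain lo f m x -> lo <= x.
Proof.
elim: m x => [|m IH] x /=; first by case.
by move=> [_ [y yx /IH ly]]; exact: le_trans ly (ltW yx).
Qed.

Lemma chain_sign lo f m x : chain lo f m x -> 0 < (-1) ^+ m * f x.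
Proof. by case: m => [|m] /= []; rewrite ?expr0 ?mul1r. Qed.

Lemma chain_zero lo f m x y : (forall z, lo <= z -> {for z, continuous f}) ->
  chain lo f m y -> y < x -> 0 < (-1) ^+ m.+1 * f x ->
  exists2 c, y < c < x & f c = 0.
Proof.
move=> fc chy yx fx; have fy := chain_sign chy; have ly := chain_lo chy.
have [||c /andP[yc cx] fc0] := @ivt0 _ f y x (ltW yx).
- by move=> z /andP[yz _]; apply: fc; exact: le_trans ly yz.
- by move: fx fy; rewrite exprS; case: (sign_cases m) => ->; nra.
exists c => //; rewrite !lt_neqAle yc cx !andbT; apply/andP; split; apply/eqP => e.
  by move: fy; rewrite e fc0 mulr0 ltxx.
by move: fx; rewrite -e fc0 mulr0 ltxx.
Qed.

(** The inductive scheme behind every comparison: if every nodal interval of [f]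
contains both signs of [g], and the first one a sign change of [g], then at
the zero [c] of [f] which ends the chain, [g] is one sign change ahead. *)
Lemma chain_transfer lo hi lo' f g : (forall z, lo <= z -> {for z, continuous f}) ->
  (forall x c, lo <= x -> x < c -> c <= hi -> 0 < f x -> f c = 0 ->
     exists2 y, y < c & chain lo' g 1 y) ->
  (forall a x c, lo <= a -> a < x -> x < c -> c <= hi -> f a = 0 -> f c = 0 -> f x != 0 ->
     forall s, is_sign s -> exists2 y, a < y < c & 0 < s * g y) ->
  forall m x c, chain lo f m x -> x < c -> c <= hi -> f c = 0 ->
    exists2 y, y < c & chain lo' g m.+1 y.
Proof.
move=> fc Hb Hs; elim=> [|m IH] x c /=.
  by move=> [lx fx] xc ch fc0; exact: (Hb x).
move=> [fx [z zx chz]] xc ch fc0.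
have [b /andP[zb bx] fb] := chain_zero fc chz zx fx.
have [y yb chy] := IH z b chz zb (ltW (lt_le_trans (lt_trans bx xc) ch)) fb.
have [|||u /andP[bu uc] gu] := Hs b x c _ bx xc ch fb fc0 _ ((-1) ^+ m.+2).
- by rewrite (le_trans (chain_lo chz))// ltW.
- by apply/eqP => e; move: fx; rewrite e mulr0 ltxx.
- exact: sign_cases.
by exists u => //; split => //; exists y => //; exact: lt_trans yb bu.
Qed.

(** The analogue of [chain_transfer] which collects one zero of [g] per nodal
interval of [f], to be confronted with a bound on the number of zeros. *)
Lemma chain_roots lo f g : (forall z, lo <= z -> {for z, continuous f}) ->
  (forall x c, lo <= x -> x < c -> 0 < f x -> f c = 0 ->
     exists2 y, y < c & g y = 0) ->
  (forall a x c, lo <= a -> a < x -> x < c -> f a = 0 -> f c = 0 -> f x != 0 ->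
     exists2 y, a < y < c & g y = 0) ->
  forall m x c, chain lo f m x -> x < c -> f c = 0 ->
    exists s : seq R, [/\ uniq s, size s = m.+1 & all (fun y => (y < c) && (g y == 0)) s].
Proof.
move=> fc Hb Hs; elim=> [|m IH] x c /=.
  move=> [lx fx] xc fc0; have [y yc gy] := Hb x c lx xc fx fc0.
  by exists [:: y] => /=; rewrite yc gy eqxx.
move=> [fx [z zx chz]] xc fc0.
have [b /andP[zb bx] fb] := chain_zero fc chz zx fx.
have [s [us ss /allP as_]] := IH z b chz zb fb.
have [||u /andP[bu uc] gu] := Hs b x c _ bx xc fb fc0 _.
- by rewrite (le_trans (chain_lo chz))// ltW.
- by apply/eqP => e; move: fx; rewrite e mulr0 ltxx.
exists (u :: s); split => /=.
- rewrite us andbT; apply/negP => /as_ /andP[ub _].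
  by move: (lt_trans ub bu); rewrite ltxx.
- by rewrite ss.
- rewrite uc gu eqxx /=; apply/allP => y /as_ /andP[yb ->].
  by rewrite (lt_trans yb (lt_trans bu uc)).
Qed.

End Sturm.

(** * Entire power series *)

Section EntireSeries.
Variable R : realType.
Implicit Types (c d : nat -> R) (r x K C : R).

(** Coefficients decaying faster than any geometric sequence; all the series
below converge on the whole line. *)
Definition entire c := forall K, 0 < K -> exists C, forall m, `|c m| * K ^+ m <= C.

Definition psum c r : R := limn (pseries c r).

Lemma entire_cvg c r : entire c -> cvgn (pseries c r).
Proof.
move=> ec; pose K := 2 * (`|r| + 1).
have K0 : 0 < K by rewrite /K mulr_gt0// ltr_wpDl.
have [C CP] := ec K K0.
have C0 : 0 <= C by apply: le_trans (CP 0); rewrite mulr_ge0.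
apply: normed_cvg; apply: (@series_le_cvg _ _ (geometric C 2^-1)) => //.
- by move=> n /=; exact: normr_ge0.
- by move=> n /=; rewrite mulr_ge0// exprn_ge0// invr_ge0.
- move=> n /=; rewrite normrM normrX.
  apply: le_trans (_ : `|c n| * K ^+ n * 2^-1 ^+ n <= _).
    rewrite -mulrA ler_wpM2l// -exprMn lerXn2r ?nnegrE//.
      by rewrite divr_ge0// ltW.
    by rewrite /K mulrAC mulfV// mul1r lerDl.
  by rewrite ler_wpM2r// exprn_ge0// invr_ge0.
- by apply: is_cvg_geometric_series; rewrite ger0_norm ?invr_ge0// invf_lt1// ltr1n.
Qed.

Lemma natr_le_exp2 m : m%:R <= 2 ^+ m :> R.
Proof. by rewrite -natrX ler_nat ltnW// ltn_expl. Qed.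

Lemma entire_mulnat c : entire c -> entire (fun m => m%:R * c m).
Proof.
move=> ec K K0; have [|C CP] := ec (2 * K); first by rewrite mulr_gt0.
exists C => m; apply: le_trans (CP m).
rewrite normrM normr_nat -mulrA exprMn [leRHS]mulrCA.
by rewrite ler_wpM2r ?natr_le_exp2// mulr_ge0// exprn_ge0// ltW.
Qed.

Lemma entire_behead c : entire c -> entire (fun m => c m.+1).
Proof.
move=> ec K K0; have [C CP] := ec K K0; exists (C / K) => m.
by rewrite ler_pdivlMr// -mulrA -exprSr.
Qed.

Lemma entire_diffs c : entire c -> entire (pseries_diffs c).
Proof. by move=> /entire_mulnat /entire_behead. Qed.

Lemma psum_deriv c r : entire c -> is_derive r 1 (psum c) (psum (pseries_diffs c) r).
Proof.
move=> ec; apply: (@pseries_snd_diffs _ _ (`|r| + 1)).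
- exact: entire_cvg.
- exact/entire_cvg/entire_diffs.
- exact/entire_cvg/entire_diffs/entire_diffs.
- by rewrite [X in _ < X]ger0_norm ?addr_ge0// ltrDl.
Qed.

Lemma psumD c d r : entire c -> entire d ->
  psum (fun m => c m + d m) r = psum c r + psum d r.
Proof.
move=> /entire_cvg cc /entire_cvg cd; rewrite /psum -limD//; congr (lim (_ @ \oo)).
rewrite /pseries /series; apply/funext => n /=; rewrite -[RHS]big_split /=.
by apply: eq_bigr => i _; rewrite mulrDl.
Qed.

Lemma psumZ a c r : entire c -> psum (fun m => a * c m) r = a * psum c r.
Proof.
move=> /entire_cvg cc; apply/cvg_lim => //.
rewrite (_ : pseries _ r = fun n => a * pseries c r n).
  by apply: cvgM; [exact: cvg_cst | exact: cc].
rewrite /pseries /series; apply/funext => n /=; rewrite big_distrr /=.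
by apply: eq_bigr => i _; rewrite mulrA.
Qed.

Lemma entireD c d : entire c -> entire d -> entire (fun m => c m + d m).
Proof.
move=> ec ed K K0; have [C CP] := ec K K0; have [D DP] := ed K K0.
exists (C + D) => m; apply: le_trans (lerD (CP m) (DP m)).
by rewrite -mulrDl ler_wpM2r ?ler_normD// exprn_ge0// ltW.
Qed.

Lemma entireZ a c : entire c -> entire (fun m => a * c m).
Proof.
move=> ec K K0; have [C CP] := ec K K0.
by exists (`|a| * C) => m; rewrite normrM -mulrA ler_wpM2l.
Qed.

Definition delay c m : R := if m is m'.+1 then c m' else 0.

Lemma entire_delay c : entire c -> entire (delay c).
Proof.
move=> ec K K0; have [C CP] := ec K K0; exists (C * K).
have C0 : 0 <= C by apply: le_trans (CP 0); rewrite mulr_ge0.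
case=> [|m] /=; first by rewrite normr0 mul0r mulr_ge0// ltW.
by rewrite exprSr mulrA ler_wpM2r// ltW.
Qed.

Lemma psum_delay c r : entire c -> psum (delay c) r = r * psum c r.
Proof.
move=> ec; have cc := entire_cvg (r := r) ec.
apply/cvg_lim => //; rewrite -cvg_shiftS /=.
rewrite (_ : (fun n => pseries _ r n.+1) = fun n => r * pseries c r n).
  by apply: cvgM; [exact: cvg_cst | exact: cc].
apply/funext => n; rewrite /pseries /series /= big_nat_recl//= mul0r add0r big_distrr /=.
by apply: eq_bigr => i _; rewrite exprS; ring.
Qed.

Lemma psum0 c : psum c 0 = c 0.
Proof.
apply/cvg_lim => //; rewrite -cvg_shiftS /=.
rewrite (_ : (fun n => pseries c 0 n.+1) = fun=> c 0); first exact: cvg_cst.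
apply/funext => n; rewrite /pseries /series /= big_nat_recl//= expr0 mulr1 big1 ?addr0// => i _.
by rewrite exprS mul0r mulr0.
Qed.

Lemma eq_psum c d r : c =1 d -> psum c r = psum d r.
Proof. by move=> /funext ->. Qed.

(** Term by term comparison with a majorant series; it gives the continuous
dependence of the solution on the energy. *)
Lemma psum_lip c d e a r : entire c -> entire d -> entire e -> 0 <= a ->
  (forall m, `|c m - d m| <= a * e m) -> `|psum c r - psum d r| <= a * psum e `|r|.
Proof.
move=> ec ed ee a0 H.
rewrite -psumZ//; have -> : psum c r - psum d r = psum (fun m => c m + (-1) * d m) r.
  by rewrite psumD ?psumZ ?mulN1r//; exact: entireZ.
have ecd : entire (fun m => c m + (-1) * d m) by apply: entireD => //; exact: entireZ.
have eae := entireZ a ee.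
have c1 := entire_cvg (r := r) ecd; have c2 := entire_cvg (r := `|r|) eae.
rewrite /psum -lim_norm//; apply: ler_lim => //; first exact: is_cvg_norm.
near=> n; rewrite /pseries /series /=.
apply: le_trans (ler_norm_sum _ _ _) _; apply: ler_sum => i _.
by rewrite normrM normrX ler_wpM2r ?exprn_ge0// mulN1r.
Unshelve. all: by end_near. Qed.

End EntireSeries.

(** * The coefficients of the regular solution *)

Section Coefficients.
Variable R : realType.
Implicit Types (p q s K C B : R).

(** Carries four consecutive coefficients, because the recurrence reaches back
that far; negative indices count as zero. *)
Fixpoint window p q s m : R * R * R * R :=
  if m is m'.+1 then
    let: (a, b, c, d) := window p q s m' in
    (b, c, d, (p * c + q * b + s * a) / m%:R ^+ 2)
  else (0, 0, 0, 1).

Definition coef p q s m : R := (window p q s m).2.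

Definition window_next p q s (w : R * R * R * R) m : R * R * R * R :=
  (w.1.1.2, w.1.2, w.2, (p * w.1.2 + q * w.1.1.2 + s * w.1.1.1) / m%:R ^+ 2).

Lemma windowS p q s m : window p q s m.+1 = window_next p q s (window p q s m) m.+1.
Proof. by rewrite /=; case: (window p q s m) => [[[a b] c] d]. Qed.

Lemma windowE p q s m : window p q s m =
  (delay (delay (delay (coef p q s))) m, delay (delay (coef p q s)) m,
   delay (coef p q s) m, coef p q s m).
Proof.
elim: m => [//|m IH]; have e : coef p q s m.+1 = (window p q s m.+1).2 by [].
by rewrite e windowS {1}IH /window_next IH.
Qed.

(** With [p = tau^2 - lam], [q = - 2 tau] and [s = 1] this is the identity between
the coefficients of [(r u')'] and [r (p + q r + s r^2) u]. *)
Lemma coef_rec p q s m : coef p q s m.+1 * m.+1%:R ^+ 2 =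
  p * delay (coef p q s) m + q * delay (delay (coef p q s)) m +
  s * delay (delay (delay (coef p q s))) m.
Proof.
rewrite {1}/coef windowS /window_next windowE.
by rewrite [LHS]mulfVK ?expf_neq0 ?pnatr_eq0.
Qed.

Lemma strong_nat_ind (P : nat -> Prop) : P 0 ->
  (forall m, (forall n, (n <= m)%N -> P n) -> P m.+1) -> forall m, P m.
Proof.
move=> P0 PS m; have [n] := ubnP m; elim: n m => // n IH [//|m] mn.
by apply: PS => k km; apply: IH; apply: leq_ltn_trans km _.
Qed.

Lemma delay_le (u v : nat -> R) m : (forall n, (n <= m)%N -> `|u n| <= v n) ->
  forall n, (n <= m)%N -> `|delay u n| <= delay v n.
Proof. by move=> H [|n] nm; [rewrite /delay normr0 | exact/H/ltnW]. Qed.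

(** The recurrence has nonnegative weights, so it is monotone in the absolute
values of its parameters. *)
Lemma coef_major B p q s m : `|p| <= B -> `|q| <= B -> `|s| <= B ->
  `|coef p q s m| <= coef B B B m.
Proof.
move=> pB qB sB; have B0 : 0 <= B by exact: le_trans pB.
elim/strong_nat_ind: m => [|m IH]; first by rewrite /coef /window normr1.
have m0 : 0 < m.+1%:R ^+ 2 :> R by rewrite exprn_gt0.
rewrite -(ler_pM2r m0) coef_rec -{1}(gtr0_norm m0) -normrM coef_rec.
have h1 := delay_le IH; have h2 := delay_le h1; have h3 := delay_le h2.
apply: le_trans (ler_normD _ _) _; apply: lerD; last by rewrite normrM ler_pM ?h3.
by apply: le_trans (ler_normD _ _) _; apply: lerD; rewrite normrM ler_pM ?h1 ?h2.
Qed.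

Lemma coef_ge0 B m : 0 <= B -> 0 <= coef B B B m.
Proof.
move=> B0; have h : `|B| <= B by rewrite ger0_norm.
exact: le_trans (normr_ge0 _) (coef_major m h h h).
Qed.

(** Once [m] exceeds [G], the division by [(m + 1)^2] absorbs the factor [G]
produced by the recurrence, and [coef m * K^m] stays below the bound reached before. *)
Lemma entire_coefM B : 1 <= B -> entire (coef B B B).
Proof.
move=> B1 K K0; have B0 : 0 <= B by lra.
pose G := B * (K ^+ 2 + K ^+ 3 + K ^+ 4).
have G0 : 0 <= G by rewrite mulr_ge0// !addr_ge0 ?exprn_ge0 ?ltW.
have [N GN] : exists N : nat, G <= N%:R.
  by exists (Num.truncn G).+1; rewrite ltW// truncnS_gt.
pose u m := coef B B B m * K ^+ m.
have u0 m : 0 <= u m by rewrite mulr_ge0 ?coef_ge0 ?exprn_ge0// ltW.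
pose C := \sum_(i < N.+1) u i.
have C0 : 0 <= C by apply: sumr_ge0.
exists C => m; rewrite ger0_norm ?coef_ge0// -/(u m).
elim/strong_nat_ind: m => [|m IH].
  by rewrite /C big_ord_recl lerDl sumr_ge0.
have [mN|Nm] := leqP m.+1 N.
  by rewrite /C (bigD1 (Ordinal (mN : (m.+1 < N.+1)%N)))//= lerDl sumr_ge0.
have m0 : 0 < m.+1%:R ^+ 2 :> R by rewrite exprn_gt0.
rewrite -(ler_pM2r m0).
have -> : u m.+1 * m.+1%:R ^+ 2 = (coef B B B m.+1 * m.+1%:R ^+ 2) * K ^+ m.+1.
  by rewrite /u; ring.
rewrite coef_rec.
have h1 n : (n <= m)%N -> delay (coef B B B) n * K ^+ n.+1 <= C * K ^+ 2.
  case: n => [|n] nm; rewrite /delay; first by rewrite mul0r mulr_ge0// exprn_ge0// ltW.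
  rewrite (_ : _ * _ = u n * K ^+ 2); last by rewrite /u !exprS; ring.
  by rewrite ler_wpM2r ?IH ?exprn_ge0 ?(ltW K0)// ltnW.
have h2 n : (n <= m)%N -> delay (delay (coef B B B)) n * K ^+ n.+1 <= C * K ^+ 3.
  case: n => [|n] nm; first by rewrite /delay mul0r mulr_ge0// exprn_ge0// ltW.
  by rewrite exprSr mulrA (exprSr _ 2) mulrA ler_wpM2r ?(ltW K0)// h1// ltnW.
have h3 n : (n <= m)%N -> delay (delay (delay (coef B B B))) n * K ^+ n.+1 <= C * K ^+ 4.
  case: n => [|n] nm; first by rewrite /delay mul0r mulr_ge0// exprn_ge0// ltW.
  by rewrite exprSr mulrA (exprSr _ 3) mulrA ler_wpM2r ?(ltW K0)// h2// ltnW.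
apply: (@le_trans _ _ (C * G)).
  have := h1 m (leqnn m); have := h2 m (leqnn m); have := h3 m (leqnn m).
  rewrite /G; set d1 := delay _ m; set d2 := delay _ m; set d3 := delay _ m => k3 k2 k1.
  have := lerD (lerD (ler_wpM2l B0 k1) (ler_wpM2l B0 k2)) (ler_wpM2l B0 k3).
  by move=> H; apply: le_trans (le_trans H _); rewrite le_eqVlt; apply/orP; left; apply/eqP; ring.
rewrite ler_wpM2l//; apply: le_trans GN _.
by rewrite -natrX ler_nat (leq_trans (ltnW Nm))// expnS expn1 leq_pmulr.
Qed.

Lemma entire_coef p q s : entire (coef p q s).
Proof.
pose B := 1 + `|p| + `|q| + `|s|.
have := (normr_ge0 p, normr_ge0 q, normr_ge0 s) => -[[p0 q0] s0].
have B1 : 1 <= B by rewrite /B; lra.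
move=> K K0; have [C CP] := entire_coefM B1 K0; exists C => m.
apply: le_trans (CP m); rewrite ler_wpM2r ?exprn_ge0 ?(ltW K0)//.
by apply: le_trans (coef_major _ _ _ _) (ler_norm _); rewrite /B; lra.
Qed.

(** The difference of two solutions satisfies the same recurrence with the source
[(p - p') * d].  The majorant [m * coef B B B m] bounds the derivative in [B] of
[coef B B B m], a polynomial of degree at most [m]. *)
Lemma coef_lip B p p' q s m : 1 <= B -> `|p| <= B -> `|p'| <= B -> `|q| <= B -> `|s| <= B ->
  `|coef p q s m - coef p' q s m| <= `|p - p'| * (m%:R * coef B B B m).
Proof.
move=> B1 pB pB' qB sB; have B0 : 0 <= B by lra.
set c := coef p q s; set d := coef p' q s; set M := coef B B B.
elim/strong_nat_ind: m => [|m IH]; first by rewrite /c /d /coef /window subrr normr0 mul0r mulr0.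
have m0 : 0 < m.+1%:R ^+ 2 :> R by rewrite exprn_gt0.
rewrite -(ler_pM2r m0) -{1}(gtr0_norm m0) -normrM mulrBl !coef_rec.
rewrite -/c -/d.
have M0 n : 0 <= M n by exact: coef_ge0.
pose e n := n%:R * M n; set a := `|p - p'|; have a0 : 0 <= a by exact: normr_ge0.
have step (u v w : nat -> R) n0 : (forall n, (n <= n0)%N -> `|u n - v n| <= a * w n) ->
    forall n, (n <= n0)%N -> `|delay u n - delay v n| <= a * delay w n.
  by move=> H [|n] nm; [rewrite /delay subrr normr0 mulr0 | exact/H/ltnW].
have h1 := step _ _ e m IH; have h2 := step _ _ _ _ h1; have h3 := step _ _ _ _ h2.
have dM0 (u : nat -> R) n : (forall n, 0 <= u n) -> 0 <= delay u n.
  by move=> u0; case: n => [|n]; rewrite /delay.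
have de (u w : nat -> R) : (forall n, 0 <= w n) -> (forall n, u n <= n%:R * w n) ->
    forall n, delay u n <= n%:R * delay w n.
  move=> w0 H [|n]; first by rewrite /delay mulr0.
  by apply: le_trans (H n) _; rewrite ler_wpM2r// ler_nat.
have e1 := de e M M0 (fun n => lexx _).
have e2 := de _ _ (fun n => dM0 _ n M0) e1.
have e3 := de _ _ (fun n => dM0 _ n (fun n => dM0 _ n M0)) e2.
have k1 : B * delay e m + delay M m <= m%:R * (B * delay M m).
  case: (m) => [|n]; first by rewrite /delay mulr0 addr0 mul0r.
  rewrite /delay /e -natr1; have := M0 n; have := ler0n R n; nra.
have dd : `|delay d m| <= delay M m.
  by apply: (delay_le (m := m)) => // n _; exact: coef_major.
have dM1 := dM0 _ m M0; have dM2 := dM0 _ m (fun n => dM0 _ n M0).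
have dM3 := dM0 _ m (fun n => dM0 _ n (fun n => dM0 _ n M0)).
have := h1 m (leqnn m); have := h2 m (leqnn m); have := h3 m (leqnn m).
have := e2 m; have := e3 m.
have -> : a * (m.+1%:R * M m.+1) * m.+1%:R ^+ 2 = a * (m.+1%:R * (B * delay M m + B * delay (delay M) m + B * delay (delay (delay M)) m)).
  by rewrite -(coef_rec B B B m) -/M; ring.
move: k1 dd dM1 dM2 dM3.
set x1 := delay M m; set x2 := delay (delay M) m; set x3 := delay (delay (delay M)) m.
set y1 := delay e m; set y2 := delay (delay e) m; set y3 := delay (delay (delay e)) m.
set c1 := delay c m; set c2 := delay (delay c) m; set c3 := delay (delay (delay c)) m.
set d1 := delay d m; set d2 := delay (delay d) m; set d3 := delay (delay (delay d)) m.
move=> k1 dd dM1 dM2 dM3 y3x y2x k4 k3 k2.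
have -> : p * c1 + q * c2 + s * c3 - (p' * d1 + q * d2 + s * d3) =
  p * (c1 - d1) + (p - p') * d1 + q * (c2 - d2) + s * (c3 - d3) by ring.
apply: (@le_trans _ _ (B * (a * y1) + a * x1 + B * (a * y2) + B * (a * y3))).
  apply: le_trans (ler_normD _ _) _; apply: lerD; last by rewrite normrM ler_pM.
  apply: le_trans (ler_normD _ _) _; apply: lerD; last by rewrite normrM ler_pM.
  by apply: le_trans (ler_normD _ _) _; apply: lerD; rewrite normrM ler_pM.
rewrite (_ : _ + _ + _ + _ = a * (B * y1 + x1 + B * y2 + B * y3)); last by ring.
rewrite ler_wpM2l//; have n0 := ler0n R m.
rewrite -(natr1 m).
have b2 := ler_wpM2l B0 y2x; have b3 := ler_wpM2l B0 y3x.
have := mulr_ge0 B0 dM1; have := mulr_ge0 B0 dM2; have := mulr_ge0 B0 dM3.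
lra.
Qed.

End Coefficients.

(** * The regular solution and its dependence on the energy *)

Section Phi.
Variable R : realType.
Implicit Types (tau lam r L a b lo : R).

Definition phi_coef tau lam := coef (tau ^+ 2 - lam) (- (2 * tau)) 1.
(** The solution regular at the origin, as a power series.  Defining it by its
series avoids a singular initial value problem at [r = 0]. *)
Definition phi tau lam := psum (phi_coef tau lam).
Definition dphi tau lam := psum (pseries_diffs (phi_coef tau lam)).
Definition ddphi tau lam := psum (pseries_diffs (pseries_diffs (phi_coef tau lam))).

Lemma phi_deriv tau lam r : is_derive r 1 (phi tau lam) (dphi tau lam r).
Proof. exact/psum_deriv/entire_coef. Qed.

Lemma dphi_deriv tau lam r : is_derive r 1 (dphi tau lam) (ddphi tau lam r).
Proof. exact/psum_deriv/entire_diffs/entire_coef. Qed.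

Lemma phi_eq tau lam r :
  r * ddphi tau lam r + dphi tau lam r = r * ((r - tau) ^+ 2 - lam) * phi tau lam r.
Proof.
rewrite /ddphi /dphi /phi /phi_coef; set p := tau ^+ 2 - lam; set c := coef _ _ _.
have ec : entire c := entire_coef _ _ _.
have edc := entire_diffs ec; have eddc := entire_diffs edc.
have ed1 := entire_delay ec; have ed2 := entire_delay ed1; have ed3 := entire_delay ed2.
rewrite -psum_delay// -psumD//; last exact: entire_delay.
have -> : psum (fun m => delay (pseries_diffs (pseries_diffs c)) m + pseries_diffs c m) r =
  psum (fun m => p * delay c m + (- (2 * tau)) * delay (delay c) m + 1 * delay (delay (delay c)) m) r.
  apply: eq_psum => m; rewrite -coef_rec -/c /pseries_diffs.
  case: m => [|m]; rewrite /delay; first by ring.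
  rewrite -!(natr1 m.+1); ring.
have z1 := entireZ p ed1; have z2 := entireZ (- (2 * tau)) ed2; have z3 := entireZ 1 ed3.
rewrite (psumD r (entireD z1 z2) z3) (psumD r z1 z2) !psumZ// !psum_delay// /p; ring.
Qed.

Lemma phi_0 tau lam : phi tau lam 0 = 1.
Proof. exact: psum0. Qed.

Lemma dphi_0 tau lam : dphi tau lam 0 = 0.
Proof.
rewrite /dphi psum0 /pseries_diffs /phi_coef.
have := coef_rec (tau ^+ 2 - lam) (- (2 * tau)) 1 0.
by rewrite /delay !mulr0 !addr0 expr1n mulr1 => ->; rewrite mulr0.
Qed.

(** The energy enters the coefficients only through [p], so the Lipschitz constant
at a fixed [r] comes from the majorant series of [coef_lip]. *)
Lemma phi_lip tau L r : exists2 K, 0 <= K & forall lam mu, `|lam| <= L -> `|mu| <= L ->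
  `|phi tau lam r - phi tau mu r| <= K * `|lam - mu| /\
  `|dphi tau lam r - dphi tau mu r| <= K * `|lam - mu|.
Proof.
(* bounds all the parameters of the recurrence when [|lam| <= L] *)
pose B := 1 + tau ^+ 2 + `|L| + `|2 * tau|.
have t0 := sqr_ge0 tau; have L0 := normr_ge0 L; have tt0 := normr_ge0 (2 * tau).
have B1 : 1 <= B by rewrite /B; lra.
have e1 := entire_mulnat (entire_coefM B1); have e2 := entire_diffs e1.
set E1 := fun m => _ in e1.
exists (`|psum E1 `|r| | + `|psum (pseries_diffs E1) `|r| |); first by rewrite addr_ge0.
move=> lam mu lL mL.
have lB x : `|x| <= L -> `|tau ^+ 2 - x| <= B.
  move=> xL; apply: le_trans (ler_normB _ _) _; rewrite ger0_norm//.
  have := ler_norm L; rewrite /B; lra.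
have tB : `|- (2 * tau)| <= B by rewrite normrN /B; lra.
have oB : `|1 : R| <= B by rewrite normr1.
have key m := coef_lip m B1 (lB _ lL) (lB _ mL) tB oB.
have dlm : `|tau ^+ 2 - lam - (tau ^+ 2 - mu)| = `|lam - mu|.
  by rewrite distrC; congr `|_|; ring.
have d0 : 0 <= `|lam - mu| by [].
split.
- apply: le_trans (psum_lip (e := E1) (a := `|lam - mu|) _ _ _ _ _ _) _ => //.
  + exact: entire_coef.
  + exact: entire_coef.
  + by move=> m; rewrite -dlm; exact: key.
  + rewrite mulrC ler_wpM2r//; have := ler_norm (psum E1 `|r|); have := normr_ge0 (psum (pseries_diffs E1) `|r|); lra.
- apply: le_trans (psum_lip (e := pseries_diffs E1) (a := `|lam - mu|) _ _ _ _ _ _) _ => //.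
  + exact/entire_diffs/entire_coef.
  + exact/entire_diffs/entire_coef.
  + move=> m; rewrite /pseries_diffs -mulrBr normrM normr_nat mulrCA ler_wpM2l//.
    by rewrite -dlm; exact: key.
  + rewrite mulrC ler_wpM2r//; have := normr_ge0 (psum E1 `|r|); have := ler_norm (psum (pseries_diffs E1) `|r|); lra.
Qed.

End Phi.

Section Solutions.
Variable R : realType.
Implicit Types (tau lam r L a b lo : R) (y dy : R -> R).

(** The equation is stated for [r u'] instead of [u'']: this is the form that
remains meaningful at [r = 0]. *)
Definition sol tau lam lo y dy := forall r, lo <= r ->
  is_derive r 1 y (dy r) /\
  is_derive r 1 (fun s => s * dy s) (r * ((r - tau) ^+ 2 - lam) * y r).

Lemma phi_sol tau lam lo : sol tau lam lo (phi tau lam) (dphi tau lam).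
Proof.
move=> r _; split; first exact: phi_deriv.
apply: is_derive_eq (isdM (isd_id r) (dphi_deriv tau lam r)) _.
by rewrite -phi_eq mul1r addrC.
Qed.

Lemma solZ tau lam lo y dy c : sol tau lam lo y dy ->
  sol tau lam lo (fun r => c * y r) (fun r => c * dy r).
Proof.
move=> S r lr; have [yd pd] := S r lr; split; first exact: isdZ.
apply: (isd_ext (f := fun s => c * (s * dy s))) => [s|]; first by ring.
by apply: is_derive_eq (isdZ c pd) _; ring.
Qed.

(** Where the energy is below the potential, a solution that starts positive with
[y' >= 0] keeps growing, because [(r y')'] has the sign of [y]. *)
Lemma sol_grow tau lam a b y dy : 0 <= a -> sol tau lam a y dy ->
  (forall r, a <= r <= b -> 0 <= (r - tau) ^+ 2 - lam) -> 0 < y a -> 0 <= a * dy a ->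
  forall r, a <= r <= b -> y a <= y r /\ 0 <= r * dy r.
Proof.
move=> a0 S Q0 ya pa.
have key c : a <= c <= b -> (forall r, a <= r < c -> 0 < y r) -> y a <= y c /\ 0 <= c * dy c.
  move=> /andP[ac cb] pos.
  have p0 x : a <= x <= c -> 0 <= x * dy x.
    move=> /andP[ax xc]; apply: le_trans pa _.
    apply: (@mono_le _ (fun s => s * dy s) (fun z => z * ((z - tau) ^+ 2 - lam) * y z) a x ax) => [z /andP[az zx]|z /andP[az zx]].
      by have [] := S z az.
    have az' := ltW az; apply: mulr_ge0; last by rewrite ltW// pos//; apply/andP; split=> //; lra.
    by apply: mulr_ge0; [lra | apply: Q0; apply/andP; split; lra].
  split; last by apply: p0; rewrite ac lexx.
  apply: (@mono_le _ y dy a c ac) => [z /andP[az zx]|z /andP[az zx]].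
    by have [] := S z az.
  have := p0 z; rewrite (ltW az) (ltW zx) => /(_ isT).
  by rewrite pmulr_rge0//; lra.
move=> r /andP[ar rb]; apply: (key); first by rewrite ar.
move=> x /andP[ax xr]; rewrite ltNge; apply/negP => yx.
have ax' : a < x by rewrite lt_neqAle ax andbT; apply/eqP => e; move: yx; rewrite -e leNgt ya.
have [|c [/andP[ac cx] yc pos]] := first_zero ax' _ ya yx.
  by move=> z /andP[az _]; have [yd _] := S z az; exact: isd_cts yd.
have [||] := key c; [by apply/andP; split; lra | exact: pos | rewrite yc; lra].
Qed.

(** Gronwall's argument: [E = y^2 + (r y')^2] satisfies [|E'| <= K E] on bounded
intervals away from the origin. *)
Lemma sol_unique tau lam lo y dy r0 : 0 < lo -> sol tau lam lo y dy -> lo <= r0 ->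
  y r0 = 0 -> dy r0 = 0 -> forall r, lo <= r -> y r = 0 /\ dy r = 0.
Proof.
move=> lo0 S lr0 yr0 dyr0 r lr.
pose b := r0 + r.
pose K := lo^-1 + b * ((b + `|tau|) ^+ 2 + `|lam|).
pose E s := y s ^+ 2 + (s * dy s) ^+ 2.
pose dE s := 2 * (y s * (s * dy s)) * (s^-1 + s * ((s - tau) ^+ 2 - lam)).
have ED s : lo <= s -> is_derive s 1 E (dE s).
  move=> ls; have [yd pd] := S s ls; have s0 : s != 0 by rewrite gt_eqF//; lra.
  apply: (isd_ext (f := fun s => y s * y s + (s * dy s) * (s * dy s))) => [t|].
    by rewrite /E !expr2.
  apply: is_derive_eq (isdD (isdM yd yd) (isdM pd pd)) _.
  by rewrite /dE; field.
have E0 s : 0 <= E s by rewrite addr_ge0 ?sqr_ge0.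
have KE s : lo <= s <= b -> `|dE s| <= K * E s.
  move=> /andP[ls sb]; rewrite /dE normrM mulrC; apply: ler_pM => //.
    apply: le_trans (ler_normD _ _) _; apply: lerD.
      by rewrite ger0_norm ?invr_ge0 ?lef_pV2 ?posrE//; lra.
    rewrite normrM ger0_norm; last lra.
    apply: ler_pM => //; first lra.
    apply: le_trans (ler_normB _ _) _; rewrite lerD2r normrX lerXn2r ?nnegrE//.
      by rewrite addr_ge0//; lra.
    apply: le_trans (ler_normB _ _) _; rewrite lerD2r ger0_norm//; lra.
  rewrite /E ler_norml; apply/andP; split; have := sqr_ge0 (y s + s * dy s);
    have := sqr_ge0 (y s - s * dy s); rewrite sqrrB sqrrD; lra.
suff Er : E r = 0.
  have : y r ^+ 2 = 0 /\ (r * dy r) ^+ 2 = 0.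
    by move: Er; rewrite /E; have := sqr_ge0 (y r); have := sqr_ge0 (r * dy r); lra.
  move=> [/eqP + /eqP]; rewrite !sqrf_eq0 mulf_eq0 => /eqP -> /orP[/eqP|/eqP ->] //; lra.
have Er0 : E r0 = 0 by rewrite /E yr0 dyr0 mulr0 expr0n addr0.
apply/eqP; rewrite eq_le E0 andbT.
have [r0r|rr0] := leP r0 r.
- rewrite -(pmulr_lle0 _ (expR_gt0 (- K * r))).
  have -> : 0 = E r0 * expR (- K * r0) by rewrite Er0 mul0r.
  rewrite -lerN2.
  apply: (@mono_le _ (fun s => - (E s * expR (- K * s))) (fun s => - (dE s * expR (- K * s) + E s * (expR (- K * s) * - K)))) => //.
    move=> s /andP[rs sr]; have ls : lo <= s by lra.
    exact: (isdN (isdM (ED s ls) (isd_expR_lin _ s))).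
  move=> s /andP[rs sr]; have := KE s; have : lo <= s <= b by rewrite /b; apply/andP; split; lra.
  move=> -> /(_ isT); rewrite ler_norml => /andP[_ h].
  have := expR_gt0 (- K * s); nra.
- rewrite -(pmulr_lle0 _ (expR_gt0 (K * r))).
  have -> : 0 = E r0 * expR (K * r0) by rewrite Er0 mul0r.
  apply: (@mono_le _ (fun s => (E s * expR (K * s))) (fun s => (dE s * expR (K * s) + E s * (expR (K * s) * K)))).
  + exact: ltW.
  + move=> s /andP[rs sr]; have ls : lo <= s by lra.
    exact: (isdM (ED s ls) (isd_expR_lin _ s)).
  move=> s /andP[rs sr]; have := KE s; have : lo <= s <= b by rewrite /b; apply/andP; split; lra.
  move=> -> /(_ isT); rewrite ler_norml => /andP[h _].
  have := expR_gt0 (K * s); nra.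
Qed.

End Solutions.

(** * Growth and decay beyond the turning point *)

Section Decay.
Variable R : realType.
Implicit Types (tau lam r L a b lo rs : R) (y dy : R -> R).

(** A double zero would make [phi] vanish on the half-line, against [phi 0 =
1]. *)
Lemma phi_zero_simple tau lam r : 0 < r -> phi tau lam r = 0 -> dphi tau lam r = 0 -> False.
Proof.
move=> r0 f0 d0.
have z s : 0 < s -> phi tau lam s = 0.
  move=> s0; pose m := Num.min r s.
  have m0 : 0 < m by rewrite lt_min r0.
  have mr : m <= r by rewrite ge_min lexx.
  have ms : m <= s by rewrite ge_min lexx orbT.
  by have [] := sol_unique m0 (@phi_sol _ tau lam m) mr f0 d0 ms.
have : 0 <= - phi tau lam 0.
  apply: (cts_ge0r (f := fun s => - phi tau lam s) (b := 1)); rewrite ?ltr01//.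
    by apply: (isd_cts (a := - dphi tau lam 0)); apply: isdN; exact: phi_deriv.
  by move=> s /andP[s0 _]; rewrite z// oppr0.
by rewrite phi_0 oppr_ge0 ler10.
Qed.

Lemma phi_neq0_between tau lam a b : 0 <= a -> a < b ->
  exists2 s, a < s < b & phi tau lam s != 0.
Proof.
move=> a0 ab; apply: contrapT => H.
have z s : a < s < b -> phi tau lam s = 0.
  by move=> sab; apply/eqP; apply: contrapT => /negP h; apply: H; exists s.
pose c := (a + b) / 2; have ac : a < c by rewrite /c; lra.
have cb : c < b by rewrite /c; lra.
have fc : phi tau lam c = 0 by rewrite z// ac.
apply: (@phi_zero_simple tau lam c _ fc); first lra.
apply/eqP; rewrite eq_le; apply/andP; split.
  by apply: (derive_le0l (phi_deriv tau lam c) ac fc) => s /andP[? ?]; rewrite z//;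
    apply/andP; split; lra.
by apply: (derive_ge0r (phi_deriv tau lam c) cb fc) => s /andP[? ?]; rewrite z//;
    apply/andP; split; lra.
Qed.

(** Beyond the turning point a solution either moves away from zero for ever or
tends to zero; the sign of [phi * phi'] tells the two cases apart without
mentioning limits. *)
Definition decays tau lam rs := forall r, rs <= r -> phi tau lam r * dphi tau lam r <= 0.

(** From [rs] on the motion is classically forbidden, with a margin of [1] in
the energy. *)
Definition barrier tau lam rs :=
  1 <= rs /\ forall r, rs <= r -> 1 <= (r - tau) ^+ 2 - lam.

Lemma grows_ge tau lam rs y dy r0 : barrier tau lam rs -> sol tau lam rs y dy ->
  rs <= r0 -> 0 < y r0 -> 0 <= dy r0 -> forall r, r0 <= r -> y r0 <= y r /\ 0 <= dy r.
Proof.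
move=> [rs1 Q] S r0s y0 dy0 r r0r.
have S' : sol tau lam r0 y dy by move=> s r0s'; apply: S; lra.
have [||//|//|yy pp] := @sol_grow _ tau lam r0 r y dy _ S' _ y0 _ r.
- lra.
- by move=> s /andP[sr _]; have := Q s (le_trans r0s sr); lra.
- by rewrite mulr_ge0//; lra.
- by rewrite r0r lexx.
by split=> //; rewrite pmulr_rge0 in pp; lra.
Qed.

(** [y^2] is nonincreasing, so a zero would propagate to the right, which
uniqueness excludes. *)
Lemma decay_neq0 tau lam rs y dy : barrier tau lam rs -> sol tau lam rs y dy ->
  (forall r, rs <= r -> y r * dy r <= 0) -> (exists2 r, rs <= r & y r != 0) ->
  forall r, rs <= r -> y r != 0.
Proof.
move=> [rs1 Q] S D [q qs yq] r rsr; apply/eqP => yr.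
have z s : r <= s -> y s = 0.
  move=> sr.
  have : - (y r * y r) <= - (y s * y s).
    apply: (@mono_le _ (fun s => - (y s * y s)) (fun s => - (dy s * y s + y s * dy s)) _ _ sr).
      move=> u /andP[ru us]; have [yd _] := S u (le_trans rsr ru).
      exact: (isdN (isdM yd yd)).
    by move=> u /andP[ru us]; have := D u (le_trans rsr (ltW ru)); lra.
  rewrite yr mul0r oppr0 oppr_ge0 => yy; apply/eqP; rewrite -sqrf_eq0 expr2 eq_le yy.
  by rewrite -expr2 sqr_ge0.
have r10 : rs <= r + 1 by lra.
have dz : dy (r + 1) = 0.
  have [yd _] := S _ r10.
  have y0 : y (r + 1) = 0 by rewrite z//; lra.
  apply/eqP; rewrite eq_le; apply/andP; split.
    by apply: (derive_le0l (a := r) yd _ y0); [lra | move=> s /andP[? ?]; rewrite z//; lra].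
  by apply: (derive_ge0r (b := r + 2) yd _ y0); [lra | move=> s /andP[? ?]; rewrite z//; lra].
have [||yq0 _] := @sol_unique _ tau lam rs y dy (r + 1) _ S r10 _ dz q qs; first lra.
  by rewrite z//; lra.
by rewrite yq0 eqxx in yq.
Qed.

(** The margin in [barrier] makes [z = y' + y] satisfy [z' >= z].  If [z] were
positive somewhere it would grow exponentially, while [z <= y] is bounded.
Hence [y' <= - y]. *)
Lemma decay_exp tau lam rs y dy : barrier tau lam rs -> sol tau lam rs y dy ->
  (forall r, rs <= r -> 0 < y r) -> (forall r, rs <= r -> dy r <= 0) ->
  forall r, rs <= r -> y r <= y rs * expR (rs - r).
Proof.
move=> [rs1 Q] S yp dyn.
pose z s := dy s + y s.
have dyd s : rs <= s -> is_derive s 1 dy (- dy s / s + ((s - tau) ^+ 2 - lam) * y s).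
  move=> rss; have [_ pd] := S s rss; have s0 : s != 0 by rewrite gt_eqF//; lra.
  have h := isdM (@is_deriveV _ (fun s => s) s 1 1 s0 (isd_id s)) pd.
  apply: (@near_eq_is_derive R R^o R^o (fun s => s^-1 * (s * dy s)) dy s 1).
    near=> u; have u0 : u != 0.
      by rewrite gt_eqF//; near: u; apply: lt_nbhsr; lra.
    by rewrite mulKf.
  apply: is_derive_eq h _; rewrite /GRing.scale /=; field; exact: s0.
have key s : rs <= s -> dy s + y s <= 0.
  move=> rss; rewrite leNgt; apply/negP => zs.
  have zmono u : s <= u -> z s * expR (- s) <= z u * expR (- u).
    move=> su; rewrite -[- s]mulN1r -[- u]mulN1r.
    apply: (@mono_le _ (fun s => z s * expR (-1 * s)) (fun s => (- dy s / s + ((s - tau) ^+ 2 - lam) * y s + dy s) * expR (-1 * s) + z s * (expR (-1 * s) * -1)) _ _ su).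
      move=> v /andP[sv vu]; have rsv := le_trans rss sv; have [yd _] := S v rsv.
      exact: (isdM (isdD (dyd v rsv) yd) (isd_expR_lin _ _)).
    move=> v /andP[sv vu]; have rsv : rs <= v by lra.
    have := expR_gt0 (-1 * v); have := Q v rsv; have := yp v rsv; have := dyn v rsv.
    move=> d1 y1 q1 e1; rewrite /z.
    have v0 : 0 <= v^-1 by rewrite invr_ge0; lra.
    have h1 : 0 <= - dy v / v by rewrite mulr_ge0// oppr_ge0.
    have h2 : y v <= ((v - tau) ^+ 2 - lam) * y v by rewrite ler_peMl// ltW.
    rewrite [leRHS](_ : _ = (- dy v / v + (((v - tau) ^+ 2 - lam) * y v - y v)) * expR (-1 * v)); last by ring.
    by rewrite mulr_ge0 ?(ltW e1)// addr_ge0// subr_ge0.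
  (* with this [u] one has [z s * (1 + (u - s)) = 2 * z s + y s], which exceeds
     the upper bound [y s] of [z u] *)
  pose u := s + (y s) / (z s) + 1.
  have ys := yp s rss.
  have yz : 0 <= y s / z s by apply: divr_ge0; exact: ltW.
  have su : s <= u by rewrite /u; lra.
  have yu : y u <= y s.
    rewrite -lerN2; apply: (@mono_le _ (fun s => - y s) (fun s => - dy s) _ _ su).
      by move=> v /andP[sv vu]; apply: isdN; have [] := S v (le_trans rss sv).
    by move=> v /andP[sv vu]; rewrite oppr_ge0 dyn//; lra.
  have zu := zmono u su.
  have eu : expR (- s) = expR (u - s) * expR (- u) by rewrite -expRD; congr expR; ring.
  move: zu; rewrite eu mulrA ler_pM2r ?expR_gt0// => zu.
  have e1 : 1 + (u - s) <= expR (u - s) by exact: expR_ge1Dx.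
  have : z s * (1 + (u - s)) <= z u by apply: le_trans zu; rewrite ler_wpM2l// ltW.
  have -> : z s * (1 + (u - s)) = 2 * z s + y s by rewrite /u; field; rewrite gt_eqF.
  rewrite {2}/z; have := dyn u (le_trans rss su); move: zs; rewrite -/(z s); lra.
move=> r rsr.
have : - (y rs * expR (1 * rs)) <= - (y r * expR (1 * r)).
  apply: (@mono_le _ (fun s => - (y s * expR (1 * s))) (fun s => - (dy s * expR (1 * s) + y s * (expR (1 * s) * 1))) _ _ rsr).
    move=> v /andP[sv vu]; have [yd _] := S v sv.
    exact: (isdN (isdM yd (isd_expR_lin _ _))).
  move=> v /andP[sv vu]; have := key v (ltW sv); have := expR_gt0 (1 * v); nra.
rewrite lerN2 !mul1r => h.
by rewrite expRD expRN mulrA ler_pdivlMr ?expR_gt0.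
Unshelve. all: by end_near. Qed.

(** [- r y'] is nonincreasing, so [- y'] at [r] is dominated by a mean slope
of [y] on [[r - 1, r]]. *)
Lemma decay_dexp tau lam rs y dy : barrier tau lam rs -> sol tau lam rs y dy ->
  (forall r, rs <= r -> 0 < y r) -> (forall r, rs <= r -> dy r <= 0) ->
  forall r, rs + 1 <= r -> - dy r <= y (r - 1).
Proof.
move=> [rs1 Q] S yp dyn r r1.
have [||s /andP[s1 sr] e] := @mvt _ y dy (r - 1) r; first lra.
  by move=> v /andP[v1 vr]; have [|//] := S v; lra.
have rss : rs <= s by lra.
have rsr : rs <= r by lra.
have : s * dy s <= r * dy r.
  apply: (@mono_le _ (fun s => s * dy s) (fun r => r * ((r - tau) ^+ 2 - lam) * y r) _ _ (ltW sr)).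
    by move=> v /andP[v1 vr]; have [|//] := S v; lra.
  move=> v /andP[v1 vr]; have rsv : rs <= v by lra.
  by rewrite !mulr_ge0//; [lra | have := Q v rsv; lra | rewrite ltW// yp].
have := dyn s rss; have := dyn r rsr; have := yp r rsr.
have := yp (r - 1) (_ : rs <= r - 1); rewrite lerBrDr => /(_ r1).
have : dy s * (r - (r - 1)) = dy s by ring.
move: e => /[swap] -> e; nra.
Qed.

End Decay.

(** * Oscillation of the regular solution and eigenvalues *)

Section Eigen.
Variable R : realType.
Implicit Types (tau lam mu r L a b lo rs s : R).

Lemma phi_cts tau lam r : {for r, continuous (phi tau lam)}.
Proof. exact: isd_cts (phi_deriv tau lam r). Qed.

Definition oscillates tau lam m := exists x, chain 0 (phi tau lam) m x.

Lemma oscillates0 tau lam : oscillates tau lam 0.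
Proof. by exists 0; split=> //; rewrite phi_0. Qed.

Lemma decays_sign tau lam rs : barrier tau lam rs -> decays tau lam rs ->
  exists2 s, is_sign s & forall r, rs <= r -> 0 < s * phi tau lam r /\ s * dphi tau lam r <= 0.
Proof.
move=> B D; have [rs1 Q] := B.
have nz : forall r, rs <= r -> phi tau lam r != 0.
  apply: (decay_neq0 B (@phi_sol _ tau lam rs) D).
  have [|//|y /andP[ry _] fy] := @phi_neq0_between _ tau lam rs (rs + 1); [lra|lra|].
  by exists y => //; exact: ltW.
have [s ss fs] : exists2 s, is_sign s & 0 < s * phi tau lam rs.
  have := nz rs (lexx _); rewrite neq_lt => /orP[h|h].
    by exists (-1); [right | rewrite mulN1r oppr_gt0].
  by exists 1; [left | rewrite mul1r].
exists s => // r rsr.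
have fr : 0 < s * phi tau lam r.
  rewrite ltNge; apply/negP => h.
  have [||c /andP[rc cr] fc] := @ivt0 _ (phi tau lam) rs r rsr.
  - by move=> z _; exact: phi_cts.
  - by case: ss fs h => ->; rewrite ?mul1r ?mulN1r; nra.
  by have := nz c rc; rewrite fc eqxx.
split => //; have := D r rsr; move: fr; case: ss => ->; rewrite ?mul1r ?mulN1r; nra.
Qed.

(** The sign at infinity of a solution that does not decay.  The condition is at a
single point, hence open in the energy, and by [sol_grow] it persists to the
right of this point. *)
Definition grows s tau lam rs :=
  exists2 r0, rs <= r0 & 0 < s * phi tau lam r0 /\ 0 < s * dphi tau lam r0.

Lemma decays_or_grows tau lam rs : decays tau lam rs \/ exists2 s, is_sign s & grows s tau lam rs.
Proof.
have [|H] := pselect (decays tau lam rs); [by left|right].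
have [r [rr h]] : exists r, rs <= r /\ 0 < phi tau lam r * dphi tau lam r.
  apply: contrapT => H'; apply: H => r rsr; rewrite leNgt; apply/negP => h.
  by apply: H'; exists r.
have [f0|f0] := ltP 0 (phi tau lam r).
  exists 1; first by left.
  by exists r => //; rewrite !mul1r; split=> //; rewrite pmulr_rgt0 in h.
have fn : phi tau lam r < 0.
  by rewrite lt_neqAle f0 andbT; apply/eqP => e; rewrite e mul0r ltxx in h.
exists (-1); first by right.
by exists r => //; rewrite !mulN1r !oppr_gt0; split=> //; rewrite nmulr_rgt0 in h.
Qed.

Lemma grows_pos s tau lam rs : barrier tau lam rs -> grows s tau lam rs ->
  exists2 r0, rs <= r0 & 0 < s * phi tau lam r0 /\
    forall r, r0 <= r -> s * phi tau lam r0 <= s * phi tau lam r.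
Proof.
move=> B [r0 rr [f0 d0]]; exists r0 => //; split => // r r0r.
by have [] := grows_ge B (solZ s (@phi_sol _ tau lam rs)) rr f0 (ltW d0) r0r.
Qed.

Lemma grows_uniq s t tau lam rs : barrier tau lam rs -> grows s tau lam rs ->
  grows t tau lam rs -> is_sign s -> is_sign t -> s = t.
Proof.
move=> B /(grows_pos B)[r rr [f0 fr]] /(grows_pos B)[q qr [g0 gr]] ss st.
pose m := Num.max r q.
have := fr m; rewrite le_max lexx => /(_ isT); have := gr m; rewrite le_max lexx orbT => /(_ isT).
by case: ss st f0 g0 {fr gr} => -> [] ->; rewrite ?mul1r ?mulN1r => //; lra.
Qed.

(** One more sign change is available at infinity when the sign there differs
from the last one in the chain. *)
Lemma grows_oscillates m tau lam rs : barrier tau lam rs -> grows ((-1) ^+ m.+1) tau lam rs ->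
  oscillates tau lam m -> oscillates tau lam m.+1.
Proof.
move=> B /(grows_pos B)[r rr [f0 fr]] [x ch].
exists (Num.max r (x + 1)); split.
  by apply: lt_le_trans f0 (fr _ _); rewrite le_max lexx.
by exists x => //; rewrite lt_max ltrDl ltr01 orbT.
Qed.

Definition phi_wronskian tau lam mu r :=
  r * dphi tau lam r * phi tau mu r - phi tau lam r * (r * dphi tau mu r).

Lemma phi_sturm_pair hi tau lam mu : lam < mu ->
  sturm_pair 0 hi (phi tau lam) (dphi tau lam) (phi tau mu) (fun r => r)
    (fun r => r * (mu - lam)) (phi_wronskian tau lam mu).
Proof.
move=> lm; split.
- by move=> x _; exact: phi_deriv.
- by move=> x _; exact: phi_cts.
- by move=> a b a0 ab _; exact: phi_neq0_between.
have Wd (x : R) : is_derive x 1 (phi_wronskian tau lam mu)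
    (x * (mu - lam) * phi tau lam x * phi tau mu x).
  have [fd pd] := @phi_sol _ tau lam x x (lexx _).
  have [gd qd] := @phi_sol _ tau mu x x (lexx _).
  by apply: is_derive_eq (isdB (isdM pd gd) (isdM fd qd)) _; ring.
split=> //.
- by move=> x _; exact: isd_cts (Wd x).
- by move=> x /andP[x0 _]; rewrite mulr_gt0// subr_gt0.
- by move=> x /andP[].
- by move=> x _ fx; rewrite /phi_wronskian fx; ring.
Qed.

(** Sturm comparison on an unbounded interval: if [phi tau lam] decays, infinity
acts as its last zero.  Otherwise [phi tau mu] would keep one sign after [a],
the Wronskian would stay above a positive constant, and this contradicts the
exponential decay of [phi tau lam], since [r] times the
derivative of [phi tau mu], which then moves towards zero, is bounded. *)
Lemma sturm_tail tau lam mu rs a x s : lam < mu -> barrier tau lam rs ->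
  barrier tau mu rs -> decays tau lam rs -> is_sign s -> 0 <= a -> a < x ->
  phi tau lam a = 0 \/ a = 0 -> phi tau lam x != 0 ->
  exists2 y, a < y & 0 < s * phi tau mu y.
Proof.
move=> lm Bl Bm D ss a0 ax fa fx; apply: contrapT => H.
have g0 y : a < y -> 0 <= - s * phi tau mu y.
  by move=> ay; rewrite mulNr oppr_ge0 leNgt; apply/negP => h; apply: H; exists y.
have [u su ux] : exists2 u, is_sign u & 0 < u * phi tau lam x.
  move: fx; rewrite neq_lt => /orP[h|h].
    by exists (-1); [right | rewrite mulN1r oppr_gt0].
  by exists 1; [left | rewrite mul1r].
have ssN : is_sign (- s) by case: ss => ->; [right|left; rewrite opprK].
have P hi := sturm_pair_scale (is_sign_unit su) (is_sign_unit ssN) (phi_sturm_pair hi tau lm).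
pose F r := u * phi tau lam r; pose dF r := u * dphi tau lam r.
pose G r := - s * phi tau mu r; pose dG r := - s * dphi tau mu r.
pose W x := u * - s * phi_wronskian tau lam mu x; have {}P hi : sturm_pair 0 hi F dF G (fun r => r) (fun r => r * (mu - lam)) W := P hi.
have Wa : 0 < u * phi tau lam a -> 0 <= W a.
  case: fa => [->|a00 _]; first by rewrite mulr0 ltxx.
  by rewrite /W /phi_wronskian a00; nra.
have [|al [/andP[aal alx] Wal pos]] := sturm_left (P x) a0 ax (lexx x) Wa ux.
  by move=> y /andP[ay _]; exact: g0.
have pos' y : al < y -> 0 < u * phi tau lam y.
  move=> aly; have [yx|xy] := leP y x; first by rewrite pos// aly.
  rewrite ltNge; apply/negP => fy.
  have [z|c [/andP[xc cy] fc _]] := @first_zero _ (fun r => u * phi tau lam r) x y xy _ ux fy.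
    by move=> _; apply: isd_cts (isdZ u (phi_deriv tau lam z)).
  by apply: (sturm_one (P c) a0 ax xc (lexx c) Wa ux fc) => v /andP[av _]; exact: g0.
have [v sv vP] := decays_sign Bl D.
have [rs1 _] := Bl.
pose r1 := Num.max rs (x + 1).
have r1rs : rs <= r1 by rewrite le_max lexx.
have r1x : x + 1 <= r1 by rewrite le_max lexx orbT.
have uv : u = v.
  have [h _] := vP r1 r1rs; have := pos' r1 (_ : al < r1); have -> : al < r1 by lra.
  by move=> /(_ isT); case: su sv h {vP} => -> [] ->; rewrite ?mul1r ?mulN1r //; lra.
subst v.
have WE r : W r = r * dF r * G r - F r * (r * dG r).
  by rewrite /W /phi_wronskian /F /dF /G /dG; ring.
have Sl : sol tau lam rs F dF := solZ u (@phi_sol _ tau lam rs).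
have Sm : sol tau mu rs G dG := solZ (- s) (@phi_sol _ tau mu rs).
have Fp r : rs <= r -> 0 < F r by move=> /vP[].
have dFn r : rs <= r -> dF r <= 0 by move=> /vP[].
have Gp r : r1 <= r -> 0 <= G r by move=> h; apply: g0; lra.
have w1 : 0 < W r1.
  have h : al < r1 by lra.
  apply: (sturm_pos (P r1) (le_trans a0 aal) h (lexx r1) Wal) => y /andP[aly _]; first exact: pos'.
  by apply: g0; lra.
have Wmono r : r1 <= r -> W r1 <= W r.
  move=> h; have [_ _ _ [Wd _ k0 _ _]] := P (r + 1).
  apply: (mono_le h (df := fun z => z * (mu - lam) * F z * G z)) => z /andP[z1 zr].
    by apply: Wd; apply/andP; split; lra.
  apply: mulr_ge0; last by apply: g0; lra.
  by apply: mulr_ge0; apply: ltW; [apply: k0; apply/andP; split; lra | apply: pos'; lra].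
have dGn r : r1 <= r -> dG r < 0.
  move=> h; have wr := lt_le_trans w1 (Wmono r h); rewrite WE in wr.
  have f1 := Fp r (le_trans r1rs h); have f2 := dFn r (le_trans r1rs h); have f3 := Gp r h.
  rewrite ltNge; apply/negP => f4.
  have h1 : 0 <= - (r * dF r) * G r by rewrite mulr_ge0// oppr_ge0 mulr_ge0_le0//; lra.
  have h2 : 0 <= F r * (r * dG r) by rewrite mulr_ge0 ?(ltW f1)// mulr_ge0//; lra.
  lra.
pose B := - (r1 * dG r1).
have pG r : r1 <= r -> - (r * dG r) <= B.
  move=> h; rewrite lerN2.
  apply: (@mono_le _ (fun r => r * dG r) (fun r => r * ((r - tau) ^+ 2 - mu) * G r) _ _ h).
    by move=> z /andP[z1 _]; have [|//] := Sm z; lra.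
  move=> z /andP[z1 _]; have [_ Q] := Bm; have := Q z (_ : rs <= z).
  have -> : rs <= z by lra.
  by move=> /(_ isT) q; apply: mulr_ge0; [apply: mulr_ge0; lra | apply: Gp; lra].
have B0 : 0 < B by rewrite /B oppr_gt0 nmulr_llt0 ?dGn//; lra.
have FE := decay_exp Bl Sl Fp dFn.
pose M := F rs * expR rs * B.
have M0 : 0 < M by apply: mulr_gt0 => //; apply: mulr_gt0; rewrite ?expR_gt0 ?Fp.
(* at this point [W r1 * exp r <= M] is contradicted by [exp r > r] *)
pose r := r1 + M / W r1.
have rr1 : r1 <= r by rewrite lerDl divr_ge0// ltW.
have rsr := le_trans r1rs rr1.
have h1 : W r <= F r * B.
  rewrite WE; have f2 := dFn r rsr; have f3 := Gp r rr1.
  have h1 : 0 <= - (r * dF r) * G r by rewrite mulr_ge0// oppr_ge0 mulr_ge0_le0//; lra.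
  have := ler_wpM2l (ltW (Fp r rsr)) (pG r rr1); lra.
have h2 : W r1 * expR r <= M.
  have h := le_trans (Wmono r rr1) h1.
  have := FE r rsr; rewrite expRD expRN mulrA ler_pdivlMr ?expR_gt0// => fe.
  have := ler_wpM2r (ltW (expR_gt0 r)) h; have := ler_wpM2r (ltW B0) fe; rewrite /M; lra.
have h3 : r < expR r by have := expR_gt1Dx (_ : r != 0); rewrite gt_eqF; [move=> /(_ isT); lra|lra].
have : W r1 * r < M by apply: lt_le_trans h2; rewrite ltr_pM2l.
rewrite /r mulrDr mulrCA mulfV ?gt_eqF// mulr1 gtrDr ltNge mulr_ge0//; [exact: ltW | lra].
Qed.

(** Each nodal interval of a decaying solution, including the first one, which
starts at [0], and the last one, which is unbounded, contains a sign change or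
an additional sign of the solution at the larger energy. *)
Lemma eigenvalue_oscillates tau lam mu rs m : lam < mu -> barrier tau lam rs ->
  barrier tau mu rs -> decays tau lam rs ->
  oscillates tau lam m -> oscillates tau mu m.+1.
Proof.
move=> lm Bl Bm D [x ch].
have c0 : chain 0 (phi tau mu) 0 0 by rewrite /= lexx phi_0.
case: m ch => [_|m [fx [z zx ch]]].
  have [t /andP[t0 _] ft] := phi_neq0_between tau lam (lexx 0) ltr01.
  have [||y y0 fy] := sturm_tail lm Bl Bm D _ (lexx 0) t0 _ ft (s := -1).
  - by right.
  - by right.
  by exists y => /=; rewrite expr1; split=> //; exists 0.
have [c /andP[zc cx] fc] := chain_zero (fun z _ => @phi_cts tau lam z) ch zx fx.
have P := phi_sturm_pair c tau lm.
have [||y yc chy] := @chain_transfer _ 0 c 0 (phi tau lam) (phi tau mu) (fun z _ => @phi_cts tau lam z) _ _ m z c ch zc (lexx c) fc.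
- move=> x' c' x'0 x'c' c'c fx' fc'.
  have W0 : phi_wronskian tau lam mu 0 = 0 by rewrite /phi_wronskian; ring.
  have [d d0 dP] := cts_pos (@phi_cts tau lam x') fx'.
  pose t := x' + Num.min (d / 2) ((c' - x') / 2).
  have t1 : Num.min (d / 2) ((c' - x') / 2) <= d / 2 by rewrite ge_min lexx.
  have t2 : Num.min (d / 2) ((c' - x') / 2) <= (c' - x') / 2 by rewrite ge_min lexx orbT.
  have t3 : 0 < Num.min (d / 2) ((c' - x') / 2) by rewrite lt_min; apply/andP; split; lra.
  have t0 : 0 < t by rewrite /t; lra.
  have tc : t < c' by rewrite /t; lra.
  have ft : 0 < phi tau lam t.
    by apply: dP; rewrite distrC ger0_norm /t; lra.
  have [||y /andP[y0 yc] fy] := sturm_signs_left P _ (lexx 0) t0 tc c'c _ ft fc' (s := -1).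
  - by right.
  - by rewrite W0 mulr0.
  by exists y => //=; rewrite expr1; split=> //; exists 0.
- move=> a x' c' a0 ax' xc' c'c fa fc' fx' s ss.
  exact: (sturm_signs P ss a0 ax' xc' c'c fa fc' fx').
have c00 : 0 <= c by rewrite (le_trans (chain_lo ch))// ltW.
have [|||w cw fw] := @sturm_tail tau lam mu rs c x ((-1) ^+ m.+2) lm Bl Bm D _ c00 cx.
- exact: sign_cases.
- by left.
- by apply/eqP => e; rewrite e mulr0 ltxx in fx.
by exists w; split => //; exists y => //; exact: lt_trans yc cw.
Qed.

End Eigen.

(** * Hermite functions *)

Section Hermite.
Variable R : realType.
Implicit Types (x t M : R) (n m : nat).

(** The physicists' normalisation, generated by the raising operator [2 x -
d/dx]. *)
Fixpoint hermite n : {poly R} :=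
  if n is n'.+1 then 2%:P * 'X * hermite n' - (hermite n')^`() else 1.

Definition He n x := (hermite n).[x].
Definition dHe n x := ((hermite n)^`()).[x].

Lemma hermiteS n : hermite n.+1 = 2%:P * 'X * hermite n - (hermite n)^`().
Proof. by []. Qed.

Lemma hermite_deriv n : (hermite n.+1)^`() = (2 * n.+1%:R)%:P * hermite n.
Proof.
elim: n => [|n IH].
  by rewrite /= -polyC1 derivC subr0 polyC1 !mulr1 derivM derivC derivX mul0r add0r mulr1.
rewrite (hermiteS n.+1) derivB derivM derivM derivC derivX mul0r add0r mulr1 IH.
rewrite derivM derivC mul0r add0r.
have -> : (2 * n.+2%:R)%:P = (2 * n.+1%:R)%:P + 2%:P :> {poly R}.
  by rewrite -polyCD -[in LHS](natr1 n.+1); congr (_%:P); ring.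
rewrite (hermiteS n); ring.
Qed.

Lemma He_rec n x : He n.+2 x = 2 * x * He n.+1 x - 2 * n.+1%:R * He n x.
Proof.
by rewrite /He (hermiteS n.+1) hermite_deriv !hornerE.
Qed.

Lemma dHeS n x : dHe n.+1 x = 2 * n.+1%:R * He n x.
Proof. by rewrite /dHe hermite_deriv !hornerE. Qed.

Lemma HeS n x : He n.+1 x = 2 * x * He n x - dHe n x.
Proof. by rewrite /He hermiteS !hornerE. Qed.

Lemma He0 x : He 0 x = 1. Proof. by rewrite /He hornerE. Qed.
Lemma dHe0 x : dHe 0 x = 0. Proof. by rewrite /dHe /= derivC hornerE. Qed.

Lemma He_deriv n x : is_derive x 1 (He n) (dHe n x).
Proof. exact: is_derive_poly. Qed.

Lemma dHe_deriv n x : is_derive x 1 (dHe n) (2 * x * dHe n x - 2 * n%:R * He n x).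
Proof.
apply: is_derive_eq (is_derive_poly _ _) _.
have := hermite_deriv n; rewrite hermiteS derivB derivM derivM derivC derivX.
rewrite mul0r add0r mulr1; set h := hermite n; set h2 := _^`()^`().
have -> : (2 * n.+1%:R)%:P = (2 * n%:R)%:P + 2%:P :> {poly R}.
  by rewrite -polyCD -[in LHS](natr1 n); congr (_%:P); ring.
move=> e.
have -> : h2 = 2%:P * h + 2%:P * 'X * h^`() - ((2 * n%:R)%:P + 2%:P) * h.
  by rewrite -e; ring.
by rewrite /dHe /He -/h !(hornerD, hornerN, hornerM, hornerC, hornerX); ring.
Qed.

(** The parity transfers statements from [x > 0] to [x < 0]. *)
Lemma He_opp n x : He n (- x) = (-1) ^+ n * He n x.
Proof.
suff: He n (- x) = (-1) ^+ n * He n x /\ He n.+1 (- x) = (-1) ^+ n.+1 * He n.+1 x by case.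
elim: n => [|n [IH1 IH2]]; first by rewrite !HeS !dHe0 !He0 expr0 expr1; split; ring.
by split=> //; rewrite !He_rec IH1 IH2 !exprS; ring.
Qed.

(** In the recurrence for [He n.+2] the first term dominates once [x^2 >= 2n],
by induction. *)
Lemma He_large n x : 0 < x -> 2 * n%:R <= x ^+ 2 -> 0 < He n x /\ x * He n x <= He n.+1 x.
Proof.
move=> x0; elim: n => [|n IH] nx.
  by rewrite !HeS !dHe0 !He0; split => //; lra.
have [|h0 h1] := IH; first by apply: le_trans nx; rewrite ler_pM2l// ler_nat.
have h2 : 0 < He n.+1 x by apply: lt_le_trans h1; rewrite mulr_gt0.
split => //; rewrite He_rec.
suff : 2 * n.+1%:R * He n x <= x * He n.+1 x by lra.
apply: (@le_trans _ _ (x ^+ 2 * He n x)); first by rewrite ler_wpM2r// ltW.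
by rewrite expr2 -mulrA ler_pM2l.
Qed.

Lemma large_sq n x : 2 * n%:R + 1 <= x -> 0 < x /\ 2 * n%:R <= x ^+ 2.
Proof. by have := ler0n R n => n0 h; split; [lra | nra]. Qed.

Lemma He_gt0 n x : 2 * n%:R + 1 <= x -> 0 < He n x.
Proof. by move=> /large_sq[x0 h]; have [] := He_large x0 h. Qed.

Lemma dHe_le n x : 2 * n%:R + 1 <= x -> 0 <= dHe n x <= He n x.
Proof.
case: n => [|n] h; first by rewrite dHe0 He0 lexx ler01.
have [x0 h2] := large_sq h; have n0 := ler0n R n.
have [|p q] := @He_large n x x0.
  by apply: le_trans h2; rewrite ler_pM2l// ler_nat.
rewrite dHeS; apply/andP; split; first by rewrite !mulr_ge0// ltW.
apply: le_trans q; rewrite ler_pM2r//; lra.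
Qed.

Lemma He_neq0 n x : 2 * n%:R + 1 <= `|x| -> He n x != 0.
Proof.
case: (ger0P x) => x0 h; first by rewrite gt_eqF ?He_gt0.
by rewrite -[x]opprK He_opp mulf_neq0 ?signr_eq0// gt_eqF ?He_gt0.
Qed.

(** Far from the zeros the logarithmic derivative of [h_d] is [- t] up to an
error of at most [1]. *)
Lemma dHe_ratio n x : 2 * n%:R + 1 <= `|x| -> `|dHe n x / He n x| <= 1.
Proof.
have key y : 2 * n%:R + 1 <= y -> `|dHe n y / He n y| <= 1.
  move=> h; have /andP[h1 h2] := dHe_le h; have h3 := He_gt0 h.
  by rewrite normrM normfV !ger0_norm ?(ltW h3)// ler_pdivrMr// mul1r.
case: (ger0P x) => x0 h; first exact: key.
have := key _ h; congr (_ <= _).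
have dopp : dHe n (- x) = - (-1) ^+ n * dHe n x.
  case: (n) => [|k]; first by rewrite !dHe0; ring.
  by rewrite !dHeS He_opp exprS; ring.
rewrite dopp He_opp !normrM !normfV !normrM normrN normr_sign !mul1r.
by [].
Qed.

Lemma hermite_size n : (size (hermite n) <= n.+1)%N.
Proof.
elim: n => [|n IH]; first by rewrite size_poly1.
rewrite /=; apply: leq_trans (size_polyD _ _) _; rewrite size_polyN geq_max; apply/andP; split.
  rewrite -mulrA mul_polyC; apply: leq_trans (size_scale_leq _ _) _.
  by rewrite -commr_polyX (leq_trans (size_polyMleq _ _))// size_polyX addn2.
by apply: leq_trans (leq_trans (size_poly _ _) _) (leqnSn _); rewrite -ltnS; apply: leq_trans (leq_pred _) _.
Qed.

Lemma hermite_neq0 n : hermite n != 0.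
Proof.
apply/eqP => e; have := @He_gt0 n (2 * n%:R + 1) (lexx _).
by rewrite /He e horner0 ltxx.
Qed.

(** A polynomial of degree [n] has at most [n] zeros; this caps the
oscillation of the supersolution. *)
Lemma hermite_roots n (s : seq R) : uniq s -> all (fun y => He n y == 0) s -> (size s <= n)%N.
Proof.
move=> us rs; rewrite -ltnS; apply: leq_trans (hermite_size n).
by apply: max_poly_roots => //; exact: hermite_neq0.
Qed.

(** The derivative of [He n * exp(- t^2)] is [- He n.+1 * exp(- t^2)], so between
two points where [He n] has opposite signs the mean value theorem finds one
with the required sign of [He n.+1]. *)
Lemma hermite_chain_step n M m x : 2 * n.+1%:R + 1 <= M ->
  chain (- M) (fun t => (-1) ^+ n * He n t) m x ->
  exists2 y, y <= x & chain (- M) (fun t => (-1) ^+ n.+1 * He n.+1 t) m y.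
Proof.
move=> nM; elim: m x => [|m IH] x.
  move=> [Mx _]; exists (- M) => //; split => //.
  by rewrite He_opp mulrA -exprD addnn -mul2n mulnC exprM sqrr_sign mul1r He_gt0.
move=> [fx [z zx ch]]; have [y yz chy] := IH z ch.
pose w t := (-1) ^+ n * He n t * expR (- (t * t)).
pose dw t := (-1) ^+ n.+1 * He n.+1 t * expR (- (t * t)).
have [t _|c /andP[zc cx] e] := @mvt _ w dw z x zx.
  have h1 := isdN (isdM (isd_id t) (isd_id t)).
  have h2 := isd_exp h1.
  apply: is_derive_eq (isdM (isdZ ((-1) ^+ n) (He_deriv n t)) h2) _.
  by rewrite /dw HeS exprS; ring.
exists c; first exact: ltW.
split; last by exists y => //; exact: le_lt_trans yz zc.
have fz := chain_sign ch.
have : 0 < (-1) ^+ m.+1 * (w x - w z).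
  have p1 := mulr_gt0 fx (expR_gt0 (- (x * x))).
  have p2 := mulr_gt0 fz (expR_gt0 (- (z * z))).
  by rewrite mulrBr /w subr_gt0; move: p1 p2; rewrite exprS; lra.
rewrite e mulrA pmulr_lgt0 ?subr_gt0// /dw mulrA pmulr_lgt0 ?expR_gt0//.
Qed.

(** The sign [(-1)^n] makes the leftmost value positive, as [chain] requires. *)
Lemma hermite_chain n M : 2 * n%:R + 1 <= M ->
  chain (- M) (fun t => (-1) ^+ n * He n t) n M.
Proof.
elim: n M => [|n IH] M nM.
  by split; [move: nM; lra | rewrite He0; lra].
have [|y yM chy] := @hermite_chain_step n M n M nM; first apply: IH.
  by apply: le_trans nM; rewrite lerD2r ler_pM2l// ler_nat.
have p := He_gt0 nM.
split; first by rewrite mulrA -exprD addnn -mul2n mulnC exprM sqrr_sign mul1r.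
exists y => //; rewrite lt_neqAle yM andbT; apply/eqP => e.
have := chain_sign chy; rewrite e exprS mulN1r mulNr mulrN mulrA -exprD addnn -mul2n mulnC exprM sqrr_sign; lra.
Qed.

(** The eigenfunction of the harmonic oscillator with energy [2n + 1]. *)
Definition hfun n t := He n t * expR (- (t * t / 2)).
Definition dhfun n t := (dHe n t - t * He n t) * expR (- (t * t / 2)).

Lemma gaussian_deriv t : is_derive t 1 (fun t => expR (- (t * t / 2))) (- t * expR (- (t * t / 2))).
Proof.
have h1 := isdN (isdM (isdM (isd_id t) (isd_id t)) (isd_cst t (2^-1))).
apply: is_derive_eq (isd_exp h1) _.
by rewrite !mul1r mulr1 mulr0 addr0; field.
Qed.

Lemma hfun_deriv n t : is_derive t 1 (hfun n) (dhfun n t).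
Proof.
by apply: is_derive_eq (isdM (He_deriv n t) (gaussian_deriv t)) _; rewrite /dhfun; ring.
Qed.

Lemma dhfun_deriv n t : is_derive t 1 (dhfun n) ((t ^+ 2 - (2 * n%:R + 1)) * hfun n t).
Proof.
apply: is_derive_eq (isdM (isdB (dHe_deriv n t) (isdM (isd_id t) (He_deriv n t))) (gaussian_deriv t)) _.
by rewrite /hfun; ring.
Qed.

End Hermite.

(** * Removing the first order term *)

Section Liouville.
Variable R : realType.
Implicit Types (tau lam r t x : R) (U dU ddU : R -> R).

Lemma isd_translate f tau r a : is_derive (r - tau) 1 f a ->
  is_derive r 1 (fun r => f (r - tau)) (a : R).
Proof.
move=> fa; have h := isdB (isd_id r) (isd_cst r tau).
by apply: is_derive_eq (isd_comp (f := f) (g := fun r => r - tau) fa h) _; rewrite subr0 mulr1.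
Qed.

(** The Wronskian of [sqrt r * phi] and [U (r - tau)], expanded. *)
Definition sqrt_wronskian tau lam U dU r :=
  Num.sqrt r * dphi tau lam r * U (r - tau) +
  phi tau lam r * (U (r - tau) / (2 * Num.sqrt r) - Num.sqrt r * dU (r - tau)).

(** [sqrt r * phi] has the potential [(r - tau)^2 - lam - 1/(4 r^2)]; the last term
is the source of [- 1/(4 tau^2)] in the eigenvalues. *)
Lemma sqrt_wronskian_deriv tau lam U dU ddU r : 0 < r ->
  is_derive (r - tau) 1 U (dU (r - tau)) -> is_derive (r - tau) 1 dU (ddU (r - tau)) ->
  is_derive r 1 (sqrt_wronskian tau lam U dU)
    (Num.sqrt r * phi tau lam r *
      (((r - tau) ^+ 2 - lam - (4 * r ^+ 2)^-1) * U (r - tau) - ddU (r - tau))).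
Proof.
move=> r0 Ud dUd.
have s0 : 0 < Num.sqrt r by rewrite sqrtr_gt0.
have sn0 : 2 * Num.sqrt r != 0 by rewrite mulf_neq0 ?gt_eqF// pnatr_eq0.
have sd := is_derive1_sqrt r0.
have sVd := @is_deriveV _ (fun r => 2 * Num.sqrt r) r _ 1 sn0 (isdZ 2 sd).
have := isdD (isdM (isdM sd (dphi_deriv tau lam r)) (isd_translate Ud))
  (isdM (phi_deriv tau lam r)
     (isdB (isdM (isd_translate Ud) sVd) (isdM sd (isd_translate dUd)))).
move=> h; apply: is_derive_eq h _.
have e := phi_eq tau lam r.
have -> : ddphi tau lam r = ((r - tau) ^+ 2 - lam) * phi tau lam r - dphi tau lam r / r.
  have rn : r != 0 by rewrite gt_eqF.
  by apply: (mulfI rn); rewrite mulrBr (mulrCA r _ r^-1) mulfV// mulr1 mulrA -e addrK.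
rewrite /GRing.scale /=.
have rS : r = Num.sqrt r ^+ 2 by rewrite sqr_sqrtr// ltW.
move: (phi tau lam r) (dphi tau lam r) (U _) (dU _) (ddU _) ((r - tau) ^+ 2 - lam) => f df u du ddu q.
move: (Num.sqrt r) s0 {sn0 sd sVd} rS => s s0 ->; field.
by rewrite gt_eqF.
Qed.

End Liouville.

(** * A comparison function with few sign changes *)

Section Upper.
Variable R : realType.
Implicit Types (tau lam r t x s M : R) (n d : nat).

(** The comparison functions are glued at [|t| = M] with powers of the
positive part, which makes them twice differentiable. *)
Definition ppart x : R := Num.max 0 x.

Lemma ppart_id x : 0 <= x -> ppart x = x.
Proof. by move=> x0; rewrite /ppart max_r. Qed.

Lemma ppart0 x : x <= 0 -> ppart x = 0.
Proof. by move=> x0; rewrite /ppart max_l. Qed.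

Lemma ppart_ge0 x : 0 <= ppart x.
Proof. by rewrite /ppart le_max lexx. Qed.

Lemma ppart_cts x : {for x, continuous ppart}.
Proof.
apply: (@continuous_max _ _ (fun=> 0) (fun x => x)); first exact: cst_continuous.
by move=> ?; exact.
Qed.

Lemma ppart2_deriv x : is_derive x 1 (fun x => ppart x ^+ 2) (2 * ppart x).
Proof.
have [x0|x0|x0] := ltgtP x 0.
- rewrite ppart0 ?ltW// mulr0.
  apply: (@near_eq_is_derive R R^o R^o (fun=> 0) _ x 1).
  near=> y; have y0 : y <= 0 by near: y; apply: filterS (lt_nbhsl x0) => z; exact: ltW.
  by rewrite (ppart0 y0) expr0n.
- rewrite ppart_id ?ltW//.
  apply: (@near_eq_is_derive R R^o R^o (fun y => y * y) _ x 1).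
    near=> y; have y0 : 0 < y by near: y; exact: lt_nbhsr.
    by rewrite ppart_id ?expr2// ltW.
  by apply: is_derive_eq (isdM (isd_id x) (isd_id x)) _; ring.
- rewrite x0 ppart0// mulr0; apply/is_derive1_caratheodory; exists ppart; split.
  + move=> y; rewrite subr0 (ppart0 (lexx 0)) expr0n subr0 expr2.
    by have [y0|y0] := leP 0 y; [rewrite ppart_id | rewrite ppart0 ?ltW// !mul0r].
  + exact: ppart_cts.
  + by rewrite ppart0.
Unshelve. all: by end_near. Qed.

Lemma ppartX_deriv n x : is_derive x 1 (fun x => ppart x ^+ n.+2) (n.+2%:R * ppart x ^+ n.+1).
Proof.
elim: n => [|n IH]; first by rewrite expr1; exact: ppart2_deriv.
have pE m y : y * ppart y ^+ m.+1 = ppart y ^+ m.+2.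
  have [y0|y0] := leP 0 y; first by rewrite ppart_id// -exprS.
  by rewrite ppart0 ?ltW// !exprS !mul0r mulr0.
apply: (isd_ext (f := fun x => x * ppart x ^+ n.+2)) => [y|]; first exact: pE.
apply: is_derive_eq (isdM (isd_id x) IH) _.
by rewrite mul1r mulrCA pE -[in RHS](natr1 n.+2); ring.
Qed.

Lemma He_neq0_between n a b : a < b -> exists2 y : R, a < y < b & He n y != 0.
Proof.
move=> ab; apply: contrapT => H.
pose p (i : nat) : R := a + (b - a) * i.+1%:R / n.+2%:R.
have pin i : (i < n.+1)%N -> a < p i < b.
  move=> i1; have ba : 0 < b - a by rewrite subr_gt0.
  rewrite /p ltrDl divr_gt0 ?mulr_gt0//= -ltrBrDl ltr_pdivrMr// ltr_pM2l// ltr_nat.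
  by rewrite ltnS.
suff h : (size (mkseq p n.+1) <= n)%N by rewrite size_mkseq ltnn in h.
apply: hermite_roots.
  apply/mkseq_uniqP => i j _ _ /addrI; rewrite -!mulrA.
  move=> /(mulfI (_ : b - a != 0)) h; have := h (lt0r_neq0 (_ : 0 < b - a)).
  rewrite subr_gt0 => /(_ ab) /mulIf; rewrite invr_eq0 pnatr_eq0 => /(_ isT) /eqP.
  by rewrite eqr_nat eqSS => /eqP.
apply/allP => y /mapP[k]; rewrite mem_iota add0n => /andP[_ k1] ->.
by apply/eqP; apply: contrapT => /eqP h; apply: H; exists (p k) => //; exact: pin.
Qed.

Lemma inv_sq_le tau r : 0 < tau -> tau / 2 <= r -> r <= tau ->
  (4 * r ^+ 2)^-1 <= (4 * tau ^+ 2)^-1 + 2 * (tau - r) / tau ^+ 3.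
Proof.
move=> t0 tr rt; have r0 : 0 < r by lra.
rewrite -subr_ge0.
have -> : (4 * tau ^+ 2)^-1 + 2 * (tau - r) / tau ^+ 3 - (4 * r ^+ 2)^-1 =
  (tau - r) * (8 * r ^+ 2 - tau * (tau + r)) / (4 * r ^+ 2 * tau ^+ 3).
  by field; rewrite !gt_eqF.
rewrite divr_ge0// ?mulr_ge0 ?subr_ge0 ?exprn_ge0 ?(ltW r0) ?(ltW t0)//; nra.
Qed.

(** [r^-2] is convex, so it lies above its tangent at [tau]. *)
Lemma inv_sq_tangent tau r : 0 < tau -> 0 < r ->
  (4 * tau ^+ 2)^-1 - (r - tau) / (2 * tau ^+ 3) <= (4 * r ^+ 2)^-1.
Proof.
move=> t0 r0; rewrite -subr_ge0.
have -> : (4 * r ^+ 2)^-1 - ((4 * tau ^+ 2)^-1 - (r - tau) / (2 * tau ^+ 3)) =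
  (tau - r) ^+ 2 * (tau + 2 * r) / (4 * r ^+ 2 * tau ^+ 3).
  by field; rewrite !gt_eqF.
have h1 := sqr_ge0 r; have h2 : 0 <= tau ^+ 3 by rewrite exprn_ge0// ltW.
by apply: divr_ge0; apply: mulr_ge0; rewrite ?sqr_ge0//; lra.
Qed.

(** Distance to the left of the region [t >= - M] where [h_d] itself is a good
comparison function; [up_U = h_d * exp(up_theta)] and [up_theta' = - up_sig]. *)
Definition up_s M t := ppart (- M - t).
(** Chosen so that [up_sig = tau/2 + 1] at [r = tau/2], i.e. at [up_s = tau/2 - M]:
this is just enough to make the logarithmic derivative of [up_U] nonpositive
at that point, where that of [h_d] is at most [tau/2 + 1]. *)
Definition up_A M tau := (tau / 2 + 1) / (tau / 2 - M) ^+ 4.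
Definition up_sig M tau t := up_A M tau * up_s M t ^+ 4.
Definition up_theta M tau t := up_A M tau / 5 * up_s M t ^+ 5.
Definition up_U d M tau t := hfun d t * expR (up_theta M tau t).
Definition up_dU d M tau t := (dhfun d t - up_sig M tau t * hfun d t) * expR (up_theta M tau t).
Definition up_ddU d M tau t := ((t ^+ 2 - (2 * d%:R + 1)) * hfun d t -
  2 * up_sig M tau t * dhfun d t + up_sig M tau t ^+ 2 * hfun d t +
  4 * up_A M tau * up_s M t ^+ 3 * hfun d t) * expR (up_theta M tau t).

Lemma up_sX_deriv M n t : is_derive t 1 (fun t => up_s M t ^+ n.+2) (- (n.+2%:R * up_s M t ^+ n.+1)).
Proof.
have h := isdB (isd_cst t (- M)) (isd_id t).
apply: is_derive_eq (isd_comp (f := fun x => ppart x ^+ n.+2) (g := fun t => - M - t) (ppartX_deriv n _) h) _.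
by rewrite /up_s; ring.
Qed.

Lemma up_exp_deriv M tau t : is_derive t 1 (fun t => expR (up_theta M tau t))
  (- up_sig M tau t * expR (up_theta M tau t)).
Proof.
apply: is_derive_eq (isd_exp (isdZ (up_A M tau / 5) (up_sX_deriv M 3 t))) _.
by rewrite -/(up_theta M tau t) /up_sig; field.
Qed.

Lemma up_U_deriv d M tau t : is_derive t 1 (up_U d M tau) (up_dU d M tau t).
Proof.
apply: is_derive_eq (isdM (hfun_deriv d t) (up_exp_deriv M tau t)) _.
by rewrite /up_dU; ring.
Qed.

Lemma up_dU_deriv d M tau t : is_derive t 1 (up_dU d M tau) (up_ddU d M tau t).
Proof.
have h := isdZ (up_A M tau) (up_sX_deriv M 2 t).
apply: is_derive_eq (isdM (isdB (dhfun_deriv d t) (isdM h (hfun_deriv d t))) (up_exp_deriv M tau t)) _.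
by rewrite /up_ddU -/(up_sig M tau t); ring.
Qed.

Definition log_deriv d t := dHe d t / He d t - t : R.

(** The coefficient for which [up_U] satisfies
[U'' = ((r - tau)^2 - lam - 1/(4 r^2) - up_kappa) U]: positivity of [up_kappa]
says that [up_U] oscillates faster than [sqrt r * phi]. *)
Definition up_kappa d M tau lam r := 2 * d%:R + 1 - lam - (4 * r ^+ 2)^-1 +
  2 * up_sig M tau (r - tau) * log_deriv d (r - tau) - up_sig M tau (r - tau) ^+ 2 -
  4 * up_A M tau * up_s M (r - tau) ^+ 3.

Lemma log_deriv_hfun d t : He d t != 0 -> log_deriv d t * hfun d t = dhfun d t.
Proof. by move=> h; rewrite /log_deriv /hfun /dhfun; field. Qed.

Lemma up_kappaE d M tau lam r : 2 * d%:R + 1 <= M ->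
  ((r - tau) ^+ 2 - lam - (4 * r ^+ 2)^-1) * up_U d M tau (r - tau) - up_ddU d M tau (r - tau) =
  up_kappa d M tau lam r * up_U d M tau (r - tau).
Proof.
move=> dM; have M0 : 0 <= M by have := ler0n R d; lra.
rewrite /up_U /up_ddU /up_kappa.
have key : up_sig M tau (r - tau) * dhfun d (r - tau) =
    up_sig M tau (r - tau) * log_deriv d (r - tau) * hfun d (r - tau).
  have [h|h] := leP (- M) (r - tau).
    by rewrite /up_sig /up_s ppart0 ?expr0n ?mulr0 ?mul0r//; lra.
  rewrite -mulrA log_deriv_hfun// He_neq0// ltr0_norm; lra.
by rewrite -[2 * _ * dhfun _ _]mulrA key; ring.
Qed.

Lemma log_deriv_left d t : 2 * d%:R + 1 <= - t -> - t - 1 <= log_deriv d t <= - t + 1.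
Proof.
move=> h; have := @dHe_ratio _ d t; have d0 := ler0n R d.
rewrite ltr0_norm; last lra.
by move=> /(_ h); rewrite ler_norml /log_deriv => /andP[h1 h2]; apply/andP; split; lra.
Qed.

(** [A] is of order [tau^-3], like the error allowed in [lam]. *)
Lemma up_A_bounds M tau : 4 <= M -> 4 * M <= tau ->
  [/\ 0 < up_A M tau, 8 <= up_A M tau * tau ^+ 3 & up_A M tau * tau ^+ 3 <= 256].
Proof.
move=> M4 Mt; rewrite /up_A.
have s0 : tau / 4 <= tau / 2 - M by lra.
have p0 : 0 < tau / 2 - M by lra.
have q0 : 0 < (tau / 2 - M) ^+ 4 by rewrite exprn_gt0.
have t0 : 0 < tau ^+ 3 by rewrite exprn_gt0//; lra.
split; first by rewrite divr_gt0//; lra.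
- rewrite mulrAC ler_pdivlMr//.
  have h : (tau / 2 - M) ^+ 4 <= (tau / 2) ^+ 4 by rewrite lerXn2r ?nnegrE//; lra.
  have e : 8 * (tau / 2) ^+ 4 = tau / 2 * tau ^+ 3 by field.
  have : 8 * (tau / 2 - M) ^+ 4 <= tau / 2 * tau ^+ 3 by rewrite -e ler_wpM2l.
  lra.
- rewrite mulrAC ler_pdivrMr//.
  have h : (tau / 4) ^+ 4 <= (tau / 2 - M) ^+ 4 by rewrite lerXn2r ?nnegrE//; lra.
  have e : 256 * (tau / 4) ^+ 4 = tau * tau ^+ 3 by field.
  have h' := ler_wpM2l (ler0n R 256) h; rewrite e in h'; apply: le_trans h'.
  by rewrite ler_pM2r//; clear -M4 Mt; lra.
Qed.

Lemma inv_sq_le_pos tau r : 0 < tau -> tau / 2 <= r ->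
  (4 * r ^+ 2)^-1 <= (4 * tau ^+ 2)^-1 + 2 * ppart (tau - r) / tau ^+ 3.
Proof.
move=> t0 tr; have r0 : 0 < r by lra.
have [rt|tr'] := leP r tau; first by rewrite ppart_id ?subr_ge0//; exact: inv_sq_le.
rewrite ppart0 ?mulr0 ?mul0r ?addr0 ?subr_le0 ?(ltW tr')//.
rewrite lef_pV2 ?posrE ?mulr_gt0 ?exprn_gt0// ler_pM2l//.
by rewrite lerXn2r ?nnegrE// ltW.
Qed.

(** [up_sig / (tau/2 + 1)] is the fourth power of [s / (tau/2 - M) <= 1], and
is bounded by its first power. *)
Lemma up_sig_le M tau s : 0 <= M -> 0 < tau / 2 - M -> 0 <= s -> s <= tau / 2 - M ->
  up_A M tau * s ^+ 4 <= s + M + 1.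
Proof.
move=> M0 s10 s0 ss1.
have AE : up_A M tau * (tau / 2 - M) ^+ 4 = tau / 2 + 1.
  by rewrite /up_A mulfVK// expf_neq0// gt_eqF.
set s1 := tau / 2 - M in s10 ss1 AE; pose q := s / s1.
have q0 : 0 <= q by rewrite divr_ge0// ltW.
have q1 : q <= 1 by rewrite ler_pdivrMr// mul1r.
have sq : s = q * s1 by rewrite /q mulfVK ?gt_eqF.
have -> : up_A M tau * s ^+ 4 = q ^+ 4 * (tau / 2 + 1) by rewrite sq -AE; ring.
have q41 : q ^+ 4 <= q by rewrite exprS ler_piMr// exprn_ile1.
have tE : tau / 2 + 1 = s1 + (M + 1) by rewrite /s1; ring.
have M1 : 0 <= M + 1 by rewrite addr_ge0.
have h1 : q ^+ 4 * (tau / 2 + 1) <= q * (tau / 2 + 1).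
  by rewrite ler_wpM2r// tE addr_ge0// ltW.
have h2 : q * (M + 1) <= M + 1 by rewrite ler_piMl.
by apply: le_trans h1 _; rewrite tE mulrDr -sq -addrA lerD2l.
Qed.

(** What [up_kappa > 0] reduces to after multiplication by [tau^3], with
[a = A tau^3].  For [s >= 2] the powers of degree four and five win, because
[a >= 8]; for [s <= 2] the left side is at most [2 M + 4 + 4 * 256 * 8 = 2 M + 8196]. *)
Lemma up_poly a s M C : 8 <= a -> a <= 256 -> 0 < s -> 9000 + 2 * M <= C ->
  2 * (M + s) + a * (4 * s ^+ 3) < C + a * (s ^+ 4 * (s + 1)).
Proof.
move=> a8 a256 s0 MC; have a0 : 0 <= a by lra.
have s3 : 0 <= s ^+ 3 by rewrite exprn_ge0// ltW.
have s4 : 0 <= s ^+ 4 by rewrite exprn_ge0// ltW.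
have [s2|s2] := leP 2 s.
  have k1 : 4 * s ^+ 3 <= s ^+ 4 * s.
    have -> : s ^+ 4 * s = s * s * s ^+ 3 by ring.
    have s24 : 4 <= s * s by nra.
    by rewrite ler_wpM2r.
  have k2 : s <= s ^+ 4.
    by rewrite exprS ler_peMr ?(ltW s0)// exprn_ege1// (le_trans _ s2)// ler1n.
  have k3 : a * (4 * s ^+ 3 + s) <= a * (s ^+ 4 * (s + 1)).
    by rewrite ler_wpM2l// mulrDr mulr1 lerD.
  have k4 : 8 * s <= a * s by rewrite ler_wpM2r// ltW.
  move: k3; rewrite mulrDr; lra.
have k1 : s ^+ 3 <= 8.
  have -> : 8 = 2 ^+ 3 :> R by ring.
  by rewrite lerXn2r ?nnegrE ?ltW.
have k2 : a * s ^+ 3 <= 256 * 8 by apply: ler_pM.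
have k3 : 0 <= a * (s ^+ 4 * (s + 1)) by apply: mulr_ge0 => //; apply: mulr_ge0 => //; clear -s0; lra.
lra.
Qed.

(** For [- M <= t] the correction vanishes and the room [C / tau^3] in [lam] covers
the variation of [1/(4 r^2)].  For [t < - M] the gain is
[sig (2 h_d'/h_d - sig) >= sig (s + 1)], and [up_poly] applies. *)
Lemma up_kappa_gt0 d M tau lam r C : 2 * d%:R + 1 <= M -> 4 <= M -> 4 * M <= tau ->
  9000 + 2 * M <= C -> lam <= 2 * d%:R + 1 - (4 * tau ^+ 2)^-1 - C / tau ^+ 3 ->
  tau / 2 <= r -> 0 < up_kappa d M tau lam r.
Proof.
move=> dM M4 Mt MC lamC tr.
have t0 : 0 < tau by clear lamC; lra.
have := inv_sq_le_pos t0 tr; move: lamC; rewrite /up_kappa.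
set E := (4 * r ^+ 2)^-1; set E0 := (4 * tau ^+ 2)^-1; set D := 2 * d%:R + 1.
move=> lamC E1.
suff H : 2 * ppart (tau - r) / tau ^+ 3 + up_sig M tau (r - tau) ^+ 2 +
    4 * up_A M tau * up_s M (r - tau) ^+ 3 <
    C / tau ^+ 3 + 2 * up_sig M tau (r - tau) * log_deriv d (r - tau).
  move: H lamC E1; set x1 := C / _; set x2 := _ / tau ^+ 3; set x3 := _ * log_deriv _ _.
  set x4 := _ ^+ 2; set x5 := _ * _ ^+ 3; clear; lra.
have T0 : 0 < tau ^+ 3 by rewrite exprn_gt0.
clear E E0 E1 lamC.
have [A0 A8 A256] := up_A_bounds M4 Mt.
have M0 : 0 <= M by clear -M4; lra.
have [h|h] := leP (- M) (r - tau).
  rewrite /up_sig /up_s (@ppart0 (- M - (r - tau))); last by clear -h; lra.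
  rewrite !expr0n /= !mulr0 mul0r expr0n /= !addr0 ltr_pM2r ?invr_gt0//.
  have pM : ppart (tau - r) <= M.
    by have [q|q] := leP 0 (tau - r); [rewrite ppart_id//|rewrite (ppart0 (ltW q))//]; clear -h M0; lra.
  by clear -pM MC; lra.
pose s := - M - (r - tau); have s0 : 0 < s by rewrite /s; clear -h; lra.
have sE : up_s M (r - tau) = s by rewrite /up_s ppart_id// ltW.
have rE : tau - r = M + s by rewrite /s; ring.
have tE : - (r - tau) = M + s by rewrite /s; ring.
have ss1 : s <= tau / 2 - M by rewrite /s; clear -tr; lra.
pose A := up_A M tau; pose sig := A * s ^+ 4.
have sigE : up_sig M tau (r - tau) = sig by rewrite /up_sig sE.
have sig0 : 0 <= sig by rewrite mulr_ge0 ?exprn_ge0 ?(ltW s0) ?(ltW A0).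
have sigU : sig <= s + M + 1.
  by apply: up_sig_le => //; [clear -M4 Mt; lra | exact: ltW].
have /andP[l1 _] : - (r - tau) - 1 <= log_deriv d (r - tau) <= - (r - tau) + 1.
  by apply: log_deriv_left; rewrite tE; apply: le_trans dM _; rewrite lerDl ltW.
rewrite tE in l1.
rewrite sigE sE -/A rE ppart_id; last by rewrite addr_ge0// ltW.
have h1 : sig * (s + 1) <= 2 * sig * log_deriv d (r - tau) - sig ^+ 2.
  rewrite [leRHS](_ : _ = sig * (2 * log_deriv d (r - tau) - sig)); last by ring.
  by rewrite ler_wpM2l//; move: (log_deriv d _) sig sigU l1 {sigE sig0} => l sig; clear -M4; lra.
suff : (2 * (M + s)) / tau ^+ 3 + 4 * A * s ^+ 3 < C / tau ^+ 3 + sig * (s + 1).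
  move: h1; set x1 := C / _; set x2 := _ / tau ^+ 3; set x3 := _ * log_deriv _ _.
  set x4 := _ ^+ 2; set x5 := _ * _ ^+ 3; set x6 := sig * (s + 1); clear; lra.
have := @up_poly (A * tau ^+ 3) s M C A8 A256 s0 MC.
rewrite -[in X in _ -> X](ltr_pM2r T0).
rewrite [X in _ -> X < _](_ : _ = 2 * (M + s) + A * tau ^+ 3 * (4 * s ^+ 3)); last first.
  by field; rewrite gt_eqF.
by rewrite [X in _ -> _ < X](_ : _ = C + A * tau ^+ 3 * (s ^+ 4 * (s + 1)))// /sig; field; rewrite gt_eqF.
Qed.

End Upper.

Section NoChain.
Variable R : realType.
Variables (d : nat) (M C tau lam : R).
Hypotheses (dM : 2 * d%:R + 1 <= M) (M4 : 4 <= M) (Mt : 4 * M <= tau).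
Hypothesis MC : 9000 + 2 * M <= C.
Hypothesis lamC : lam <= 2 * d%:R + 1 - (4 * tau ^+ 2)^-1 - C / tau ^+ 3.

Let t0 : 0 < tau. Proof. move: M4 Mt; lra. Qed.
Let M0 : 0 < M. Proof. move: M4; lra. Qed.

Lemma lam_below_potential r : 0 <= r <= tau / 2 -> 0 <= (r - tau) ^+ 2 - lam.
Proof.
move=> /andP[r0 rt].
have h1 : lam <= M.
  apply: le_trans lamC _; apply: le_trans dM; rewrite -addrA gerDl subr_le0.
  apply: (@le_trans _ _ 0); first by rewrite oppr_le0 invr_ge0 mulr_ge0// sqr_ge0.
  rewrite divr_ge0// ?exprn_ge0// ?ltW//; move: MC M0; lra.
have h2 : M <= (tau / 2) ^+ 2 by move: M4 Mt; nra.
have h3 : (tau / 2) ^+ 2 <= (r - tau) ^+ 2.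
  by rewrite -[leRHS]sqrrN lerXn2r ?nnegrE//; move: r0 rt t0; lra.
by rewrite subr_ge0 (le_trans h1 (le_trans h2 h3)).
Qed.

(** Before [tau/2] the energy is below the potential, so [phi] increases from
its value at [0]. *)
Lemma phi_init r : 0 <= r <= tau / 2 -> 1 <= phi tau lam r /\ 0 <= r * dphi tau lam r.
Proof.
move=> rt; have [] := @sol_grow _ tau lam 0 (tau / 2) _ _ (lexx 0) (@phi_sol _ tau lam 0) lam_below_potential _ _ r rt.
- by rewrite phi_0.
- by rewrite mul0r.
by rewrite phi_0.
Qed.

Let U r := up_U d M tau (r - tau).

Lemma up_cts r : {for r, continuous U}.
Proof. exact: isd_cts (isd_translate (up_U_deriv d M tau (r - tau))). Qed.

(** [up_U] and [He d] differ by positive factors, so they have the same zeros. *)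
Lemma up_root r : U r = 0 -> He d (r - tau) = 0.
Proof.
move=> /eqP; rewrite /U /up_U /hfun mulf_eq0 (gt_eqF (expR_gt0 _)) orbF.
by rewrite mulf_eq0 (gt_eqF (expR_gt0 _)) orbF => /eqP.
Qed.

Lemma up_pair hi : sturm_pair (tau / 2) hi (phi tau lam) (dphi tau lam) U
  (fun r => Num.sqrt r) (fun r => Num.sqrt r * up_kappa d M tau lam r)
  (sqrt_wronskian tau lam (up_U d M tau) (up_dU d M tau)).
Proof.
split.
- by move=> r _; exact: phi_deriv.
- by move=> r _; exact: up_cts.
- move=> a b _ ab _; have [|y /andP[ay yb] hy] := @He_neq0_between _ d (a - tau) (b - tau).
    by rewrite ltrD2r.
  exists (y + tau); first by rewrite -ltrBlDr ay -ltrBrDr.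
  by apply: contra hy => /eqP /up_root; rewrite addrK => ->.
have Wd (r : R) : tau / 2 <= r -> is_derive r 1 (sqrt_wronskian tau lam (up_U d M tau) (up_dU d M tau))
    (Num.sqrt r * up_kappa d M tau lam r * phi tau lam r * U r).
  move=> tr; have r0 : 0 < r by move: tr t0; lra.
  apply: is_derive_eq (sqrt_wronskian_deriv lam r0 (up_U_deriv d M tau _) (up_dU_deriv d M tau _)) _.
  by rewrite up_kappaE// /U; ring.
split.
- by move=> r /andP[tr _]; exact: Wd (ltW tr).
- by move=> r /andP[tr _]; exact: isd_cts (Wd r tr).
- move=> r /andP[tr _]; have r0 : 0 < r by move: tr t0; lra.
  rewrite mulr_gt0 ?sqrtr_gt0//; apply: (up_kappa_gt0 dM M4 Mt MC lamC); exact: ltW.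
- by move=> r _; exact: sqrtr_ge0.
- by move=> r _ fr; rewrite /sqrt_wronskian fr /U; ring.
Qed.

(** At [tau/2] the solution has [phi' >= 0] and the comparison function, up to its
sign, a nonpositive slope: the Wronskian has the sign needed to start the
comparison there. *)
Lemma up_start : exists u : R, [/\ is_sign u, 0 < u * U (tau / 2) &
  0 <= u * sqrt_wronskian tau lam (up_U d M tau) (up_dU d M tau) (tau / 2)].
Proof.
have tE : tau / 2 - tau = - (tau / 2) by field.
have hr : 0 < tau / 2 by move: t0; lra.
have nz : U (tau / 2) != 0.
  apply/eqP => /up_root; rewrite tE => /eqP; apply/negP; apply: He_neq0.
  by rewrite normrN gtr0_norm//; move: dM Mt M0; lra.
exists (if 0 < U (tau / 2) then 1 else -1).
set u := if _ then _ else _.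
have su : is_sign u by rewrite /u; case: ifP; [left|right].
have uU : 0 < u * U (tau / 2).
  rewrite /u; case: ifP; rewrite ?mul1r// => /negbT; rewrite -leNgt => h.
  by rewrite mulN1r oppr_gt0 lt_neqAle nz.
split => //.
have [|f1 d1] := @phi_init (tau / 2).
  by rewrite lexx (ltW hr).
have s0 : 0 < Num.sqrt (tau / 2) by rewrite sqrtr_gt0.
have dU : u * up_dU d M tau (tau / 2 - tau) <= 0.
  have sE : up_sig M tau (tau / 2 - tau) = tau / 2 + 1.
    rewrite /up_sig /up_s ppart_id; last by move: Mt M0; lra.
    have s1 : 0 < tau / 2 - M by move: Mt M0; lra.
    rewrite (_ : - M - _ = tau / 2 - M); last by field.
    by rewrite /up_A mulfVK// expf_neq0// gt_eqF.
  have hl : 2 * d%:R + 1 <= - (tau / 2 - tau) by move: dM Mt M0; lra.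
  have /andP[_ l2] := log_deriv_left hl.
  rewrite /up_dU sE -log_deriv_hfun; last first.
    apply: He_neq0; rewrite ltr0_norm//; move: t0; lra.
  have -> : u * ((log_deriv d (tau / 2 - tau) * hfun d (tau / 2 - tau) -
     (tau / 2 + 1) * hfun d (tau / 2 - tau)) * expR (up_theta M tau (tau / 2 - tau))) =
     (log_deriv d (tau / 2 - tau) - (tau / 2 + 1)) * (u * U (tau / 2)) by rewrite /U /up_U; ring.
  by rewrite mulr_le0_ge0 ?(ltW uU)//; move: (log_deriv _ _) l2 => l l2; move: l2; lra.
rewrite /sqrt_wronskian.
rewrite [X in 0 <= X](_ : _ = Num.sqrt (tau / 2) * dphi tau lam (tau / 2) * (u * U (tau / 2)) +
  phi tau lam (tau / 2) * ((u * U (tau / 2)) / (2 * Num.sqrt (tau / 2)) +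
     Num.sqrt (tau / 2) * - (u * up_dU d M tau (tau / 2 - tau)))); last by rewrite /U; ring.
have dp : 0 <= dphi tau lam (tau / 2) by rewrite pmulr_rge0 in d1.
apply: addr_ge0; first by apply: mulr_ge0 (ltW uU); apply: mulr_ge0 (ltW s0) dp.
apply: mulr_ge0; first exact: le_trans ler01 f1.
apply: addr_ge0; first by rewrite divr_ge0 ?(ltW uU)// mulr_ge0// ltW.
by rewrite mulr_ge0 ?(ltW s0)// oppr_ge0.
Qed.

(** More sign changes of [phi] would give [d + 1] nodal intervals, each containing
a zero of [up_U], hence of the polynomial [He d]. *)
Lemma oscillates_le : ~ oscillates tau lam d.+1.
Proof.
move=> [x [fx [z zx ch]]].
have fc r : {for r, continuous (phi tau lam)} by exact: phi_cts.
have fc' r : 0 <= r -> {for r, continuous (phi tau lam)} by [].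
have [c /andP[zc cx] fc0] := chain_zero fc' ch zx fx.
have zero_far y : 0 <= y -> phi tau lam y = 0 -> tau / 2 < y.
  move=> y0 fy; rewrite ltNge; apply/negP => yt.
  have [|h _] := @phi_init y; first by rewrite y0.
  by move: h; rewrite fy ler10.
have hr : 0 < tau / 2 by move: t0; lra.
have [||s [us ss /allP as_]] := @chain_roots _ 0 (phi tau lam) U fc' _ _ d z c ch zc fc0.
- move=> x' c' x'0 x'c' _ fc'0.
  have tc : tau / 2 < c' by apply: zero_far => //; exact: le_trans x'0 (ltW x'c').
  have [u [su uU uW]] := up_start.
  have [|e e0 eP] := @cts_pos _ (phi tau lam) (tau / 2) (fc _).
    have [|h _] := @phi_init (tau / 2); first by rewrite lexx (ltW hr).
    exact: lt_le_trans ltr01 h.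
  pose mn := Num.min (e / 2) ((c' - tau / 2) / 2); pose t := tau / 2 + mn.
  have t1 : mn <= e / 2 by rewrite ge_min lexx.
  have t2 : mn <= (c' - tau / 2) / 2 by rewrite ge_min lexx orbT.
  have t3 : 0 < mn by rewrite lt_min; apply/andP; split; lra.
  have tt : tau / 2 < t by rewrite /t; move: t3; lra.
  have tc' : t < c' by rewrite /t; move: t2 tc; lra.
  have ft : 0 < phi tau lam t.
    by apply: eP; rewrite distrC /t addrAC subrr add0r gtr0_norm//; move: t1 e0; lra.
  have [||y /andP[ty yc] Uy] := @sturm_signs_left _ _ _ _ _ _ _ _ _ (tau / 2) c' t (- u) (up_pair c') _ (lexx _) tt tc' (lexx _) _ ft fc'0.
  + by case: su => ->; [right|left; rewrite opprK].
  + by rewrite opprK.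
  have [||w /andP[w1 w2] Uw] := @ivt0 _ U (tau / 2) y (ltW ty).
  + by move=> v _; exact: up_cts.
  + by move: uU Uy; case: su => ->; rewrite ?mul1r ?mulN1r ?opprK ?mul1r; nra.
  by exists w => //; exact: le_lt_trans w2 yc.
- move=> a x' c' a0 ax' x'c' fa fc'0 fx'.
  have ta := zero_far a a0 fa.
  have [|y1 /andP[y1a y1c] U1] := sturm_signs (up_pair c') (s := 1) _ (ltW ta) ax' x'c' (lexx _) fa fc'0 fx'.
    by left.
  have [|y2 /andP[y2a y2c] U2] := sturm_signs (up_pair c') (s := -1) _ (ltW ta) ax' x'c' (lexx _) fa fc'0 fx'.
    by right.
  move: U1 U2; rewrite mul1r mulN1r => U1 U2.
  have [y12|y21] := leP y1 y2.
    have [||w /andP[w1 w2] Uw] := @ivt0 _ U y1 y2 y12.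
    + by move=> v _; exact: up_cts.
    + by move: U1 U2; nra.
    by exists w => //; rewrite (lt_le_trans y1a w1) (le_lt_trans w2 y2c).
  have [||w /andP[w1 w2] Uw] := @ivt0 _ U y2 y1 (ltW y21).
  + by move=> v _; exact: up_cts.
  + by move: U1 U2; nra.
  by exists w => //; rewrite (lt_le_trans y2a w1) (le_lt_trans w2 y1c).
have : (size [seq (y - tau)%R | y <- s] <= d)%N.
  apply: hermite_roots; first by rewrite map_inj_uniq// => y y' /addIr.
  by apply/allP => y /mapP[y' /as_ /andP[_ /eqP /up_root h] ->]; rewrite h.
by rewrite size_map ss ltnn.
Qed.

End NoChain.

(** * A comparison function with many sign changes *)

Section Lower.
Variable R : realType.
Implicit Types (tau lam r t x s M S C : R) (n d m : nat).

(** A cutoff equal to [1] for [|t| <= M] and to [0] at [|t| = M + S]; the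
exponent [3] makes it twice differentiable at [|t| = M]. *)
Definition lo_chi M S t := 1 - (ppart (t - M) ^+ 3 + ppart (- M - t) ^+ 3) / S ^+ 3.
Definition lo_dchi M S t := - 3 * (ppart (t - M) ^+ 2 - ppart (- M - t) ^+ 2) / S ^+ 3.
Definition lo_ddchi M S t := - 6 * (ppart (t - M) + ppart (- M - t)) / S ^+ 3.
Definition lo_f d M S t := hfun d t * lo_chi M S t.
Definition lo_df d M S t := dhfun d t * lo_chi M S t + hfun d t * lo_dchi M S t.
Definition lo_ddf d M S t := (t ^+ 2 - (2 * d%:R + 1)) * hfun d t * lo_chi M S t +
  2 * dhfun d t * lo_dchi M S t + hfun d t * lo_ddchi M S t.

Lemma ppart_right_deriv M n t :
  is_derive t 1 (fun t => ppart (t - M) ^+ n.+2) (n.+2%:R * ppart (t - M) ^+ n.+1).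
Proof.
apply: is_derive_eq (isd_comp (f := fun x => ppart x ^+ n.+2) (g := fun t => t - M)
  (ppartX_deriv n _) (isdB (isd_id t) (isd_cst t M))) _.
by rewrite subr0 mulr1.
Qed.

Lemma lo_chi_deriv M S t : is_derive t 1 (lo_chi M S) (lo_dchi M S t).
Proof.
have h := isdD (ppart_right_deriv M 1 t) (up_sX_deriv M 1 t).
apply: is_derive_eq (isdB (isd_cst t 1) (isdM h (isd_cst t (S ^+ 3)^-1))) _.
by rewrite /lo_dchi /up_s; ring.
Qed.

Lemma lo_dchi_deriv M S t : is_derive t 1 (lo_dchi M S) (lo_ddchi M S t).
Proof.
have h := isdB (ppart_right_deriv M 0 t) (up_sX_deriv M 0 t).
apply: is_derive_eq (isdM (isdZ (- 3) h) (isd_cst t (S ^+ 3)^-1)) _.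
by rewrite /lo_ddchi /up_s; ring.
Qed.

Lemma lo_f_deriv d M S t : is_derive t 1 (lo_f d M S) (lo_df d M S t).
Proof. exact: (isdM (hfun_deriv d t) (lo_chi_deriv M S t)). Qed.

Lemma lo_df_deriv d M S t : is_derive t 1 (lo_df d M S) (lo_ddf d M S t).
Proof.
apply: is_derive_eq (isdD (isdM (dhfun_deriv d t) (lo_chi_deriv M S t))
  (isdM (hfun_deriv d t) (lo_dchi_deriv M S t))) _.
by rewrite /lo_ddf; ring.
Qed.

(** The coefficient for which [f = lo_f] satisfies
[f'' = ((r - tau)^2 - lam - 1/(4 r^2) + lo_kappa) f]: positivity of [lo_kappa]
says that [sqrt r * phi] oscillates faster than [lo_f]. *)
Definition lo_kappa d M S tau lam r := lam - (2 * d%:R + 1) + (4 * r ^+ 2)^-1 +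
  (2 * log_deriv d (r - tau) * lo_dchi M S (r - tau) + lo_ddchi M S (r - tau))
    / lo_chi M S (r - tau).

Lemma lo_dchi_out M S t : - M <= t <= M -> lo_dchi M S t = 0.
Proof.
move=> /andP[h1 h2]; rewrite /lo_dchi (@ppart0 _ (t - M)) ?subr_le0//.
by rewrite (@ppart0 _ (- M - t)) ?subr_le0// expr0n /= subrr mulr0 mul0r.
Qed.

Lemma lo_kappaE d M S tau lam r : 2 * d%:R + 1 <= M -> lo_chi M S (r - tau) != 0 ->
  lo_ddf d M S (r - tau) - ((r - tau) ^+ 2 - lam - (4 * r ^+ 2)^-1) * lo_f d M S (r - tau) =
  lo_kappa d M S tau lam r * lo_f d M S (r - tau).
Proof.
move=> dM c0; rewrite /lo_f /lo_ddf /lo_kappa.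
have key : dhfun d (r - tau) * lo_dchi M S (r - tau) =
    log_deriv d (r - tau) * lo_dchi M S (r - tau) * hfun d (r - tau).
  have [h|h] := boolP (- M <= r - tau <= M).
    by rewrite lo_dchi_out//; ring.
  rewrite [RHS]mulrAC log_deriv_hfun//; apply: He_neq0; apply: le_trans dM _.
  rewrite leNgt ltr_norml; apply: contra h => /andP[h1 h2].
  by rewrite !ltW.
rewrite -[2 * dhfun d _ * _]mulrA key.
move: (lo_chi _ _ _) c0 ((4 * r ^+ 2)^-1) => c c0 q; field; exact: c0.
Qed.

Lemma log_deriv_right d t : 2 * d%:R + 1 <= t -> log_deriv d t <= - t + 1.
Proof.
move=> h; have := @dHe_ratio _ d t; have d0 := ler0n R d.
rewrite ger0_norm; last by clear -h d0; lra.
move=> /(_ h); rewrite ler_norml /log_deriv => /andP[h1 h2]; clear -h2; lra.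
Qed.

(** What [lo_kappa > 0] reduces to after multiplication by [tau^3], with
[s = |t| - M] and [c = lo_chi].  For [s >= 1] the contribution of the cutoff
is at least [s].  For [s < 1] it can be negative, because of the second derivative of the
cutoff, but is bounded: [c >= 1/2] and the loss is at most [2 * 384]. *)
Lemma lo_poly C M s t c : 4 <= M -> 9000 + 2 * M <= C -> 0 <= s -> t <= M + s ->
  0 < c -> c <= 1 -> (s < 1 -> 1 / 2 <= c) ->
  0 < C - t / 2 + 384 * ((s + M - 1) * s ^+ 2 - s) / c.
Proof.
move=> M4 MC s0 tM c0 c1 sc.
set Y := (s + M - 1) * s ^+ 2 - s.
have YE : (s + 3) * s ^+ 2 - s <= Y.
  by rewrite lerD2r ler_wpM2r ?sqr_ge0//; clear -M4; lra.
have q0 := sqr_ge0 s.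
rewrite -mulrA; set Z := Y / c.
have [s1|s1] := leP 1 s.
  have Y0 : s <= Y.
    apply: le_trans YE; rewrite expr2; clear -s1; nra.
  have : Y <= Z by rewrite ler_pdivlMr// ler_piMr// (le_trans s0).
  clear -Y0 M4 MC tM s1; lra.
have c2 := sc s1.
have Y0 : - 1 <= Y.
  apply: le_trans YE; have : 0 <= (s + 3) * s ^+ 2 by rewrite mulr_ge0// addr_ge0.
  move: (_ * _) => x; clear -s1; lra.
have : - 2 <= Z by rewrite ler_pdivlMr//; clear -Y0 c2; lra.
clear -M4 MC tM s1; lra.
Qed.

Lemma lo_chi_abs M S t : 0 <= M -> lo_chi M S t = 1 - ppart (`|t| - M) ^+ 3 / S ^+ 3.
Proof.
move=> M0; rewrite /lo_chi; case: (ger0P t) => t0.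
  by rewrite (@ppart0 _ (- M - t)) ?expr0n ?addr0//; clear -M0 t0; lra.
rewrite (@ppart0 _ (t - M)) ?expr0n ?add0r//; last by clear -M0 t0; lra.
by rewrite (addrC (- M)).
Qed.

Lemma lo_ddchi_abs M S t : 0 <= M -> lo_ddchi M S t = - 6 * ppart (`|t| - M) / S ^+ 3.
Proof.
move=> M0; rewrite /lo_ddchi; case: (ger0P t) => t0.
  by rewrite (@ppart0 _ (- M - t)) ?addr0//; clear -M0 t0; lra.
rewrite (@ppart0 _ (t - M)) ?add0r//; last by clear -M0 t0; lra.
by rewrite (addrC (- M)).
Qed.

(** [h_d] and the cutoff both decrease in [|t|], so the cross term [2 h_d'
chi'] has the sign of [h_d]. *)
Lemma lo_dchi_log d M S t : 2 * d%:R + 1 <= M -> 0 < S -> M <= `|t| ->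
  3 * ((`|t| - M) + M - 1) * (`|t| - M) ^+ 2 / S ^+ 3 <= log_deriv d t * lo_dchi M S t.
Proof.
move=> dM S0 Mt; have M0 : 0 <= M by apply: le_trans dM; rewrite addr_ge0// mulr_ge0.
have V0 : 0 <= (S ^+ 3)^-1 by rewrite invr_ge0 exprn_ge0// ltW.
rewrite /lo_dchi; move: Mt; case: (ger0P t) => t0 Mt.
  rewrite (@ppart0 _ (- M - t)); last by clear -M0 t0; lra.
  rewrite ppart_id; last by clear -Mt; lra.
  have l := log_deriv_right (le_trans dM Mt).
  rewrite expr0n subr0; have := sqr_ge0 (t - M).
  move: ((t - M) ^+ 2) (log_deriv d t) l => q l l1 q0.
  by rewrite !mulrA ler_wpM2r//; clear -q0 l1; nra.
rewrite (@ppart0 _ (t - M)); last by clear -M0 t0; lra.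
rewrite ppart_id; last by clear -Mt; lra.
have /andP[l _] := log_deriv_left (le_trans dM Mt).
rewrite expr0n sub0r (addrC (- M)); have := sqr_ge0 (- t - M).
move: ((- t - M) ^+ 2) (log_deriv d t) l => q l l1 q0.
by rewrite !mulrA ler_wpM2r//; clear -q0 l1; nra.
Qed.

Lemma lo_chi_gt0 M S t : 0 <= M -> 0 < S -> `|t| < M + S -> 0 < lo_chi M S t <= 1.
Proof.
move=> M0 S0 tS; rewrite lo_chi_abs//.
have S3 : 0 < S ^+ 3 by rewrite exprn_gt0.
have p0 := ppart_ge0 (`|t| - M).
apply/andP; split; last by rewrite gerDl oppr_le0 divr_ge0 ?exprn_ge0// ltW.
rewrite subr_gt0 ltr_pdivrMr// mul1r ltrXn2r ?nnegrE ?(ltW S0)//.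
by have [q|q] := leP 0 (`|t| - M); [rewrite ppart_id|rewrite (ppart0 (ltW q))] => //; clear -tS; lra.
Qed.

Lemma lo_kappa_gt0 d M tau lam r C : 2 * d%:R + 1 <= M -> 4 <= M -> 4 * M <= tau ->
  9000 + 2 * M <= C -> 2 * d%:R + 1 - (4 * tau ^+ 2)^-1 + C / tau ^+ 3 <= lam ->
  0 < r -> `|r - tau| < M + tau / 4 -> 0 < lo_kappa d M (tau / 4) tau lam r.
Proof.
move=> dM M4 Mt MC lamC r0 rt.
have M0 : 0 <= M by clear -M4; lra.
have t0 : 0 < tau by clear -M4 Mt; lra.
have S0 : 0 < tau / 4 by clear -t0; lra.
have T0 : 0 < tau ^+ 3 by rewrite exprn_gt0.
have TT := inv_sq_tangent t0 r0.
have /andP[c0 c1] := lo_chi_gt0 M0 S0 rt.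
rewrite /lo_kappa; set X := _ / lo_chi _ _ _.
suff H : 0 < C / tau ^+ 3 - (r - tau) / (2 * tau ^+ 3) + X.
  move: H lamC TT; set x1 := C / _; set x2 := _^-1; set x3 := _ / _; set x4 := _^-1.
  set D := 2 * _; clear; lra.
clear lamC TT.
have [Mr|Mr] := leP M `|r - tau|; last first.
  have h : - M <= r - tau <= M by rewrite -ler_norml ltW.
  rewrite /X lo_dchi_out// lo_ddchi_abs// ppart0; last by rewrite subr_le0 ltW.
  rewrite !mulr0 mul0r addr0 mul0r addr0.
  rewrite [ltRHS](_ : _ = (C - (r - tau) / 2) / tau ^+ 3); last by field; rewrite gt_eqF.
  rewrite divr_gt0//.
  by case/andP: h => _ h; clear -h MC M0; lra.
pose s := `|r - tau| - M; have s0 : 0 <= s by rewrite /s subr_ge0.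
rewrite {}/X; set c := lo_chi _ _ _ in c0 c1 *; set X := _ / c.
have X1 : (6 * ((s + M - 1) * s ^+ 2 - s) / (tau / 4) ^+ 3) / c <= X.
  rewrite ler_wpM2r ?invr_ge0 ?(ltW c0)//.
  rewrite lo_ddchi_abs// ppart_id// -/s.
  have := lo_dchi_log dM S0 Mr; rewrite -/s.
  have -> : 6 * ((s + M - 1) * s ^+ 2 - s) / (tau / 4) ^+ 3 =
    2 * (3 * (s + M - 1) * s ^+ 2 / (tau / 4) ^+ 3) + - 6 * s / (tau / 4) ^+ 3 by ring.
  rewrite lerD2r -[2 * _ * _]mulrA; set x1 := _ / _; set x2 := _ * _; clear; lra.
apply: (@lt_le_trans _ _ (C / tau ^+ 3 - (r - tau) / (2 * tau ^+ 3) +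
   6 * ((s + M - 1) * s ^+ 2 - s) / (tau / 4) ^+ 3 / c)); last by rewrite lerD2l.
(* [384 = 6 * 4^3], the cube coming from [(tau / 4)^3] *)
rewrite [ltRHS](_ : _ = (C - (r - tau) / 2 + 384 * ((s + M - 1) * s ^+ 2 - s) / c) / tau ^+ 3); last first.
  by field; rewrite !gt_eqF.
have rtM : r - tau <= M + s by have := ler_norm (r - tau); rewrite /s; clear; lra.
suff hc : s < 1 -> 1 / 2 <= c.
  by have P := lo_poly M4 MC s0 rtM c0 c1 hc; rewrite divr_gt0.
move=> s1; rewrite /c lo_chi_abs// ppart_id//.
have h1 : 4 <= tau / 4 by clear -M4 Mt; lra.
have h2 : s ^+ 3 <= 1 by rewrite exprn_ile1// ltW.
have h3 : 2 <= (tau / 4) ^+ 3.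
  apply: (@le_trans _ _ (4 ^+ 3)); first by rewrite -natrX ler_nat.
  by rewrite lerXn2r ?nnegrE// ltW.
rewrite -/s; have : s ^+ 3 / (tau / 4) ^+ 3 <= 1 / 2.
  rewrite ler_pdivrMr ?exprn_gt0//; move: h2 h3; set x := s ^+ 3; set y := _ ^+ 3; clear; lra.
by set x := _ / _ ^+ 3; clear; lra.
Qed.

End Lower.

Section ChainMap.
Variable R : realType.

(** Only the signs of the function matter, so a positive factor is allowed
besides the translation. *)
Lemma chain_translate (lo hi a : R) (f g : R -> R) m x :
  (forall y, lo <= y -> y <= hi -> exists2 c, 0 < c & g (y + a) = c * f y) ->
  chain lo f m x -> x <= hi -> chain (lo + a) g m (x + a).
Proof.
move=> fg; elim: m x => [|m IH] x.
  move=> [lx fx] xh; have [c c0 e] := fg x lx xh.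
  by split; [rewrite lerD2r | rewrite e mulr_gt0].
move=> ch xh; have [c c0 e] := fg x (chain_lo ch) xh.
case: ch => fx [y yx ch]; split; first by rewrite e mulrCA mulr_gt0.
by exists (y + a); [rewrite ltrD2r | apply: IH => //; rewrite (le_trans (ltW yx))].
Qed.

Lemma chain_widen (lo lo' : R) (f : R -> R) m x : lo' <= lo -> chain lo f m x -> chain lo' f m x.
Proof.
move=> ll; elim: m x => [|m IH] x /=; first by move=> [lx fx]; split=> //; exact: le_trans lx.
by move=> [fx [y yx ch]]; split=> //; exists y => //; exact: IH.
Qed.

End ChainMap.

Section HasChain.
Variable R : realType.
Variables (d : nat) (M C tau lam : R).
Hypotheses (dM : 2 * d%:R + 1 <= M) (M4 : 4 <= M) (Mt : 4 * M <= tau).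
Hypothesis MC : 9000 + 2 * M <= C.
Hypothesis lamC : 2 * d%:R + 1 - (4 * tau ^+ 2)^-1 + C / tau ^+ 3 <= lam.

Let t0 : 0 < tau. Proof. move: M4 Mt; lra. Qed.
Let M0 : 0 < M. Proof. move: M4; lra. Qed.
Let S := tau / 4.
Let S0 : 0 < S. Proof. by move: t0; rewrite /S; lra. Qed.
Let lo := tau - (M + S).
Let hi := tau + (M + S).
Let lo0 : 0 < lo. Proof. by move: M0 Mt; rewrite /lo /S; lra. Qed.

Let F r := (-1) ^+ d * lo_f d M S (r - tau).
Let dF r := (-1) ^+ d * lo_df d M S (r - tau).
Let W r := - (-1) ^+ d * sqrt_wronskian tau lam (lo_f d M S) (lo_df d M S) r.

Lemma lo_shift_deriv (r : R) : is_derive r 1 F (dF r).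
Proof. exact: isdZ (isd_translate (lo_f_deriv d M S (r - tau))). Qed.

Lemma lo_shift_end : F lo = 0 /\ F hi = 0.
Proof.
have key t : `|t| = M + S -> lo_f d M S t = 0.
  move=> e; rewrite /lo_f lo_chi_abs ?(ltW M0)// e addrAC subrr add0r ppart_id ?(ltW S0)//.
  by rewrite mulfV ?subrr ?mulr0// expf_neq0// gt_eqF.
have MS : 0 <= M + S by rewrite addr_ge0// ltW.
rewrite /F /lo /hi; split.
  by rewrite key ?mulr0// addrAC subrr add0r normrN ger0_norm.
by rewrite key ?mulr0// addrAC subrr add0r ger0_norm.
Qed.

(** The sign [(-1)^d] makes the first nodal interval of the subsolution
positive, as the chains require. *)
Lemma lo_pair : sturm_pair lo hi F dF (phi tau lam) (fun r => Num.sqrt r)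
  (fun r => Num.sqrt r * lo_kappa d M S tau lam r) W.
Proof.
have Wd (r : R) : lo <= r -> is_derive r 1 W (- (-1) ^+ d * (Num.sqrt r * phi tau lam r *
   (((r - tau) ^+ 2 - lam - (4 * r ^+ 2)^-1) * lo_f d M S (r - tau) - lo_ddf d M S (r - tau)))).
  move=> lr; have r0 : 0 < r by apply: lt_le_trans lr.
  exact: (isdZ (- (-1) ^+ d) (sqrt_wronskian_deriv lam r0 (lo_f_deriv d M S _) (lo_df_deriv d M S _))).
have inside r : lo < r < hi -> `|r - tau| < M + S.
  by rewrite /lo /hi ltr_norml => /andP[h1 h2]; apply/andP; split; move: h1 h2; lra.
split.
- by move=> r _; exact: lo_shift_deriv.
- by move=> r _; exact: phi_cts.
- by move=> a b la ab _; apply: phi_neq0_between => //; exact: le_trans (ltW lo0) la.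
split.
- move=> r lrh; have /andP[lr rh] := lrh.
  apply: is_derive_eq (Wd r (ltW lr)) _.
  have /andP[c0 _] := lo_chi_gt0 (ltW M0) S0 (inside r lrh).
  have e := @lo_kappaE R d M S tau lam r dM (lt0r_neq0 c0).
  rewrite -[_ * lo_f d M S _ - _]opprB e /F; ring.
- by move=> r /andP[lr _]; exact: isd_cts (Wd r lr).
- move=> r lrh; have /andP[lr rh] := lrh; have r0 : 0 < r by apply: lt_trans lr.
  rewrite mulr_gt0 ?sqrtr_gt0//; apply: (lo_kappa_gt0 dM M4 Mt MC lamC r0).
  exact: inside.
- by move=> r _; exact: sqrtr_ge0.
- move=> r _ /eqP; rewrite /F mulf_eq0 signr_eq0 /= => /eqP fr.
  by rewrite /W /sqrt_wronskian /dF fr; ring.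
Qed.

(** The [d] zeros of [h_d] and the two ends of the support cut out [d + 1] nodal
intervals of the subsolution; [phi 0 > 0] provides the first sign. *)
Lemma oscillates_ge : oscillates tau lam d.+1.
Proof.
have [Flo Fhi] := lo_shift_end.
have Fc r : {for r, continuous F} by exact: isd_cts (lo_shift_deriv r).
have ch := hermite_chain dM.
have chF : chain lo F d (M + tau).
  have h := @chain_translate R (- M) M tau (fun t => (-1) ^+ d * He d t) F d M _ ch (lexx _).
  apply: (chain_widen (lo := - M + tau)); first by move: S0; rewrite /lo; lra.
  apply: h => y My yM; exists (expR (- (y * y / 2))); first exact: expR_gt0.
  rewrite /F addrK /lo_f lo_chi_abs ?(ltW M0)// ppart0; last by rewrite subr_le0 ler_norml My.
  by rewrite expr0n mul0r subr0 mulr1 /hfun mulrA mulrC.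
have Mhi : M + tau < hi by move: S0; rewrite /hi; lra.
have [||y yhi chy] := @chain_transfer R lo hi 0 F (phi tau lam) (fun z _ => Fc z) _ _ d _ hi chF Mhi (lexx _) Fhi.
- move=> x c lx xc chi Fx Fc0.
  have lx' : lo < x by rewrite lt_neqAle lx andbT; apply/eqP => e; rewrite -e Flo ltxx in Fx.
  have [||y /andP[ly yc] fy] := sturm_signs lo_pair (s := -1) _ (lexx _) lx' xc chi Flo Fc0 _.
  + by right.
  + by rewrite gt_eqF.
  exists y => //=; rewrite expr1; split => //; exists 0; first exact: lt_trans ly.
  by rewrite phi_0.
- move=> a x c la ax xc chi Fa Fc0 Fx s ss.
  exact: (sturm_signs lo_pair ss la ax xc chi Fa Fc0 Fx).
by exists y.
Qed.

End HasChain.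

(** * Decaying solutions are eigenfunctions *)

Section L2.
Variable R : realType.
Local Notation mu := (@lebesgue_measure R).
Local Notation half_line := (`]0, +oo[%classic : set R).
Implicit Types (f g : R -> R) (r C : R).

Lemma real_complexMc (x y : R) : (x%:C * y%:C = (x * y)%:C)%C.
Proof. by rewrite rmorphM. Qed.

Lemma integrable_exp_half : mu.-integrable half_line (fun r => (expR (- (2^-1) * r))%:E).
Proof.
have r0 : 0 < 2^-1 :> R by rewrite invr_gt0.
have h := integrable_exponential_pdf r0.
have h1 : mu.-integrable half_line (EFin \o exponential_pdf (2^-1 : R)).
  exact: integrableS h.
have := @integrableZl _ _ R mu half_line _ 2 _ h1 => /(_ ltac:(done)).
apply: eq_integrable => //.
move=> r; rewrite inE /= in_itv /= andbT => rgt0.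
by rewrite exponential_pdfE ?ltW// -EFinM mulrA mulfV// mul1r.
Qed.

Lemma half_line_measurable f : (forall r, 0 < r -> {for r, continuous f}) ->
  measurable_fun half_line f.
Proof.
move=> fc; apply: open_continuous_measurable_fun; first exact: interval_open.
by move=> r; rewrite inE /= in_itv /= andbT; exact: fc.
Qed.

(** The weight [r] is absorbed by half of the exponential decay of [f^2]. *)
Lemma L2_integrable f C : (forall r, 0 < r -> {for r, continuous f}) ->
  (forall r, 0 < r -> `|f r| <= C * expR (- (2^-1) * r)) ->
  mu.-integrable half_line (fun r => (f r ^+ 2 * r)%:E).
Proof.
move=> fc fC.
have C0 : 0 <= C.
  have := le_trans (normr_ge0 _) (fC 1 ltr01).
  by rewrite pmulr_lge0// expR_gt0.
have h := @integrableZl _ _ R mu half_line ltac:(done) (2 * C ^+ 2) _ integrable_exp_half.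
apply: le_integrable h => //.
  apply/measurable_EFinP.
  rewrite (_ : (fun r => f r ^+ 2 * r) = (fun r => f r * f r * r)); last first.
    by apply/funext => r; rewrite expr2.
  apply: half_line_measurable => r r0.
  apply: (@continuousM _ _ (fun r => f r * f r) (fun r => r)) => //.
  by apply: (@continuousM _ _ f f); exact: fc.
move=> r; rewrite /= in_itv /= andbT => r0.
rewrite lee_fin normrM (ger0_norm (ltW r0)) ger0_norm ?sqr_ge0// ger0_norm; last first.
  by rewrite !mulr_ge0 ?expR_ge0// sqr_ge0.
set e := expR (- (2^-1) * r).
have e0 : 0 < e := expR_gt0 _.
have h1 : f r ^+ 2 <= C ^+ 2 * e ^+ 2.
  rewrite -exprMn -[f r ^+ 2]ger0_norm ?sqr_ge0// normrX lerXn2r ?nnegrE ?mulr_ge0 ?(ltW e0)//.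
  exact: fC.
have h2 : r * e <= 2.
  have : r / 2 * e <= 1.
    rewrite -ler_pdivlMr// div1r /e -expRN mulNr opprK [_ * r]mulrC.
    by have := expR_ge1Dx (r / 2); lra.
  lra.
apply: (@le_trans _ _ (C ^+ 2 * e ^+ 2 * r)); first by rewrite ler_wpM2r// ltW.
have -> : C ^+ 2 * e ^+ 2 * r = C ^+ 2 * e * (r * e) by ring.
have -> : 2 * C ^+ 2 * e = C ^+ 2 * e * 2 by ring.
by rewrite ler_wpM2l// mulr_ge0 ?sqr_ge0// ltW.
Qed.

Lemma L2r_real f C : (forall r, 0 < r -> {for r, continuous f}) ->
  (forall r, 0 < r -> `|f r| <= C * expR (- (2^-1) * r)) ->
  L2r (fun r => ((f r)%:C)%C).
Proof.
move=> fc fC; split => /=.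
- exact: half_line_measurable.
- by apply: half_line_measurable => r _; exact: cst_continuous.
- apply: eq_integrable (L2_integrable fc fC) => //.
  by move=> r _; congr (_ * _)%:E; rewrite expr0n addr0 sqr_sqrtr ?sqr_ge0.
Qed.

Lemma real_derivative_of f g : (forall r, 0 < r -> is_derive r 1 f (g r)) ->
  (forall r, 0 < r -> {for r, continuous g}) -> real_derivative f g.
Proof.
move=> fg gc a b a0 ab.
have pos r : a <= r <= b -> 0 < r by move=> /andP[ar _]; exact: lt_le_trans ar.
have gab : {within `[a, b], continuous g} by apply: cts_within => r /pos; exact: gc.
split; first by apply: continuous_compact_integrable => //; exact: segment_compact.
move: ab; rewrite le_eqVlt => /predU1P[<-|ab].
  by rewrite subrr set_itv1 Rintegral_set1.
rewrite /Rintegral (@continuous_FTC2 _ g f)//.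
  split.
  - move=> r; rewrite in_itv /= => /andP[ar rb].
    by have [] := fg r (lt_trans a0 ar).
  - by apply: cvg_at_right_filter; exact: isd_cts (fg a a0).
  - by apply: cvg_at_left_filter; exact: isd_cts (fg b (lt_trans a0 ab)).
move=> r; rewrite in_itv /= => /andP[ar rb]; rewrite derive1E.
by have [_ ->] := fg r (lt_trans a0 ar).
Qed.

Lemma real_derivative0 : real_derivative (fun _ : R => 0) (fun _ => 0).
Proof.
apply: real_derivative_of => r _.
exact: cst_continuous.
Qed.

End L2.

Section DecayEigen.
Variable R : realType.
Local Notation mu := (@lebesgue_measure R).
Implicit Types (f g : R -> R) (r C tau lam rs : R).

Lemma segment_bound f a b : a <= b -> (forall x, a <= x <= b -> {for x, continuous f}) ->
  exists2 K, 0 <= K & forall x, a <= x <= b -> `|f x| <= K.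
Proof.
move=> ab fc; have [|c _ cP] := @EVT_max _ (fun x => `|f x|) a b ab.
  apply: cts_within => x xab; apply: continuous_comp; first exact: fc.
  exact: norm_continuous.
by exists `|f c| => // x xab; apply: cP; rewrite in_itv.
Qed.

(** On [[0, rs + 1]] both functions are bounded by continuity, beyond it they
decay exponentially. *)
Lemma decays_bound tau lam rs : barrier tau lam rs -> decays tau lam rs ->
  exists2 C, 0 <= C & forall r, 0 <= r ->
    `|phi tau lam r| <= C * expR (- r) /\ `|dphi tau lam r| <= C * expR (- r).
Proof.
move=> B D; have [rs1 Q] := B; have [s ss sP] := decays_sign B D.
have nm x : `|s * x| = `|x| by case: ss => ->; rewrite ?mul1r ?mulN1r ?normrN.
pose y r := s * phi tau lam r.
have yp r : rs <= r -> 0 < y r by move=> /sP[].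
have dyn r : rs <= r -> s * dphi tau lam r <= 0 by move=> /sP[].
have S := solZ s (@phi_sol _ tau lam rs).
have h1 := decay_exp B S yp dyn.
have h2 := decay_dexp B S yp dyn.
have rs0 : 0 <= rs + 1 by lra.
have [K1 K10 K1P] : exists2 K, 0 <= K & forall x, 0 <= x <= rs + 1 -> `|phi tau lam x| <= K.
  by apply: segment_bound => // x _; exact: phi_cts.
have [K2 K20 K2P] : exists2 K, 0 <= K & forall x, 0 <= x <= rs + 1 -> `|dphi tau lam x| <= K.
  by apply: segment_bound => // x _; exact: isd_cts (dphi_deriv tau lam x).
pose A := y rs * expR (rs + 1); pose E := expR (rs + 1).
have A0 : 0 <= A by rewrite mulr_ge0 ?expR_ge0// ltW// yp.
have E0 : 0 <= E by exact: expR_ge0.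
exists (K1 * E + K2 * E + A); first by rewrite !addr_ge0// mulr_ge0.
move=> r r0; have e0 := expR_gt0 (- r).
have K1E : 0 <= K1 * E * expR (- r) by rewrite !mulr_ge0// ltW.
have K2E : 0 <= K2 * E * expR (- r) by rewrite !mulr_ge0// ltW.
have AE : 0 <= A * expR (- r) by rewrite mulr_ge0// ltW.
rewrite !mulrDl.
have [rr|rr] := leP r (rs + 1).
  have e1 : 1 <= E * expR (- r).
    by rewrite /E -expRD -[leLHS]expR0 ler_expR subr_ge0.
  have hin : 0 <= r <= rs + 1 by rewrite r0.
  have k1 : K1 <= K1 * E * expR (- r) by rewrite -mulrA ler_peMr.
  have k2 : K2 <= K2 * E * expR (- r) by rewrite -mulrA ler_peMr.
  have := K1P r hin; have := K2P r hin; clear -k1 k2 K1E K2E AE; split; lra.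
have rsr : rs <= r by lra.
have r1 : rs <= r - 1 by lra.
have := h1 r rsr; have := h1 _ r1; have := h2 r (ltW rr).
rewrite -(nm (phi tau lam r)) -(nm (dphi tau lam r)) ger0_norm ?(ltW (yp r rsr))//.
rewrite ler0_norm ?dyn// -/(y r).
have -> : rs - (r - 1) = (rs + 1) + - r by ring.
have -> : expR (rs + 1 + - r) = E * expR (- r) by rewrite expRD.
rewrite mulrA -/A => q1 q2 q3.
have {}q3 : y r <= y rs * expR (rs - r) := q3.
have q4 : y rs * expR (rs - r) <= A * expR (- r).
  rewrite /A -mulrA -expRD ler_wpM2l ?(ltW (yp rs _))// ler_expR; clear; lra.
clear -q1 q2 q3 q4 K1E K2E AE; split; lra.
Qed.

(** The decay [exp(- r)] is weakened to [exp(- r / 2)] in order to absorb the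
polynomial weights in the operator domain. *)
Definition half_bounded f := exists C, forall r, 0 < r -> `|f r| <= C * expR (- (2^-1) * r).

Lemma half_boundedD f g : half_bounded f -> half_bounded g -> half_bounded (fun r => f r + g r).
Proof.
move=> [C CP] [D DP]; exists (C + D) => r r0; rewrite mulrDl.
exact: le_trans (ler_normD _ _) (lerD (CP r r0) (DP r r0)).
Qed.

Lemma half_boundedZ c f : half_bounded f -> half_bounded (fun r => c * f r).
Proof.
move=> [C CP]; exists (`|c| * C) => r r0; rewrite normrM -mulrA.
by rewrite ler_wpM2l// CP.
Qed.

Lemma exp_linear (a r : R) : 0 < a -> a * r * expR (- (a * r)) <= 1.
Proof.
move=> a0; rewrite expRN ler_pdivrMr ?expR_gt0// mul1r.
by have := expR_ge1Dx (a * r); lra.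
Qed.

Lemma half_bounded_pow k f C : (k <= 2)%N -> 0 <= C ->
  (forall r, 0 <= r -> `|f r| <= C * expR (- r)) -> half_bounded (fun r => r ^+ k * f r).
Proof.
move=> k2 C0 fC.
(* [16] is the square of the bound [4] of [r * exp (- r / 4)] *)
exists (16 * C) => r r0.
have e4 := expR_gt0 (- (4^-1 * r)); set e := expR (- (4^-1 * r)) in e4 *.
have q0 : 0 < 4^-1 :> R by rewrite invr_gt0.
have l : r * e <= 4.
  have := exp_linear r q0; rewrite -/e -mulrA => h.
  by rewrite -[leLHS](mulVKf (_ : 4 != 0 :> R))// ler_piMr.
have e1 : e <= 1 by rewrite /e -expR0 ler_expR oppr_le0 mulr_ge0// ?invr_ge0// ltW.
have E2 : expR (- (2^-1) * r) = e * e by rewrite /e -expRD; congr expR; field.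
have E1 : expR (- r) = e * e * (e * e) by rewrite /e -!expRD; congr expR; field.
have key : r ^+ k * (e * e) <= 16.
  have x0 : 0 <= r * e by rewrite mulr_ge0// ltW.
  have e0 := ltW e4.
  case: k k2 => [|[|[|]]] // _; rewrite ?expr0 ?expr1.
  - by rewrite mul1r; apply: (@le_trans _ _ 1); [rewrite mulr_ile1 | rewrite ler1n].
  - rewrite mulrA; apply: (@le_trans _ _ (4 * 1)); last by rewrite mulr1 ler_nat.
    exact: ler_pM.
  - rewrite (_ : _ * _ = (r * e) * (r * e)); last by ring.
    apply: (@le_trans _ _ (4 * 4)); last by rewrite -natrM ler_nat.
    exact: ler_pM.
rewrite normrM normrX (gtr0_norm r0) E2.
apply: (@le_trans _ _ (r ^+ k * (C * (e * e * (e * e))))).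
  by rewrite ler_wpM2l ?exprn_ge0 ?(ltW r0)// -E1 fC// ltW.
have -> : r ^+ k * (C * (e * e * (e * e))) = C * (e * e) * (r ^+ k * (e * e)) by ring.
have -> : 16 * C * (e * e) = C * (e * e) * 16 by ring.
by rewrite ler_wpM2l// mulr_ge0// mulr_ge0// ltW.
Qed.

(** Near [0] the quotient [phi' / r] is a value of [phi''], because [phi' 0 =
0]. *)
Lemma dphi_div_bounded tau lam C : 0 <= C ->
  (forall r, 0 <= r -> `|dphi tau lam r| <= C * expR (- r)) ->
  half_bounded (fun r => r^-1 * dphi tau lam r).
Proof.
move=> C0 dC.
have [K K0 KP] : exists2 K, 0 <= K & forall x, 0 <= x <= 1 -> `|ddphi tau lam x| <= K.
  apply: segment_bound => // x _.
  by apply: (isd_cts (psum_deriv x (entire_diffs (entire_diffs (entire_coef _ _ _))))).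
exists (K * expR 1 + C) => r r0.
have e0 := expR_gt0 (- (2^-1) * r).
rewrite normrM normfV (gtr0_norm r0) mulrDl.
have [r1|r1] := leP r 1.
  have [x _|x /andP[x0 xr] e] := @mvt _ (dphi tau lam) (ddphi tau lam) 0 r r0.
    exact: dphi_deriv.
  have hK : `|ddphi tau lam x| <= K by apply: KP; rewrite ltW//= ltW// (lt_le_trans xr).
  move: e; rewrite dphi_0 !subr0 => ->; rewrite normrM (gtr0_norm r0) mulrC mulfK ?gt_eqF//.
  apply: le_trans hK _; apply: ler_wpDr; first by rewrite mulr_ge0// ltW.
  rewrite -mulrA ler_peMr// -expRD -[leLHS]expR0 ler_expR; lra.
apply: ler_wpDl; first by rewrite !mulr_ge0 ?expR_ge0// ltW.
apply: (@le_trans _ _ `|dphi tau lam r|).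
  by rewrite ler_piMl// invf_le1// ltW.
apply: le_trans (dC r (ltW r0)) _; rewrite ler_wpM2l// ler_expR; lra.
Qed.

Lemma L2r_half_bounded f : (forall r, 0 < r -> {for r, continuous f}) -> half_bounded f ->
  L2r (fun r => ((f r)%:C)%C).
Proof. by move=> fc [C CP]; exact: L2r_real fc CP. Qed.

Lemma derivative_real f g : real_derivative f g ->
  derivative (fun r => ((f r)%:C)%C) (fun r => ((g r)%:C)%C).
Proof. by move=> fg; split => //=; exact: real_derivative0. Qed.

(** The eigenfunction is [phi] itself; the exponential decay puts all the required
weighted derivatives in [L^2], and [phi''] is recovered from the equation. *)
Lemma decays_eigenvalue tau lam rs : barrier tau lam rs -> decays tau lam rs ->
  g_eigenvalue tau lam.
Proof.
move=> B D; have [C C0 CP] := decays_bound B D.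
have pc r : {for r, continuous (phi tau lam)} by exact: phi_cts.
have dc r : {for r, continuous (dphi tau lam)} by exact: isd_cts (dphi_deriv tau lam r).
have ddc r : {for r, continuous (ddphi tau lam)}.
  exact: (isd_cts (psum_deriv r (entire_diffs (entire_diffs (entire_coef _ _ _))))).
have Xk k r : {for r, continuous (fun r : R => r ^+ k)}.
  have := @continuous_horner R ('X^k) r.
  by rewrite (_ : horner 'X^k = fun r => r ^+ k)//; apply/funext => y; rewrite hornerXn.
have pb : forall r, 0 <= r -> `|phi tau lam r| <= C * expR (- r) by move=> r /CP[].
have db : forall r, 0 <= r -> `|dphi tau lam r| <= C * expR (- r) by move=> r /CP[].
have b1 k : (k <= 2)%N -> half_bounded (fun r => r ^+ k * phi tau lam r).
  by move=> k2; exact: half_bounded_pow pb.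
have bphi : half_bounded (phi tau lam).
  by have [K KP] := b1 0 isT; exists K => r r0; have := KP r r0; rewrite expr0 mul1r.
have bdphi : half_bounded (dphi tau lam).
  have [K KP] := half_bounded_pow (k := 0) isT C0 db.
  by exists K => r r0; have := KP r r0; rewrite expr0 mul1r.
have bdiv := dphi_div_bounded C0 db.
have bddphi : half_bounded (ddphi tau lam).
  have [K KP] := half_boundedD (half_boundedD (b1 2 isT) (half_boundedZ (- (2 * tau)) (b1 1 isT)))
    (half_boundedD (half_boundedZ (tau ^+ 2 - lam) bphi) (half_boundedZ (-1) bdiv)).
  exists K => r r0; have := KP r r0; congr (_ <= _); congr `|_|.
  have rn : r != 0 by rewrite gt_eqF.
  apply: (mulfI rn); have := phi_eq tau lam r.
  have -> : r * (r ^+ 2 * phi tau lam r + - (2 * tau) * (r ^+ 1 * phi tau lam r) +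
    ((tau ^+ 2 - lam) * phi tau lam r + -1 * (r^-1 * dphi tau lam r))) =
    r * ((r - tau) ^+ 2 - lam) * phi tau lam r - (r * r^-1) * dphi tau lam r by ring.
  by rewrite mulfV// mul1r => <-; ring.
have Lphi := L2r_half_bounded (fun r _ => pc r) bphi.
have Ldphi := L2r_half_bounded (fun r _ => dc r) bdphi.
have Lddphi := L2r_half_bounded (fun r _ => ddc r) bddphi.
have d1 := derivative_real (real_derivative_of (fun r _ => phi_deriv tau lam r) (fun r _ => dc r)).
have d2 := derivative_real (real_derivative_of (fun r _ => dphi_deriv tau lam r) (fun r _ => ddc r)).
exists (fun r => ((phi tau lam r)%:C)%C); split.
  move=> [N [mN N0 sub]].
  have [e e0 eP] : exists2 d, 0 < d & forall y, `|0 - y| < d -> 0 < phi tau lam y.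
    by apply: cts_pos => //; rewrite phi_0.
  have : (mu `]0%R, e[%classic <= 0)%E.
    rewrite -N0; apply: le_measure; rewrite ?inE//.
    move=> r; rewrite /= in_itv /= => /andP[r0 re]; apply: sub => /= H.
    have [h] : (phi tau lam r)%:C%C = 0 :> R[i] by exact: H.
    by have := eP r; rewrite sub0r normrN gtr0_norm// re h ltxx => /(_ isT).
  by rewrite lebesgue_measure_itv /= lte_fin e0 oppr0 adde0 lee_fin leNgt e0.
exists (fun r => ((dphi tau lam r)%:C)%C), (fun r => ((ddphi tau lam r)%:C)%C); split.
  split; split => //.
  - split => //; first by exists (fun r => ((dphi tau lam r)%:C)%C).
    rewrite (_ : (fun r => _) = (fun r => ((r ^+ 1 * phi tau lam r)%:C)%C)); last first.
      by apply/funext => r; rewrite expr1 real_complexMc.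
    apply: L2r_half_bounded (b1 1 isT) => r _.
    apply: (@continuousM _ _ (fun r => r ^+ 1) (phi tau lam)); [exact: Xk | exact: pc].
  - rewrite (_ : (fun r => _) = (fun r => ((r^-1 * dphi tau lam r)%:C)%C)); last first.
      by apply/funext => r; rewrite real_complexMc.
    apply: L2r_half_bounded bdiv => r r0.
    apply: (@continuousM _ _ (fun r => r^-1) (dphi tau lam)); last exact: dc.
    have rn : r != 0 by rewrite gt_eqF.
    exact: isd_cts (@is_deriveV _ (fun r => r) r 1 1 rn (isd_id r)).
  - rewrite (_ : (fun r => _) = (fun r => ((r ^+ 2 * phi tau lam r)%:C)%C)); last first.
      by apply/funext => r; rewrite real_complexMc.
    apply: L2r_half_bounded (b1 2 isT) => r _.
    apply: (@continuousM _ _ (fun r => r ^+ 2) (phi tau lam)); [exact: Xk | exact: pc].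
  - have nE (x : R) : ComplexField.Normc.normc (x%:C)%C = `|x|.
      by rewrite /= expr0n addr0 sqrtr_sqr.
    rewrite (_ : (fun r => _) = (fun r => r * `|dphi tau lam r|)); last first.
      by apply/funext => r; rewrite nE.
    have c0 : {for 0, continuous (fun r => r * `|dphi tau lam r|)}.
      apply: (@continuousM _ _ (fun r => r) (fun r => `|dphi tau lam r|)).
        exact: isd_cts (isd_id 0).
      by apply: continuous_comp; [exact: dc | exact: norm_continuous].
    by have := cvg_at_right_filter c0; rewrite mul0r.
apply: aeW => r r0 /=.
rewrite !real_complexMc -!rmorphN -!rmorphD; congr (_%:C)%C.
have rn : r != 0 by rewrite gt_eqF.
apply: (mulfI rn); have e := phi_eq tau lam r.
have -> : r * (- ddphi tau lam r - r^-1 * dphi tau lam r + (r - tau) ^+ 2 * phi tau lam r) =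
  r * (r - tau) ^+ 2 * phi tau lam r - (r * ddphi tau lam r + (r * r^-1) * dphi tau lam r) by ring.
by rewrite mulfV// mul1r e; ring.
Qed.

End DecayEigen.

(** * Eigenfunctions are decaying solutions *)

Section EigenDecay.
Variable R : realType.
Local Notation mu := (@lebesgue_measure R).
Local Notation half_line := (`]0, +oo[%classic : set R).
Implicit Types (f g v : R -> R) (r C tau lam rs x : R).

Lemma near_itv (a b x : R) : a < x -> x < b -> \forall y \near x, a < y < b.
Proof.
move=> ax xb; near=> y; apply/andP; split.
  by near: y; exact: lt_nbhsr.
by near: y; exact: lt_nbhsl.
Unshelve. all: by end_near. Qed.

Lemma real_derivative_primitive f g (a b : R) : real_derivative f g -> 0 < a ->
  forall y, a < y -> f y = f a + \int[mu]_(r in `[a, y]) g r.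
Proof.
by move=> fg a0 y ay; have [_ <-] := fg a y a0 (ltW ay); rewrite addrC subrK.
Qed.

Lemma real_derivative_cts f g : real_derivative f g ->
  forall r, 0 < r -> {for r, continuous f}.
Proof.
move=> fg x x0; pose a := x / 2; pose b := 2 * x.
have a0 : 0 < a by rewrite /a; lra.
have ax : a < x by rewrite /a; lra.
have xb : x < b by rewrite /b; lra.
have ab := lt_trans ax xb.
have [gi _] := fg a b a0 (ltW ab).
have := parameterized_integral_continuous (ltW ab) gi.
move=> /(continuous_within_itvP _ ab)[+ _ _] => /(_ x).
rewrite in_itv /= ax xb => /(_ isT) Fc.
have c2 : {for x, continuous (fun y => f a + parameterized_integral mu a y g)}.
  by apply: continuousD => //; exact: cst_continuous.
have e : \forall y \near x, f a + parameterized_integral mu a y g = f y.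
  apply: filterS (near_itv ax xb) => y /andP[ay _].
  by rewrite (real_derivative_primitive b fg a0 ay).
have ex := nbhs_singleton e.
have c3 : f @ x --> f x.
  by rewrite -ex; apply: cvg_trans c2; exact: near_eq_cvg.
exact: c3.
Qed.

(** The fundamental theorem of calculus at the points of continuity of the
weak derivative. *)
Lemma real_derivative_is_derive f g : real_derivative f g ->
  (forall r, 0 < r -> {for r, continuous g}) -> forall r, 0 < r -> is_derive r 1 f (g r).
Proof.
move=> fg gc x x0; pose a := x / 2; pose b := 2 * x.
have a0 : 0 < a by rewrite /a; lra.
have ax : a < x by rewrite /a; lra.
have xb : x < b by rewrite /b; lra.
have [gi _] := fg a b a0 (ltW (lt_trans ax xb)).
have [Fd Fe] := continuous_FTC1_closed xb gi ax (gc x x0).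
set F := fun _ => _ in Fd Fe.
have FD : is_derive x 1 F (g x).
  by rewrite -Fe derive1E; exact: derivableP.
apply: (@near_eq_is_derive R R^o R^o (fun y => f a + F y) f x 1).
  apply: filterS (near_itv ax xb) => y /andP[ay _].
  by rewrite (real_derivative_primitive b fg a0 ay).
by apply: is_derive_eq (isdD (isd_cst x (f a)) FD) _; rewrite add0r.
Qed.

Lemma real_derivative_ae f g h : real_derivative f g ->
  (forall r, 0 < r -> {for r, continuous h}) ->
  {ae mu, forall r, 0 < r -> g r = h r} -> real_derivative f h.
Proof.
move=> fg hc gh a b a0 ab; have [gi e] := fg a b a0 ab.
have hi : mu.-integrable `[a, b] (EFin \o h).
  apply: continuous_compact_integrable; first exact: segment_compact.
  by apply: cts_within => x /andP[ax _]; apply: hc; exact: lt_le_trans ax.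
split => //; rewrite e /Rintegral; congr fine.
apply: ae_eq_integral => //.
- by move/integrableP : gi => [].
- by move/integrableP : hi => [].
- case: gh => N [mN N0 sub]; exists N; split=> // x /= H; apply: sub => /= ghx.
  by apply: H; rewrite in_itv /= => /andP[ax _]; rewrite ghx//; exact: lt_le_trans ax.
Qed.

(** Bootstrap: [v] and [v1] are absolutely continuous, so the equation replaces the
weak second derivative by a continuous function, hence [v] is a classical
solution. *)
Lemma ae_solution tau lam v v1 v2 : real_derivative v v1 -> real_derivative v1 v2 ->
  {ae mu, forall r, 0 < r -> - v2 r - r^-1 * v1 r + (r - tau) ^+ 2 * v r = lam * v r} ->
  forall lo, 0 < lo -> sol tau lam lo v v1.
Proof.
move=> vd v1d ae lo lo0.
have vc := real_derivative_cts vd; have v1c := real_derivative_cts v1d.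
pose w r := ((r - tau) ^+ 2 - lam) * v r - r^-1 * v1 r.
have rVc r : 0 < r -> {for r, continuous (fun r : R => r^-1)}.
  move=> r0; have rn : r != 0 by rewrite gt_eqF.
  exact: isd_cts (@is_deriveV _ (fun r => r) r 1 1 rn (isd_id r)).
have qc r : {for r, continuous (fun r => (r - tau) ^+ 2 - lam)}.
  have h := isdB (isd_id r) (isd_cst r tau).
  have h2 := isdB (isdM h h) (isd_cst r lam).
  have := isd_cts h2; rewrite (_ : (fun y => _) = (fun r => (r - tau) ^+ 2 - lam))//.
have wc r : 0 < r -> {for r, continuous w}.
  move=> r0; apply: (@continuousB _ _ _ (fun r => ((r - tau) ^+ 2 - lam) * v r) (fun r => r^-1 * v1 r)).
    by apply: (@continuousM _ _ (fun r => (r - tau) ^+ 2 - lam) v); [exact: qc | exact: vc].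
  by apply: (@continuousM _ _ (fun r => r^-1) v1); [exact: rVc | exact: v1c].
have v1w : real_derivative v1 w.
  apply: real_derivative_ae v1d wc _.
  case: ae => N [mN N0 sub]; exists N; split=> // r /= H; apply: sub => /= h.
  by apply: H => r0; have := h r0; rewrite /w; lra.
have D1 := real_derivative_is_derive vd v1c.
have D2 := real_derivative_is_derive v1w wc.
move=> r lr; have r0 := lt_le_trans lo0 lr; split; first exact: D1.
apply: is_derive_eq (isdM (isd_id r) (D2 r r0)) _.
by rewrite /w; field; rewrite gt_eqF.
Qed.

Lemma cts_dist f x (e : R) : {for x, continuous f} -> 0 < e ->
  exists2 d, 0 < d & forall y, `|x - y| < d -> `|f x - f y| < e.
Proof.
move=> fc e0; have /cvgrPdist_lt /(_ e e0) : f @ x --> f x by exact: fc.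
by move=> /nbhs_ballP[d /= d0 dP]; exists d => // y xy; apply: dP.
Qed.

(** The Wronskian with [phi] is constant on [(0, +oo)].  It vanishes because at the
origin [r v1 --> 0], [phi' 0 = 0] and [r v] stays bounded, the last by
integrating the bound on [r v1].  Proportionality follows from the uniqueness
of the solution with given values at one point. *)
Lemma solution_multiple tau lam v v1 : (forall lo, 0 < lo -> sol tau lam lo v v1) ->
  (fun r => r * `|v1 r|) @ 0^'+ --> (0 : R) ->
  exists c, forall r, 0 < r -> v r = c * phi tau lam r.
Proof.
move=> S trace.
pose W r := r * v1 r * phi tau lam r - v r * (r * dphi tau lam r).
have WD (r : R) : 0 < r -> is_derive r 1 W 0.
  move=> r0; have [vd pd] := S r r0 r (lexx r).
  have [fd qd] := @phi_sol _ tau lam r r (lexx r).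
  by apply: is_derive_eq (isdB (isdM pd fd) (isdM vd qd)) _; ring.
have Wcst s r : 0 < s -> s < r -> W s = W r.
  move=> s0 sr; have [x|x _] := @mvt _ W (fun=> 0) s r sr.
    by move=> /andP[sx _]; apply: WD; exact: lt_le_trans sx.
  by rewrite mul0r => /eqP; rewrite subr_eq0 => /eqP.
have small e : 0 < e -> exists2 d, 0 < d & forall r, 0 < r -> r < d -> r * `|v1 r| < e.
  move=> e0; have : \forall r \near 0^'+, `|0 - r * `|v1 r| | < e.
    by move: trace => /cvgrPdist_lt /(_ e e0).
  rewrite /at_right => /nbhs_ballP[d /= d0 dP]; exists d => // r r0 rd.
  have := dP r; rewrite /ball /= sub0r normrN (gtr0_norm r0) => /(_ rd r0).
  by rewrite sub0r normrN ger0_norm// mulr_ge0// ltW.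
have [d1 d10 d1P] := small 1 ltr01.
pose a := d1 / 2; have a0 : 0 < a by rewrite /a; lra.
have ad : a < d1 by rewrite /a; lra.
pose B := `|v a| * a + a; have B0 : 0 <= B by rewrite addr_ge0 ?mulr_ge0// ltW.
have sB s : 0 < s -> s < a -> s * `|v s| <= B.
  move=> s0 sa; have [x /andP[sx _]|x /andP[sx xa] e] := @mvt _ v v1 s a sa.
    by have [] := S s s0 x sx.
  have h1 : s * `|v1 x| <= 1.
    have x0 := lt_trans s0 sx.
    apply: le_trans (ltW (d1P x x0 (lt_trans xa ad))); rewrite ler_wpM2r//; exact: ltW.
  have -> : v s = v a - v1 x * (a - s) by rewrite -e; ring.
  apply: (@le_trans _ _ (s * (`|v a| + `|v1 x| * (a - s)))).
    rewrite ler_wpM2l ?(ltW s0)//; apply: le_trans (ler_normB _ _) _.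
    by rewrite lerD2l normrM [X in _ * X <= _]gtr0_norm ?subr_gt0.
  rewrite mulrDr /B; apply: lerD; first by rewrite mulrC ler_wpM2l// ltW.
  rewrite mulrA; apply: (@le_trans _ _ (1 * (a - s))); last by rewrite mul1r; lra.
  by rewrite ler_wpM2r// subr_ge0 ltW.
have W0 r : 0 < r -> W r = 0.
  move=> r0; apply/eqP; rewrite -normr_le0; apply/ler_addgt0Pl => e e0; rewrite addr0.
  (* near [0], [|phi| <= 2] and [s * |v s| <= B] *)
  pose e' := e / (2 + B); have e'0 : 0 < e' by rewrite divr_gt0// ltr_wpDr.
  have [d2 d20 d2P] := small e' e'0.
  have [d3 d30 d3P] := cts_dist (@phi_cts R tau lam 0) ltr01.
  have [d4 d40 d4P] := cts_dist (isd_cts (dphi_deriv tau lam 0)) e'0.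
  pose s := Num.min (Num.min r a) (Num.min (Num.min d2 d3) d4) / 2.
  have m0 : 0 < Num.min (Num.min r a) (Num.min (Num.min d2 d3) d4).
    by rewrite !lt_min r0 a0 d20 d30 d40.
  have s0 : 0 < s by rewrite /s divr_gt0.
  have : s < Num.min (Num.min r a) (Num.min (Num.min d2 d3) d4) by rewrite /s; move: m0; lra.
  rewrite !lt_min => /andP[/andP[sr sa] /andP[/andP[sd2 sd3] sd4]].
  clearbody s; rewrite -(Wcst s r s0 sr) /W.
  have f2 : `|phi tau lam s| <= 2.
    have := d3P s; rewrite sub0r normrN (gtr0_norm s0) phi_0 => /(_ sd3) h.
    rewrite (_ : phi tau lam s = 1 - (1 - phi tau lam s)); last by ring.
    by apply: le_trans (ler_normB _ _) _; rewrite normr1; move: h; lra.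
  have df : `|dphi tau lam s| <= e'.
    by have := d4P s; rewrite sub0r normrN (gtr0_norm s0) dphi_0 sub0r normrN => /(_ sd4) /ltW.
  apply: le_trans (ler_normB _ _) _; rewrite !normrM (gtr0_norm s0).
  have h1 : s * `|v1 s| * `|phi tau lam s| <= e' * 2.
    by apply: ler_pM => //; [rewrite mulr_ge0// ltW | apply/ltW/d2P].
  have h2 : `|v s| * (s * `|dphi tau lam s|) <= B * e'.
    rewrite mulrCA mulrA; apply: ler_pM => //; [by rewrite mulr_ge0// ltW | exact: sB].
  apply: le_trans (lerD h1 h2) _.
  have -> : e' * 2 + B * e' = e.
    by rewrite /e'; field; rewrite gt_eqF// ltr_wpDr.
  by [].
have p01 : 0 < phi tau lam 0 by rewrite phi_0.
have [d d0 dP] := @cts_pos _ (phi tau lam) 0 (@phi_cts R tau lam 0) p01.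
pose q := d / 2; have q0 : 0 < q by rewrite /q; lra.
have fq : 0 < phi tau lam q by apply: dP; rewrite sub0r normrN gtr0_norm// /q; lra.
pose c := v q / phi tau lam q; exists c => r r0.
(* the uniqueness theorem works on [[lo, +oo)], which has to contain both points *)
pose lo := Num.min q r.
have lo0 : 0 < lo by rewrite lt_min q0.
have loq : lo <= q by rewrite ge_min lexx.
have lor : lo <= r by rewrite ge_min lexx orbT.
have Sz : sol tau lam lo (fun r => v r + (- c) * phi tau lam r) (fun r => v1 r + (- c) * dphi tau lam r).
  move=> x lx; have [vd pd] := S lo lo0 x lx.
  have [fd qd] := solZ (- c) (@phi_sol _ tau lam lo) lx.
  split; first exact: (isdD vd fd).
  apply: (isd_ext (f := fun s => s * v1 s + s * (- c * dphi tau lam s))) => [y|]; first by ring.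
  by apply: is_derive_eq (isdD pd qd) _; ring.
have [||h _] := sol_unique lo0 Sz loq _ _ lor.
- by rewrite /c mulNr mulfVK ?subrr// gt_eqF.
- have := W0 q q0; rewrite /W /c => hW.
  have qn : q != 0 by rewrite gt_eqF.
  have fn : phi tau lam q != 0 by rewrite gt_eqF.
  apply: (mulfI qn); apply: (mulfI fn); rewrite !mulr0 -[RHS]hW; field; exact: fn.
- by move: h => /eqP; rewrite mulNr subr_eq0 => /eqP.
Qed.

(** A solution that does not decay is eventually bounded away from [0], and
the weight [r] has infinite mass. *)
Lemma grows_not_L2 tau lam rs v c : barrier tau lam rs -> ~ decays tau lam rs -> c != 0 ->
  (forall r, 0 < r -> v r = c * phi tau lam r) ->
  ~ mu.-integrable half_line (fun r => (v r ^+ 2 * r)%:E).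
Proof.
move=> B nd c0 vE /integrableP[mv vi].
have [//|[s ss G]] := decays_or_grows tau lam rs.
have [r0 rr [f0 fr]] := grows_pos B G.
have [rs1 _] := B; have r00 : 0 < r0 by apply: lt_le_trans rr; lra.
pose k := (c * phi tau lam r0) ^+ 2 * r0.
have fn0 : phi tau lam r0 != 0 by apply/eqP => e; rewrite e mulr0 ltxx in f0.
have k0 : 0 < k by rewrite mulr_gt0// exprn_even_gt0//= mulf_neq0.
have kv r : r0 <= r -> k <= v r ^+ 2 * r.
  move=> r0r; have rgt0 := lt_le_trans r00 r0r; rewrite vE// /k; apply: ler_pM => //.
  - exact: sqr_ge0.
  - exact: ltW.
  - rewrite !exprMn ler_wpM2l ?sqr_ge0//.
    have s2 x : x ^+ 2 = (s * x) ^+ 2 by case: ss => ->; ring.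
    by rewrite (s2 (phi _ _ _)) [leRHS]s2 lerXn2r ?nnegrE ?fr// ltW// (lt_le_trans f0)// fr.
set I := (\int[mu]_(x in half_line) `|(v x ^+ 2 * x)%:E|)%E in vi.
have I0 : (0 <= I)%E by apply: integral_ge0.
have key (N : R) : 0 <= N -> ((k * N)%:E <= I)%E.
  move=> N0; pose J := `[r0, r0 + N]%classic : set R.
  have mJ : measurable J by exact: measurable_itv.
  have JH : J `<=` half_line.
    by move=> x; rewrite /J /= !in_itv /= andbT => /andP[h _]; exact: lt_le_trans h.
  have h1 : (\int[mu]_(x in J) (cst k%:E x) = (k * N)%:E)%E.
    have muJ : mu J = N%:E.
      have := @lebesgue_measure_itv R `[r0, r0 + N]; rewrite /= lte_fin ltrDl => ->.
      case: ltP => h; first by rewrite -EFinB addrAC subrr add0r.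
      by have -> : N = 0 by apply/eqP; rewrite eq_le h N0.
    rewrite integral_cst; [exact: (congr1 (mule k%:E) muJ) | exact: measurable_itv].
  have h2 : (\int[mu]_(x in J) (cst k%:E x) <=
      \int[mu]_(x in J) `|(v x ^+ 2 * x)%:E|)%E.
    apply: ge0_le_integral => //.
    - by move=> x _; rewrite lee_fin ltW.
    - apply: measurableT_comp => //; exact: measurable_funS mv.
    - move=> x; rewrite /J /= in_itv /= => /andP[h _]; rewrite lee_fin.
      exact: le_trans (kv x h) (ler_norm _).
  have h3 : (\int[mu]_(x in J) `|(v x ^+ 2 * x)%:E| <= I)%E.
    apply: ge0_subset_integral => //.
    exact: measurableT_comp.
  by rewrite -h1; exact: le_trans h2 h3.
move: I0 vi key; case: I => // i; rewrite lee_fin => i0 _ key.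
have := key ((i + 1) / k) (ltac:(rewrite divr_ge0// ?(ltW k0)// addr_ge0//)).
rewrite lee_fin mulrCA mulfV ?gt_eqF// mulr1; lra.
Qed.

End EigenDecay.

Section EigenDecay2.
Variable R : realType.
Local Notation mu := (@lebesgue_measure R).
Local Notation half_line := (`]0, +oo[%classic : set R).
Implicit Types (f g v : R -> R) (r C tau lam rs x : R).

(** The operator has real coefficients, so real and imaginary parts can be
treated separately. *)
Lemma component_decays tau lam rs v v1 v2 : barrier tau lam rs ->
  real_derivative v v1 -> real_derivative v1 v2 ->
  {ae mu, forall r, 0 < r -> - v2 r - r^-1 * v1 r + (r - tau) ^+ 2 * v r = lam * v r} ->
  (fun r => r * `|v1 r|) @ 0^'+ --> (0 : R) ->
  mu.-integrable half_line (fun r => (v r ^+ 2 * r)%:E) ->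
  decays tau lam rs \/ forall r, 0 < r -> v r = 0.
Proof.
move=> B vd v1d ae tr vi.
have [c cP] := solution_multiple (ae_solution vd v1d ae) tr.
have [c0|c0] := eqVneq c 0; first by right=> r r0; rewrite cP// c0 mul0r.
left; apply: contrapT => nd; exact: (grows_not_L2 B nd c0 cP vi).
Qed.

Lemma Re_le_normc (z : R[i]) : `|complex.Re z| <= ComplexField.Normc.normc z.
Proof.
case: z => a b /=; rewrite -sqrtr_sqr; apply: ler_wsqrtr.
by rewrite lerDl sqr_ge0.
Qed.

Lemma Im_le_normc (z : R[i]) : `|complex.Im z| <= ComplexField.Normc.normc z.
Proof.
case: z => a b /=; rewrite -sqrtr_sqr; apply: ler_wsqrtr.
by rewrite lerDr sqr_ge0.
Qed.

Lemma trace_le f g : (forall r, 0 <= f r <= g r) ->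
  (fun r => r * g r) @ 0^'+ --> (0 : R) -> (fun r => r * f r) @ 0^'+ --> (0 : R).
Proof.
move=> fg; apply: (squeeze_cvgr (f := fun=> 0)); last exact: cvg_cst.
near=> r; have r0 : 0 < r by near: r; exact: nbhs_right_gt.
have /andP[f0 fgr] := fg r.
by rewrite mulr_ge0 ?(ltW r0)//= ler_wpM2l// ltW.
Unshelve. all: by end_near. Qed.

(** The norm hypotheses on a complex function pass to its components. *)
Lemma weight_integrable f g : measurable_fun half_line f -> (forall r, `|f r| <= g r) ->
  mu.-integrable half_line (fun r => (g r ^+ 2 * r)%:E) ->
  mu.-integrable half_line (fun r => (f r ^+ 2 * r)%:E).
Proof.
move=> mf fg; apply: le_integrable => //.
  apply/measurable_EFinP; apply: measurable_funM => //.
  exact: measurable_funX.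
move=> r; rewrite /= in_itv /= andbT => r0; rewrite lee_fin.
have g0 : 0 <= g r := le_trans (normr_ge0 _) (fg r).
rewrite !normrM (gtr0_norm r0) ler_wpM2r ?(ltW r0)// (ger0_norm g0).
by apply: ler_pM.
Qed.

Lemma eigenvalue_decays tau lam rs : barrier tau lam rs -> g_eigenvalue tau lam ->
  decays tau lam rs.
Proof.
move=> B [u [nz [u1 [u2 [[[[Lu _ _] [ur ui] [u1r u1i]] [_ _ _ tr]] ae]]]]].
have [mr mi ni] := Lu.
have hr : decays tau lam rs \/ forall r, 0 < r -> complex.Re (u r) = 0.
  apply: (component_decays B ur u1r).
  - case: ae => N [mN N0 sub]; exists N; split=> // r /= H; apply: sub => /= h; apply: H => r0.
    move: (congr1 (@complex.Re R) (h r0)).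
    by case: (u r) => a b; case: (u1 r) => a1 b1; case: (u2 r) => a2 b2 /=; lra.
  - by apply: trace_le tr => r; rewrite normr_ge0 Re_le_normc.
  - by apply: weight_integrable ni => // r; exact: Re_le_normc.
have hi : decays tau lam rs \/ forall r, 0 < r -> complex.Im (u r) = 0.
  apply: (component_decays B ui u1i).
  - case: ae => N [mN N0 sub]; exists N; split=> // r /= H; apply: sub => /= h; apply: H => r0.
    move: (congr1 (@complex.Im R) (h r0)).
    by case: (u r) => a b; case: (u1 r) => a1 b1; case: (u2 r) => a2 b2 /=; lra.
  - by apply: trace_le tr => r; rewrite normr_ge0 Im_le_normc.
  - by apply: weight_integrable ni => // r; exact: Im_le_normc.
case: hr => // hr; case: hi => // hi.
exfalso; apply: nz; exists set0; split=> // r /= H; apply: H => r0.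
by move: (hr r r0) (hi r r0); case: (u r) => a b /= -> ->.
Qed.

End EigenDecay2.

(** * Counting the eigenvalues *)

Section Counting.
Variable R : realType.
Implicit Types (C tau lam rs x l : R).

(** If [l < l'], the eigenvalues below [l'] include those below [l] and also
[l], so the two finite sets have different sizes. *)
Lemma nth_g_eigenvalue_uniq n tau l l' :
  nth_g_eigenvalue n tau l -> nth_g_eigenvalue n tau l' -> l = l'.
Proof.
wlog ll : l l' / l <= l'.
  by move=> h; case: (leP l l') => [|/ltW] ll' hl hl'; [|apply/esym]; exact: h.
move=> [el cl] [el' cl']; move: ll; rewrite le_eqVlt => /predU1P[//|ll].
set A := [set _ | _] in cl; set B := [set _ | _] in cl'.
have AB : A `<=` B by move=> m [em ml]; split=> //; exact: lt_trans ll.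
have fA : finite_set A by apply/finite_setP; exists n.-1.
have fB : finite_set B by apply/finite_setP; exists n.-1.
have : fset_set A = fset_set B.
  have /eqP// : fset_set A == fset_set B.
  rewrite eqEfcard (card_fset_set cl) (card_fset_set cl') leqnn andbT.
  by rewrite -fset_set_sub.
move=> /(fset_set_inj fA fB) e.
have : B l by split.
by rewrite -e => -[_]; rewrite ltxx.
Qed.

Lemma grows_open s tau lam rs : is_sign s -> grows s tau lam rs ->
  exists2 d, 0 < d & forall mu, `|lam - mu| < d -> grows s tau mu rs.
Proof.
move=> ss [r rr [f0 d0]].
have [K K0 KP] := phi_lip tau (`|lam| + 1) r.
pose m := Num.min (s * phi tau lam r) (s * dphi tau lam r).
have m0 : 0 < m by rewrite lt_min f0.
have mf : m <= s * phi tau lam r by rewrite ge_min lexx.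
have md : m <= s * dphi tau lam r by rewrite ge_min lexx orbT.
exists (Num.min 1 (m / (K + 1))).
  by rewrite lt_min ltr01 divr_gt0// ltr_wpDl.
move=> mu; rewrite lt_min => /andP[lm1 lm].
have hK : K * `|lam - mu| < m.
  apply: (@le_lt_trans _ _ ((K + 1) * `|lam - mu|)).
    by rewrite ler_wpM2r// lerDl.
  by rewrite mulrC -ltr_pdivlMr// ltr_wpDl.
have [||h1 h2] := KP lam mu _ _.
- by rewrite lerDl.
- have -> : mu = lam - (lam - mu) by ring.
  by apply: le_trans (ler_normB _ _) _; rewrite lerD2l ltW.
exists r => //; move: (le_lt_trans h1 hK) (le_lt_trans h2 hK).
rewrite !ltr_norml => /andP[a1 a2] /andP[b1 b2].
by split; case: ss mf md => -> mf md; rewrite ?mul1r ?mulN1r in mf md *; lra.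
Qed.

(** One barrier serves all energies up to [L], which lets them be compared
with each other. *)
Lemma barrier_far tau L lam : 0 <= tau -> 0 <= L -> lam <= L -> barrier tau lam (tau + L + 1).
Proof. by move=> t0 L0 lL; split=> [|r rr]; nra. Qed.

(** On an interval free of eigenvalues the sign at infinity is locally constant by
[grows_open] and [grows_uniq]; the intermediate value theorem applied to the
resulting locally constant function shows that it is constant. *)
Lemma grows_constant s tau L p q : 0 <= tau -> 0 <= L -> is_sign s -> p <= q -> q < L ->
  (forall lam, p <= lam <= q -> ~ decays tau lam (tau + L + 1)) ->
  grows s tau p (tau + L + 1) -> grows s tau q (tau + L + 1).
Proof.
move=> t0 L0 ss pq qL nd gp; set rs := tau + L + 1 in nd gp *.
apply: contrapT => ngq.
pose f lam : R := if `[< grows s tau lam rs >] then 1 else - 1.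
have loc lam : p <= lam <= q -> exists2 d, 0 < d & forall mu, `|lam - mu| < d -> f mu = f lam.
  move=> lpq; have [//|[t st gt]] := decays_or_grows tau lam rs; first by move/nd : lpq.
  have [d d0 dP] := grows_open st gt.
  exists (Num.min d (L - lam)).
    by rewrite lt_min d0 subr_gt0; case/andP: lpq => _; move/le_lt_trans; exact.
  move=> mu; rewrite lt_min => /andP[md mL]; have gm := dP mu md.
  have Bl : barrier tau lam rs.
    by apply: barrier_far => //; case/andP: lpq => _ /le_trans; apply; exact: ltW.
  have Bm : barrier tau mu rs.
    apply: barrier_far => //; move: mL; rewrite distrC; move: (ler_norm (mu - lam)); lra.
  rewrite /f; have [e|ne] := pselect (s = t).
    by rewrite !asboolT// e.
  by rewrite !asboolF// => h; apply: ne; [exact: grows_uniq Bl h gt ss st | exact: grows_uniq Bm h gm ss st].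
have [||c _] := @ivt0 _ f p q pq.
- move=> x xpq; have [d d0 dP] := loc x xpq.
  have c : {for x, continuous (fun _ : R => f x)} by exact: cst_continuous.
  have c' : f @ x --> f x; last exact: c'.
  apply: cvg_trans c; apply: near_eq_cvg.
  by apply/nbhs_ballP; exists d => //= y xy; rewrite dP.
- by rewrite /f asboolT// asboolF//; lra.
- by rewrite /f; case: ifP => _; lra.
Qed.

End Counting.

Section Enclosure.
Variable R : realType.
Variables (n : nat) (tau L : R) (p q : nat -> R).
Hypotheses (t0 : 0 <= tau) (L0 : 0 <= L).
Hypothesis pq : forall d, p d <= q d.
Hypothesis qp : forall d, q d < p d.+1.
Hypothesis qL : forall d, (d <= n)%N -> q d < L.
Hypothesis nosc : forall d lam, (d <= n)%N -> lam <= p d -> ~ oscillates tau lam d.+1.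
Hypothesis osc : forall d lam, (d <= n)%N -> q d <= lam -> oscillates tau lam d.+1.

Let rs := tau + L + 1.

Let B lam : lam <= L -> barrier tau lam rs.
Proof. exact: barrier_far. Qed.

Let pL d : (d <= n)%N -> p d < L.
Proof. by move=> /qL; apply: le_lt_trans. Qed.

Lemma oscillates_in_window d lam : (d <= n)%N -> p d <= lam -> oscillates tau lam d.
Proof.
case: d => [|d] dn pl; first exact: oscillates0.
by apply: osc (ltnW dn) _; apply: le_trans pl; exact: ltW.
Qed.

Lemma oscillates_above_eigenvalue d lam mu : lam < mu -> mu <= L -> g_eigenvalue tau lam ->
  oscillates tau lam d -> oscillates tau mu d.+1.
Proof.
move=> lm mL el ol; have lL := le_trans (ltW lm) mL.
exact: eigenvalue_oscillates lm (B lL) (B mL) (eigenvalue_decays (B lL) el) ol.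
Qed.

(** Without an eigenvalue in [[p d, q d]] the sign at infinity would be the same at
both ends.  At [p d] it is [(-1)^d], as there are exactly [d] sign changes;
at [q d] there are [d + 1] of them, and the sign [(-1)^d] would add one more,
which is impossible below [p d.+1]. *)
Lemma enclosure_exists d : (d < n)%N -> exists2 e, p d <= e <= q d & g_eigenvalue tau e.
Proof.
move=> dn; have dn' := ltnW dn; apply: contrapT => H.
have nd lam : p d <= lam <= q d -> ~ decays tau lam rs.
  move=> lpq dl; apply: H; exists lam => //; apply: decays_eigenvalue dl.
  by apply: B; case/andP: lpq => _ /le_trans; apply; exact/ltW/qL.
have pp : p d <= p d <= q d by rewrite lexx pq.
have qq : p d <= q d <= q d by rewrite lexx pq.
have [/nd//|[s ss gs]] := decays_or_grows tau (p d) rs.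
have gp : grows ((-1) ^+ d) tau (p d) rs.
  have [e|sE] := pselect (s = (-1) ^+ d); first by rewrite -e.
  case: (nosc dn' (lexx (p d))); apply: (grows_oscillates (rs := rs)); first by apply/B/ltW/pL.
    have -> // : (-1) ^+ d.+1 = s.
    by rewrite exprS; case: ss sE (sign_cases R d) => -> sE [] e; move: sE; rewrite e ?mulN1r ?opprK.
  exact: oscillates_in_window.
have gq : grows ((-1) ^+ d) tau (q d) rs.
  by apply: grows_constant (sign_cases R d) _ _ nd gp => //; exact: qL.
apply: (nosc dn (ltW (qp d))); apply: (grows_oscillates (rs := rs)).
- by apply/B/ltW/qL.
- by rewrite !exprS mulrA mulrNN mul1r mul1r.
- exact: osc.
Qed.

(** Starting from the [d] sign changes available at [p d], two eigenvalues would
produce two more of them before [p d.+1]. *)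
Lemma enclosure_unique d e e' : (d < n)%N -> p d <= e <= q d -> p d <= e' <= q d ->
  g_eigenvalue tau e -> g_eigenvalue tau e' -> e = e'.
Proof.
move=> dn; wlog ee : e e' / e <= e'.
  by move=> h; case: (leP e e') => [|/ltW] ee he he' ge ge'; [|apply/esym]; exact: h.
move=> /andP[pe _] /andP[_ eq'] ge ge'; move: ee; rewrite le_eqVlt => /predU1P[//|ee].
have e'p := le_lt_trans eq' (qp d); have e'L := ltW (lt_trans e'p (pL dn)).
have o1 := oscillates_above_eigenvalue ee e'L ge (oscillates_in_window (ltnW dn) pe).
by case: (nosc dn (lexx _)); exact: oscillates_above_eigenvalue e'p (ltW (pL dn)) ge' o1.
Qed.

(** An eigenvalue in a gap would produce a [d.+1]-st sign change before [p d]. *)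
Lemma enclosure_all d e : (d < n)%N -> e <= q d -> g_eigenvalue tau e ->
  exists2 j, (j <= d)%N & p j <= e <= q j.
Proof.
elim: d => [|d IH] dn eq' ge.
  exists 0%N => //; rewrite eq' andbT leNgt; apply/negP => ep.
  by case: (nosc (leq0n n) (lexx _)); exact: oscillates_above_eigenvalue ep (ltW (pL (leq0n n))) ge (oscillates0 _ _).
have [eqd|qe] := leP e (q d).
  by have [j jd je] := IH (ltnW dn) eqd ge; exists j => //; exact: leqW.
exists d.+1 => //; rewrite eq' andbT leNgt; apply/negP => ep.
case: (nosc (ltnW dn) (lexx _)); apply: oscillates_above_eigenvalue ep (ltW (pL (ltnW dn))) ge _.
by apply: osc (ltW qe); exact: ltnW (ltnW dn).
Qed.

Lemma zeta_enclosed : (0 < n)%N -> p n.-1 <= zeta n tau <= q n.-1.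
Proof.
case: n enclosure_exists enclosure_unique enclosure_all => // m ex un al _ /=.
have qp' i j : (i < j)%N -> q i < p j.
  elim: j => // j IH; rewrite ltnS leq_eqVlt => /predU1P[-> //|/IH h].
  by apply: lt_trans h _; exact: le_lt_trans (pq j) (qp j).
(* outside the range [d < m.+1] the value of [e] is a dummy *)
have /choice[e eP] : forall d, exists e, (d < m.+1)%N -> p d <= e <= q d /\ g_eigenvalue tau e.
  move=> d; have [dm|] := boolP (d < m.+1)%N; last by exists 0.
  by have [e e1 e2] := ex d dm; exists e.
have [em gm] := eP m (ltnSn m).
have elt i j : (i < j)%N -> (j < m.+1)%N -> e i < e j.
  move=> ij jm; have [/andP[_ h] _] := eP i (ltn_trans ij jm); have [/andP[h' _] _] := eP j jm.
  exact: le_lt_trans h (lt_le_trans (qp' _ _ ij) h').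
have nth : nth_g_eigenvalue m.+1 tau (e m).
  split=> //=; have -> : [set l | g_eigenvalue tau l /\ l < e m] = e @` `I_m.
    apply/seteqP; split=> [l [gl le]|_ [d dm <-]]; last first.
      by split; [have [] := eP d (ltnW dm) | exact: elt].
    have [|j jm lj] := al m l (ltnSn m) _ gl.
      by apply: le_trans (ltW le) _; case/andP: em.
    have [ej gj] := eP j jm; have le' := un j _ _ jm lj ej gl gj.
    exists j => //=; rewrite ltn_neqAle jm andbT; apply/eqP => jE.
    by move: le; rewrite le' jE ltxx.
  apply: inj_card_eq => i j; rewrite !inE /= => im jm eE.
  case: (ltngtP i j) => // h.
    by have := elt i j h (leqW jm); rewrite eE ltxx.
  by have := elt j i h (leqW im); rewrite eE ltxx.
suff -> : zeta m.+1 tau = e m by [].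
by rewrite /zeta; apply: xget_unique => // l ln; exact: nth_g_eigenvalue_uniq ln nth.
Qed.

End Enclosure.

(** The size of [tau] separates the windows and keeps them below the common
bound [2n + 3] on the energies. *)
Lemma zeta_bound (R : realType) (n : nat) (M C tau : R) : (0 < n)%N ->
  2 * n%:R + 5 <= M -> 9000 + 2 * M <= C -> C + 4 * M <= tau ->
  `|zeta n tau - (2 * n%:R - 1 - 1 / (4 * tau ^+ 2))| <= C / tau ^+ 3.
Proof.
move=> n0 nM MC Ct; have nR : 0 <= n%:R :> R by [].
have M4 : 4 <= M by clear -nM nR; lra.
have C1 : 1 <= C by clear -M4 MC; lra.
have tC : C < tau by clear -M4 Ct; lra.
have Mt : 4 * M <= tau by clear -C1 Ct; lra.
have t1 : 1 < tau by exact: le_lt_trans tC.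
have t0 : 0 < tau by exact: lt_trans t1.
pose x := (4 * tau ^+ 2)^-1; pose y := C / tau ^+ 3.
have x0 : 0 < x by rewrite invr_gt0 mulr_gt0// exprn_gt0.
have y0 : 0 <= y by rewrite divr_ge0 ?exprn_ge0// ?(ltW t0)// (le_trans _ C1).
have y1 : y < 1.
  rewrite ltr_pdivrMr ?exprn_gt0// mul1r; apply: lt_le_trans tC _.
  by rewrite -[leLHS]expr1 ler_weXn2l// ltW.
pose p d := 2 * (d%:R : R) + 1 - x - y; pose q d := 2 * (d%:R : R) + 1 - x + y.
have dM d : (d <= n)%N -> 2 * d%:R + 1 <= M.
  by rewrite -(ler_nat R) => dn; clear -dn nM; lra.
have /andP[] : p n.-1 <= zeta n tau <= q n.-1.
  apply: (@zeta_enclosed R n tau (2 * n%:R + 3) p q) => //.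
  - exact: ltW.
  - by move=> d; rewrite /p /q; clear -y0; lra.
  - by move=> d; rewrite /p /q -natr1; clear -y1; lra.
  - by move=> d; rewrite -(ler_nat R) /q; clear -y1 x0; lra.
  - by move=> d lam /dM dn lp; exact: oscillates_le dn M4 Mt MC lp.
  - by move=> d lam /dM dn lp; exact: oscillates_ge dn M4 Mt MC lp.
have -> : 1 / (4 * tau ^+ 2) = x by rewrite div1r.
have nE : n%:R = n.-1%:R + 1 :> R by rewrite natr1 prednK.
rewrite -/y nE /p /q ler_norml; clear; move=> h1 h2; apply/andP; split; lra.
Qed.

Theorem proposition2p4 (R : realType) (n : nat) (hn : (1 <= n)%N) :
  exists C : R, \forall tau \near +oo_R,
    `|zeta n tau - (2 * n%:R - 1 - 1 / (4 * tau ^+ 2))| <= C / tau ^+ 3.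
Proof.
pose M : R := 2 * n%:R + 5; exists (9000 + 2 * M); near=> tau.
apply: (@zeta_bound R n M) hn (lexx _) (lexx _) _.
by near: tau; apply: nbhs_pinfty_ge; exact: num_real.
Unshelve. all: by end_near. Qed.
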